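(* Let $\lambda$ be a real valued smooth function on $S^2$ with $1\le\lambda\le\Lambda$ on $S^2$, where $\Lambda>1$, such that $\lambda=1$ near the poles $\theta=0,\pi$, $\lambda=\Lambda$ at each point of the equator $\{\theta=\pi/2\}$, and $\lambda<\Lambda$ elsewhere. Let $S^3_0$ be the standard CR 3-sphere, and let $S^3_1$ be $S^3$ equipped with the CR structure whose $(0,1)$ vector space is spanned by $\overline W_1=\overline W_0-\nu W_0$, where $$\nu=\frac{\tilde\lambda^2-1}{\tilde\lambda^2+1}\,\frac{w_1w_2}{\overline w_1\overline w_2},\qquad \tilde\lambda=\lambda\circ p.$$ Then $\mathrm{id}_{S^3}:S^3_1\to S^3_0$ is an equivariantly extremal quasiconformal homeomorphism, namely, it has the least maximal dilatation among all $S^1$-equivariant quasiconformal homeomorphisms from $S^3_1$ to $S^3_0$.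
   Context: $S^3=\{(w_1,w_2)\in\mathbb C^2: |w_1|^2+|w_2|^2=1\}$ with contact form $\eta=-\mathrm{Im}(w_1d\overline w_1+w_2d\overline w_2)$ and contact bundle $HS^3=\ker\eta$. The circle action is $U_\phi(w_1,w_2)=(e^{i\phi}w_1,e^{i\phi}w_2)$; a homeomorphism $f$ of $S^3$ is $S^1$-equivariant if $f\circ U_\phi=U_\phi\circ f$ for all $\phi$. The Hopf projection is $p:S^3\to S^2=\mathbb C\cup\{\infty\}$, $p(w_1,w_2)=z=w_2/w_1$. Here $S^2$ is identified with the unit Euclidean sphere by stereographic projection, with spherical coordinates $(\theta,\phi)$, $0\le\theta\le\pi$, $0\le\phi<2\pi$ (so $\phi=\arg z$, the poles $\theta=0,\pi$ are $z=0,\infty$, the equator is $|z|=1$, and the spherical metric is $d\theta^2+\sin^2\theta\,d\phi^2=4|dz|^2/(1+|z|^2)^2$). $W_0=\overline w_2\frac{\partial}{\partial w_1}-\overline w_1\frac{\partial}{\partial w_2}$ spans the $(1,0)$ tangent space of $S^3_0$, the sphere with the CR structure inherited from $\mathbb C^2$. The function $\nu$ is understood to be $0$ where $w_1w_2=0$ (note $\tilde\lambda=1$ near there). Quasiconformality: for $j=0,1$ let $HS^3_j$ be $HS^3$ with the complex structure $J_j$ of $S^3_j$, and $|\cdot|_j$ the norm of any Hermitian metric on it. A differentiable curve is Legendrian if its tangent vectors lie in $HS^3$. A contact fibration $\Gamma$ of an open set $U$ is a smooth fibration of $U$ by smooth Legendrian curves. A subfamily $\Gamma_1\subset\Gamma$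 has measure zero if for every smooth surface $S$ transversal to each $\gamma\in\Gamma$ the set $\{S\cap\gamma:\gamma\in\Gamma_1\}$ has zero area in $S$. A homeomorphism $f:S^3_1\to S^3_0$ is ACL if for every open $U$ and every contact fibration $\Gamma$ of $U$, $f$ is absolutely continuous along all curves in $\Gamma$ outside a subfamily of measure zero. $f$ is quasiconformal if it is ACL, differentiable almost everywhere with differential $f_*$ preserving the contact bundle, and its maximal dilatation $$K(f)=\operatorname{ess\,sup}_{q}\frac{\max_{X\in H_qS^3_1,\,|X|_1=1}|f_*X|_0}{\min_{X\in H_qS^3_1,\,|X|_1=1}|f_*X|_0}$$ is finite. *)

(* Defs.v *)
From HB Require Import structures.
From mathcomp Require Import all_boot all_order all_algebra.
From mathcomp Require Import complex.
From mathcomp Require Import all_classical all_reals all_analysis.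
Set Implicit Arguments.
Unset Strict Implicit.
Unset Printing Implicit Defensive.
Import Order.TTheory GRing.Theory Num.Theory.
Import numFieldNormedType.Exports.
Local Open Scope classical_set_scope.
Local Open Scope complex_scope.
Local Open Scope ring_scope.

(* Smooth maps between (finite-dimensional) normed spaces.                    *)
Section Smooth.
Context {R : realType}.

Fixpoint class_C (V W : normedModType R) (k : nat) (U : set V) (f : V -> W)
    : Prop :=
  if k is k'.+1 then
    (forall x, U x -> differentiable f x) /\
    (forall v : V, class_C k' U (fun x => 'd f x v))
  else forall x, U x -> {for x, continuous f}.

(* meant for open U *)
Definition smooth_on (V W : normedModType R) (U : set V) (f : V -> W) : Prop :=
  forall k, class_C k U f.

Definition sphere (n : nat) : set 'rV[R]_n := [set x | \sum_i x 0 i ^+ 2 = 1].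

(* radial retraction onto the Euclidean unit sphere; `|x| is the sup norm *)
Definition retr (n : nat) (x : 'rV[R]_n) : 'rV[R]_n :=
  (Num.sqrt (\sum_i x 0 i ^+ 2))^-1 *: x.

(* retr is a smooth submersion of the punctured space onto the sphere, so a   *)
(* map on the sphere is smooth iff its composite with retr is; the values of  *)
(* F off the sphere are irrelevant.                                           *)
Definition sphere_smooth (n : nat) (W : normedModType R) (F : 'rV[R]_n -> W) :=
  smooth_on (~` [set 0]) (F \o @retr n).

Definition rel_open (V : normedModType R) (M A : set V) : Prop :=
  exists2 W, open W & A = M `&` W.

(* Velocity vectors at x of smooth curves contained in M: this is T_x M when  *)
(* M is an embedded submanifold.                                              *)
Definition tangent (V : normedModType R) (M : set V) (x v : V) : Prop :=
  exists c : R -> V, [/\ smooth_on setT c, forall t, M (c t), c 0 = x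
                       & derive1 c 0 = v].

(* psi is a smooth embedding of the open set U onto a relatively open part of *)
(* M, i.e. the inverse of a chart of M.                                       *)
Definition local_param (P V : normedModType R) (M : set V) (U : set P)
    (psi : P -> V) : Prop :=
  [/\ open U, smooth_on U psi,
      forall u v, U u -> 'd psi u v = 0 -> v = 0,
      {in U &, injective psi}
    & forall U', open U' -> U' `<=` U -> rel_open M (psi @` U')].

Definition abs_continuous (V : normedModType R) (a b : R) (g : R -> V) : Prop :=
  forall e, 0 < e -> exists2 d, 0 < d &
    forall (n : nat) (u v : 'I_n -> R),
      (forall i, [/\ a <= u i, u i <= v i & v i <= b]) ->
      (forall i j, i != j -> v i <= u j \/ v j <= u i) ->
      \sum_i (v i - u i) < d -> \sum_i `|g (v i) - g (u i)| < e.

End Smooth.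

(* C^2 as R^4: (w1, w2) = (q_0 + i q_1, q_2 + i q_3).                         *)
Section ContactSphere.
Context {R : realType}.
Implicit Types (q X Y : 'rV[R]_4) (M A : set 'rV[R]_4).
Implicit Type f : 'rV[R]_4 -> 'rV[R]_4.

Definition w1 q : R[i] := q 0 0 +i* q 0 1.
Definition w2 q : R[i] := q 0 2 +i* q 0 3.
Definition ofC2 (z1 z2 : R[i]) : 'rV[R]_4 :=
  \row_k [:: complex.Re z1; complex.Im z1; complex.Re z2; complex.Im z2]`_k.

Definition S3 : set 'rV[R]_4 := @sphere R 4.

Definition TS3 q : set 'rV[R]_4 := [set X | \sum_i q 0 i * X 0 i = 0].

Definition eta q X : R :=
  - complex.Im (w1 q * (w1 X)^* + w2 q * (w2 X)^*).

Definition HS3 q : set 'rV[R]_4 := [set X | TS3 q X /\ eta q X = 0].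

Definition circle_act (phi : R) q : 'rV[R]_4 :=
  let u := cos phi +i* sin phi in ofC2 (u * w1 q) (u * w2 q).

Definition equivariant f : Prop :=
  forall phi q, S3 q -> f (circle_act phi q) = circle_act phi (f q).

(* Maps of S^3 are represented by functions on R^4, of which only the         *)
(* restriction to S^3 matters.                                                *)
Definition homeomorphism_S3 f : Prop :=
  exists g : 'rV[R]_4 -> 'rV[R]_4,
    [/\ forall q, S3 q -> S3 (f q) /\ S3 (g q),
        forall q, S3 q -> g (f q) = q /\ f (g q) = q,
        {within S3, continuous f}
      & {within S3, continuous g}].

(* f is differentiable at q in S^3 iff f \o retr is, and then the restriction *)
(* to T_q S^3 of the differential of the latter is the differential of f.     *)
Definition differentiable_S3 f q : Prop := differentiable (f \o @retr R 4) q.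
Definition push f q X : 'rV[R]_4 := 'd (f \o @retr R 4) q X.

(* A subset of a smooth surface (resp. of S^3) is null iff its preimages by   *)
(* all local parametrizations are Lebesgue-null.                              *)
Definition area_null (S A : set 'rV[R]_4) : Prop :=
  forall (U : set (R * R)) (psi : R * R -> 'rV[R]_4), local_param S U psi ->
    (lebesgue_measure \x lebesgue_measure)%E.-negligible (U `&` psi @^-1` A).

Definition volume_null A : Prop :=
  forall (U : set (R * R * R)) (psi : R * R * R -> 'rV[R]_4),
    local_param S3 U psi ->
    ((lebesgue_measure \x lebesgue_measure) \x lebesgue_measure)%E.-negligible
      (U `&` psi @^-1` A).

Definition ae_S3 (P : 'rV[R]_4 -> Prop) : Prop :=
  volume_null [set q | S3 q /\ ~ P q].

Definition smooth_surface (S : set 'rV[R]_4) : Prop :=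
  S `<=` S3 /\
  forall x, S x -> exists (U : set (R * R)) (psi : R * R -> 'rV[R]_4),
    local_param S U psi /\ (psi @` U) x.

Definition legendrian (gamma : set 'rV[R]_4) : Prop :=
  forall q X, gamma q -> tangent gamma q X -> HS3 q X.

(* Phi is a local trivialization of the partition Gamma over D, whose fibres  *)
(* Phi(d, .) are lines, or circles R / Z.                                     *)
Definition trivialization (Gamma : set (set 'rV[R]_4)) (D : set (R * R))
    (Phi : R * R * R -> 'rV[R]_4) : Prop :=
  [/\ open D, smooth_on (D `*` setT) Phi,
      forall u v, (D `*` setT) u -> 'd Phi u v = 0 -> v = 0,
      forall d, D d -> Gamma [set Phi (d, t) | t in setT]
    & {in D `*` setT &, injective Phi} \/
      forall d d' t t', D d -> D d' ->
        (Phi (d, t) = Phi (d', t') <-> d = d' /\ exists k : int, t' = t + k%:~R)].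

(* Smooth fibre bundle, with base the (Hausdorff) leaf space of Gamma, whose  *)
(* fibres are Legendrian curves.                                              *)
Definition contact_fibration (U : set 'rV[R]_4) (Gamma : set (set 'rV[R]_4))
    : Prop :=
  [/\ rel_open S3 U,
      (\bigcup_(gamma in Gamma) gamma = U) /\ trivIset Gamma id,
      forall gamma, Gamma gamma -> exists D Phi, trivialization Gamma D Phi /\
        exists2 d, D d & gamma = [set Phi (d, t) | t in setT],
      forall gamma gamma', Gamma gamma -> Gamma gamma' -> gamma <> gamma' ->
        exists G G' : set (set 'rV[R]_4),
          [/\ G `<=` Gamma /\ G' `<=` Gamma, G gamma /\ G' gamma',
              G `&` G' = set0,
              rel_open S3 (\bigcup_(c in G) c)
            & rel_open S3 (\bigcup_(c in G') c)]
    & forall gamma, Gamma gamma -> legendrian gamma].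

Definition transversal (S gamma : set 'rV[R]_4) : Prop :=
  forall q, S q -> gamma q -> forall X, TS3 q X ->
    exists Y Z, [/\ tangent S q Y, tangent gamma q Z & X = Y + Z].

Definition measure_zero_subfamily (Gamma Gamma1 : set (set 'rV[R]_4)) : Prop :=
  Gamma1 `<=` Gamma /\
  forall S, smooth_surface S ->
    (forall gamma, Gamma gamma -> transversal S gamma) ->
    area_null S (S `&` \bigcup_(gamma in Gamma1) gamma).

(* absolute continuity on compact arcs, through regular parametrizations *)
Definition abs_continuous_along (gamma : set 'rV[R]_4) f : Prop :=
  forall c : R -> 'rV[R]_4, smooth_on setT c -> (forall t, derive1 c t != 0) ->
    (forall t, gamma (c t)) -> forall a b, abs_continuous a b (f \o c).

Definition ACL f : Prop :=
  forall U Gamma, contact_fibration U Gamma ->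
    exists2 Gamma1, measure_zero_subfamily Gamma Gamma1 &
      forall gamma, Gamma gamma -> ~ Gamma1 gamma -> abs_continuous_along gamma f.

(* Complex tangent vectors are elements of R[i] ^ 4, in the basis             *)
(* d/dx1, d/dy1, d/dx2, d/dy2.                                                *)
Definition d_w1 : 'rV[R[i]]_4 := 2^-1 *: (delta_mx 0 0 - 'i *: delta_mx 0 1).
Definition d_w2 : 'rV[R[i]]_4 := 2^-1 *: (delta_mx 0 2 - 'i *: delta_mx 0 3).

Definition W0 q : 'rV[R[i]]_4 := (w2 q)^* *: d_w1 - (w1 q)^* *: d_w2.

Definition conj_vec (Z : 'rV[R[i]]_4) : 'rV[R[i]]_4 :=
  map_mx (fun z : R[i] => z^*) Z.

(* J is the complex structure on the contact bundle whose (0,1) space, the    *)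
(* eigenspace for -i in the complexified contact bundle, is spanned by Wbar.  *)
(* Only the restriction of the endomorphism X |-> X *m J q to H_q S^3 matters.*)
Definition complex_structure (Wbar : 'rV[R]_4 -> 'rV[R[i]]_4)
    (J : 'rV[R]_4 -> 'M[R]_4) : Prop :=
  forall q, S3 q ->
    [/\ forall X, HS3 q X -> HS3 q (X *m J q),
        forall X, HS3 q X -> X *m J q *m J q = - X
      & Wbar q *m map_mx (real_complex R) (J q) = - 'i *: Wbar q].

(* The real part of a smooth Hermitian metric on (HS^3, J), as a Gram matrix; *)
(* only the restriction of the form to H_q S^3 matters.                       *)
Definition form (g : 'rV[R]_4 -> 'M[R]_4) q X Y : R := (X *m g q *m Y^T) 0 0.

Definition hermitian_metric (J g : 'rV[R]_4 -> 'M[R]_4) : Prop :=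
  sphere_smooth g /\
  forall q, S3 q ->
    [/\ forall X Y, HS3 q X -> HS3 q Y -> form g q X Y = form g q Y X,
        forall X, HS3 q X -> X != 0 -> 0 < form g q X X
      & forall X Y, HS3 q X -> HS3 q Y ->
          form g q (X *m J q) (Y *m J q) = form g q X Y].

Definition hnorm (g : 'rV[R]_4 -> 'M[R]_4) q X : R := Num.sqrt (form g q X X).

Local Open Scope ereal_scope.

(* The quotient of max |f_* X|_0 by min |f_* X|_0 over the unit circle of     *)
(* H_q S^3_1, read as +oo when the minimum is 0.                              *)
Definition dilatation (g1 g0 : 'rV[R]_4 -> 'M[R]_4) f q : \bar R :=
  let N := [set (hnorm g0 (f q) (push f q X))%:E
             | X in [set X | HS3 q X /\ hnorm g1 q X = 1%R]] in
  if ereal_inf N == 0 then +oo else ereal_sup N / ereal_inf N.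

Definition max_dilatation (g1 g0 : 'rV[R]_4 -> 'M[R]_4) f : \bar R :=
  ereal_inf [set K | ae_S3 (fun q => dilatation g1 g0 f q <= K)].

Definition quasiconformal (g1 g0 : 'rV[R]_4 -> 'M[R]_4) f : Prop :=
  [/\ homeomorphism_S3 f, ACL f,
      ae_S3 (fun q => differentiable_S3 f q /\
               forall X, HS3 q X -> HS3 (f q) (push f q X))
    & max_dilatation g1 g0 f < +oo].

End ContactSphere.

Section Deformation.
Context {R : realType}.

Definition S2 : set 'rV[R]_3 := @sphere R 3.

Definition spherical (theta phi : R) : 'rV[R]_3 :=
  \row_k [:: sin theta * cos phi; sin theta * sin phi; cos theta]`_k.

(* stereographic identification of C u {oo} with S^2, oo being None *)
Definition stereo (z : option R[i]) : 'rV[R]_3 :=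
  if z is Some (x +i* y) then
    (1 + x ^+ 2 + y ^+ 2)^-1 *:
      \row_k [:: 2 * x; 2 * y; 1 - x ^+ 2 - y ^+ 2]`_k
  else \row_k [:: 0; 0; -1]`_k.

Definition hopf (q : 'rV[R]_4) : option R[i] :=
  if w1 q == 0 then None else Some (w2 q / w1 q).

Definition nu (lam : 'rV[R]_3 -> R) (q : 'rV[R]_4) : R[i] :=
  let l := lam (stereo (hopf q)) in
  if w1 q * w2 q == 0 then 0
  else ((l ^+ 2 - 1) / (l ^+ 2 + 1))%:C
         * (w1 q * w2 q / ((w1 q)^* * (w2 q)^*)).

Definition W0bar (q : 'rV[R]_4) : 'rV[R[i]]_4 := conj_vec (W0 q).

Definition W1bar (lam : 'rV[R]_3 -> R) (q : 'rV[R]_4) : 'rV[R[i]]_4 :=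
  W0bar q - nu lam q *: W0 q.

End Deformation.

(* Main.v *)
(* Idea. Use the coordinates w1 = sqrt ((1 + y) / 2) e^(i (t - x / 2)),
   w2 = sqrt ((1 - y) / 2) e^(i (t + x / 2)), in which eta = dt - (y / 2) dx and
   the circle acts by translation of t. An eigenvector computation shows that
   the dilatation of the identity is lam ^ 2 <= Lam ^ 2.

   Conversely let f be equivariant with dilatation <= K almost everywhere, and
   let g (x, y) be f on a generic slice t = const. As f is ACL along the
   Legendrian curves {y, t - x y / 2 constant} and {x, t constant}, g is
   absolutely continuous on almost all coordinate lines, and since f preserves
   the contact bundle omega (g, g_x) = - y / 2 and omega (g, g_y) = 0. Integrated
   around small rectangles this gives omega (g_x, g_y) = 1 / 4 a.e.: the map of
   S^2 covered by f preserves area. The integrability of |dg| along the edges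
   comes from the fact that |dg| is bounded by the lower area density of the
   planar map w2 / w1 o g, whose integral is at most the area of the image.

   Hence the stretching of f along the horizontal lift X of d/dx satisfies
   lam ^ 2 |f_* X| ^ 2 <= K |X| ^ 2, so f is sqrt K / (2 lam)-Lipschitz in x on almost
   all lines y = const, and, letting y tend to 0, the curve x |-> f (x, 0, 0)
   above the equator is locally C-Lipschitz whenever C > sqrt K / (2 Lam). By
   equivariance this curve joins antipodal points of S^3 as x runs from 0 to
   2 pi, so its length is at least pi and Lam ^ 2 <= K. *)
From HB Require Import structures.
Require Import Defs.
From mathcomp Require Import all_boot all_order all_algebra.
From mathcomp Require Import complex.
From mathcomp Require Import all_classical all_reals all_analysis.
From mathcomp Require Import measurable_realfun.
From mathcomp Require Import ring lra.
Set Implicit Arguments.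
Unset Strict Implicit.
Unset Printing Implicit Defensive.
Import Order.TTheory GRing.Theory Num.Theory.
Import numFieldNormedType.Exports.
Local Open Scope classical_set_scope.
Local Open Scope ring_scope.

(** * Absolutely continuous functions *)

(** The ACL hypothesis gives no uniform control on the integral of the derivative, and the rows of a
    slice t = const are not even Legendrian: each row is carried to a Legendrian leaf by a circle
    rotation whose angle is affine in x, which is where equivariance first enters. Area preservation
    thus needs a Stokes argument without Sobolev regularity. Along the edges of a small rectangle dg
    need not be close to its value at the centre; it is enough that g is close to its affine
    approximation. As omega (g, dg) is prescribed, replacing g by that approximation in the first
    slot changes the integral by at most a constant times sup |g - affine| times the integral of
    |dg|, and the latter is O(r) on suitable edges. The dilatation bound serves twice: qualitatively
    it makes all horizontal stretchings comparable, so that their squares are controlled by the area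
    density of the quotient map; sharply, it turns area preservation into the bound on |f_* X|. The
    equator is a null set, so almost everywhere estimates cannot be read off on it; hence the limit
    y -> 0 and the strict inequality C > sqrt K / (2 Lam). *)

Lemma real_induction (R : realType) (P : R -> Prop) (a b : R) : a <= b -> P a ->
  (forall t, a < t <= b ->
     (forall e, 0 < e -> exists2 s, t - e < s < t & a <= s /\ P s) -> P t) ->
  (forall t, a <= t < b -> P t -> exists2 s, t < s <= b & P s) -> P b.
Proof.
move=> ab Pa Plim Pnext.
pose A := [set t | a <= t <= b /\ P t].
have Aa : A a by split => //; rewrite lexx.
have supA : has_sup A by split; [exists a|exists b => t [/andP[]]].
have aS : a <= sup A by apply: ub_le_sup => //; exact: supA.2.
have Sb : sup A <= b by apply: ge_sup; [exists a|move=> t [/andP[]]].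
have PS : P (sup A).
  case: (pselect (A (sup A))) => [[]//|nAS].
  apply: Plim.
    rewrite Sb andbT lt_neqAle aS andbT; apply/eqP => aE.
    by apply: nAS; rewrite -aE.
  move=> e e0; have [s As es] := sup_adherent e0 supA.
  exists s; last by case: As => /andP[].
  rewrite es/= lt_neqAle ub_le_sup ?andbT//; last exact: supA.2.
  by apply/eqP => sE; apply: nAS; rewrite -sE.
have [Sltb|bS] := ltP (sup A) b; last by rewrite (_ : b = sup A)//; apply/le_anti; rewrite bS.
have [|s /andP[Ss sb] Ps] := Pnext _ _ PS; first by rewrite aS.
have : s <= sup A.
  by apply: ub_le_sup; [exact: supA.2|split => //; rewrite sb (le_trans aS (ltW Ss))].
by rewrite leNgt Ss.
Qed.

Lemma le_lebesgue (R : realType) (A B : set R) :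
  measurable A -> measurable B -> A `<=` B ->
  (lebesgue_measure A <= lebesgue_measure B)%E.
Proof. by move=> mA mB AB; apply: le_measure => //; rewrite inE. Qed.

(** Ordered lists allow the real induction below to append one interval at a time. *)
Lemma abs_continuous_seq (R : realType) (g : R -> R) (a b e : R) :
  abs_continuous a b g -> 0 < e -> exists2 d, 0 < d &
    forall s : seq (R * R),
      all (fun p => [&& a <= p.1, p.1 <= p.2 & p.2 <= b]) s ->
      pairwise (fun p q => p.2 <= q.1) s ->
      \sum_(p <- s) (p.2 - p.1) < d -> \sum_(p <- s) `|g p.2 - g p.1| < e.
Proof.
move=> ac /ac [d d0 H]; exists d => // s sab sp.
rewrite !(big_nth (0, 0)) !big_mkord; apply: H => [i|i j ij].
  by have /and3P[] := all_nthP (0, 0) sab i (ltn_ord i).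
have /pairwiseP H := sp; have := H (0, 0) _ _ (ltn_ord _) (ltn_ord _).
by move: ij; rewrite neq_ltn => /orP[|] ij H'; [left|right]; exact: H'.
Qed.

(* Real induction on t, with invariant
   g t - g a <= e (t - a) + (variation of g over a finite family of intervals
   that lie in a small neighbourhood of the exceptional null set). *)
Lemma abs_continuous_nonincreasing (R : realType) (g : R -> R) (a b : R) :
  a <= b -> abs_continuous a b g ->
  (@lebesgue_measure R).-negligible [set t | a <= t <= b /\
    ~ forall e, 0 < e -> \forall s \near t, (g s - g t) * (s - t) <= e * (s - t) ^+ 2] ->
  g b <= g a.
Proof.
move=> ab ac [M [mM M0 subM]].
apply/ler_addgt0Pr => e e0.
(* Half of [e] pays for the slopes, half for the variation over the family; the [+ 1] keeps the
   denominator positive when [a = b]. *)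
pose e1 := e / (2 * (b - a + 1)).
have ba1 : 0 < b - a + 1 by lra.
have e10 : 0 < e1 by rewrite divr_gt0// mulr_gt0.
have e20 : 0 < e / 2 by lra.
have [d d0 Hd] := abs_continuous_seq ac e20.
have [|O [oO MO muO]] := lebesgue_regularity_outer mM _ d0.
  by rewrite [X in (X < _)%E]M0 ltry.
have mO := open_measurable oO.
have {}muO : (lebesgue_measure O < d%:E)%E.
  have -> : lebesgue_measure O = lebesgue_measure ((O `\` M) `|` M) :> \bar R.
    by rewrite setUC setDUK.
  apply: le_lt_trans muO.
  have := measureU2 lebesgue_measure (measurableD mO mM) mM.
  by move/le_trans; apply; rewrite [X in (_ + X <= _)%E]M0 adde0.
pose P t := exists s : seq (R * R), [/\
  all (fun p => [&& a <= p.1, p.1 <= p.2 & p.2 <= t]) s,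
  pairwise (fun p q => p.2 <= q.1) s,
  ((\sum_(p <- s) (p.2 - p.1))%:E <= lebesgue_measure (O `&` `[a, t]))%E &
  g t - g a <= e1 * (t - a) + \sum_(p <- s) `|g p.2 - g p.1|].
have mOI (I : interval R) : measurable (O `&` [set` I]).
  exact: measurableI.
(* Inside the neighbourhood [O] of the exceptional set, the interval itself joins the family; the
   measure of [O] keeps the total length below [d]. *)
have Pend t t' : a <= t <= t' -> `[t, t'] `<=` O -> P t -> P t'.
  move=> /andP[at_ tt'] sub [s [s1 s2 s3 s4]].
  exists (rcons s (t, t')); split.
  - rewrite all_rcons/= at_ tt' lexx/=; apply: sub_all s1 => p /and3P[-> -> /=].
    by move=> /le_trans; apply.
  - rewrite pairwise_rcons s2 andbT; apply: sub_all s1 => p /and3P[_ _].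
    by [].
  - rewrite big_rcons/= EFinD.
    apply: (@le_trans _ _ (lebesgue_measure (O `&` `[a, t]) + lebesgue_measure `]t, t'])%E).
      apply: leeD => //; rewrite lebesgue_measure_itv/= lte_fin.
      by case: ltP => // t't; rewrite lee_fin subr_le0.
    rewrite -measureU//; last 2 first.
    + exact: mOI.
    + rewrite -subset0 => x [[_]] /=; rewrite !in_itv/= => /andP[_ xt] /andP[].
      by rewrite ltNge xt.
    + apply: le_lebesgue; [by apply: measurableU => //; exact: mOI|exact: mOI|].
      move=> x [[Ox]|]; rewrite /= !in_itv/= => /andP[h1 h2].
        by split=> //=; rewrite h1 (le_trans h2).
      split; last by rewrite /= h2 (le_trans at_ (ltW h1)).
      by apply: sub; rewrite /= in_itv/= h2 (ltW h1).
  - rewrite big_rcons/=.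
    have := ler_norm (g t' - g t).
    have : e1 * (t - a) <= e1 * (t' - a) by rewrite ler_pM2l// lerB.
    lra.
(* At a point outside [O] the slope condition pays for the step and the family is unchanged. *)
have Pslope t t' : a <= t <= t' -> g t' - g t <= e1 * (t' - t) -> P t -> P t'.
  move=> /andP[at_ tt'] gtt' [s [s1 s2 s3 s4]]; exists s; split => //.
  - apply: sub_all s1 => p /and3P[-> -> /=].
    by move=> /le_trans; apply.
  - apply: (le_trans s3); apply: le_lebesgue; [exact: mOI|exact: mOI|].
    apply: setIS => x /=; rewrite !in_itv/= => /andP[->] /=.
    by move=> /le_trans; apply.
  - have -> : e1 * (t' - a) = e1 * (t - a) + e1 * (t' - t) by ring.
    lra.
suff [s [s1 s2 s3 s4]] : P b.
  have : \sum_(p <- s) `|g p.2 - g p.1| < e / 2.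
    apply: Hd => //; rewrite -lte_fin (le_lt_trans s3)//.
    apply: le_lt_trans muO; apply: le_lebesgue; [exact: mOI|exact: mO|].
    exact: subIsetl.
  have : e1 * (b - a) <= e / 2.
    rewrite /e1 invfM mulrA -mulrA ger_pMr//.
    by rewrite mulrC ler_pdivrMr// mul1r; lra.
  lra.
apply: (@real_induction _ _ a b) => //.
- exists [::]; split => //; first by rewrite big_nil measure_ge0.
  by rewrite big_nil !subrr mulr0 addr0.
- move=> t /andP[at_ tb] H.
  have [Ot|nOt] := pselect (O t).
    have /nbhs_ballP[r /= r0 rO] : nbhs t O by exact: open_nbhs_nbhs.
    have [s /andP[ts st] [as_ Ps]] := H _ r0.
    apply: (Pend s t _ _ Ps); first by rewrite as_ ltW.
    move=> x; rewrite /= in_itv/= => /andP[sx xt]; apply: rO.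
    by rewrite /ball/= ger0_norm; lra.
  have /(_ _ e10) /nbhs_ballP[r /= r0 rO] : forall e, 0 < e ->
      \forall s \near t, (g s - g t) * (s - t) <= e * (s - t) ^+ 2.
    apply: contrapT => nt; apply: nOt; apply: MO; apply: subM; split => //.
    by rewrite (ltW at_).
  have [s /andP[ts st] [as_ Ps]] := H _ r0.
  apply: (Pslope s t _ _ Ps); first by rewrite as_ ltW.
  have := rO s; rewrite /ball/= ger0_norm; last by lra.
  move=> /(_ ltac:(lra)).
  by move=> h; rewrite -(@ler_pM2r _ (t - s)) ?subr_gt0//; lra.
- move=> t /andP[at_ tb] Pt.
  have [Ot|nOt] := pselect (O t).
    have /nbhs_ballP[r /= r0 rO] : nbhs t O by exact: open_nbhs_nbhs.
    exists (Num.min b (t + r / 2)).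
      by rewrite lt_min tb ge_min lexx/= andbT; lra.
    apply: (Pend t _ _ _ Pt).
      by rewrite at_ le_min (ltW tb)/=; lra.
    move=> x; rewrite /= in_itv/= le_min => /and3P[tx xb xtr]; apply: rO.
    by rewrite /ball/= ler0_norm; lra.
  have /(_ _ e10) /nbhs_ballP[r /= r0 rO] : forall e, 0 < e ->
      \forall s \near t, (g s - g t) * (s - t) <= e * (s - t) ^+ 2.
    apply: contrapT => nt; apply: nOt; apply: MO; apply: subM; split => //.
    by rewrite at_ (ltW tb).
  set t' := Num.min b (t + r / 2).
  have tt' : t < t' by rewrite lt_min tb/=; lra.
  exists t'; first by rewrite tt' ge_min lexx.
  apply: (Pslope t _ _ _ Pt); first by rewrite at_ (ltW tt').
  have t'r : t' <= t + r / 2 by rewrite ge_min lexx orbT.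
  have := rO t'; rewrite /ball/= ler0_norm; last by lra.
  move=> /(_ ltac:(lra)).
  by move=> h; rewrite -(@ler_pM2r _ (t' - t)) ?subr_gt0//; lra.
Qed.

Lemma abs_continuous_id (R : realType) (a b : R) : abs_continuous a b (fun x : R => x).
Proof.
move=> e e0; exists e => // n u v H1 _; apply: le_lt_trans.
by apply: ler_sum => i _; rewrite ger0_norm// subr_ge0; have [] := H1 i.
Qed.

Lemma abs_continuous_dominated (R : realType) (V W U : normedModType R)
    (g : R -> V) (h : R -> W) (G : R -> U) (a b k : R) :
  abs_continuous a b g -> abs_continuous a b h ->
  (forall s t, a <= s -> s <= t -> t <= b ->
     `|G t - G s| <= k * (`|g t - g s| + `|h t - h s|)) ->
  abs_continuous a b G.
Proof.
move=> acg ach Hk e e0.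
have k0 : 0 < 2 * (`|k| + 1) by rewrite mulr_gt0// ltr_wpDl.
have [d1 d10 H1] := acg _ (divr_gt0 e0 k0).
have [d2 d20 H2] := ach _ (divr_gt0 e0 k0).
exists (Num.min d1 d2); first by rewrite lt_min d10.
move=> n u v uv disj; rewrite lt_min => /andP[s1 s2].
have {}H1 := H1 n u v uv disj s1; have {}H2 := H2 n u v uv disj s2.
apply: (@le_lt_trans _ _ ((`|k| + 1) * (\sum_i `|g (v i) - g (u i)| + \sum_i `|h (v i) - h (u i)|))).
  rewrite -big_split/= mulr_sumr; apply: ler_sum => i _.
  have [? ? ?] := uv i; apply: (le_trans (Hk _ _ _ _ _)) => //.
  rewrite ler_wpM2r ?addr_ge0//; have := ler_norm k; lra.
have -> : e = (`|k| + 1) * (e / (2 * (`|k| + 1)) + e / (2 * (`|k| + 1))).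
  by field; rewrite gt_eqF// ltr_wpDl.
by rewrite ltr_pM2l ?ltrD// ltr_wpDl.
Qed.

Lemma abs_continuous_monotone_comp (R : realType) (V : normedModType R)
    (g : R -> V) (h : R -> R) (a b c d k : R) :
  abs_continuous a b g ->
  (forall s t, c <= s -> s <= t -> t <= d ->
     [/\ a <= h s, h s <= h t, h t <= b & h t - h s <= k * (t - s)]) ->
  abs_continuous c d (g \o h).
Proof.
move=> acg H e e0; have [d1 d10 H1] := acg _ e0.
have k0 : 0 < `|k| + 1 by rewrite ltr_wpDl.
exists (d1 / (`|k| + 1)); first by rewrite divr_gt0.
move=> n u v uv disj; rewrite ltr_pdivlMr// => s.
apply: (H1 n (h \o u) (h \o v)).
- move=> i /=; have [? ? ?] := uv i.
  by have [] := H (u i) (v i).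
- move=> i j ij /=; have [? ? ?] := uv i; have [? ? ?] := uv j.
  have [?|?] := disj i j ij; [left|right].
  + have [] // := H (v i) (u j); [exact: le_trans (_ : u i <= _)|exact: le_trans (_ : _ <= v j) _].
  + have [] // := H (v j) (u i); [exact: le_trans (_ : u j <= _)|exact: le_trans (_ : _ <= v i) _].
- apply: le_lt_trans s; rewrite mulr_suml; apply: ler_sum => i _ /=.
  have [? uvi ?] := uv i; have [] // := H (u i) (v i) => _ _ _ /le_trans; apply.
  by rewrite mulrC ler_wpM2l ?subr_ge0//; have := ler_norm k; lra.
Qed.

Lemma abs_continuous_Rintegral (R : realType) (f : R -> R) (a b : R) :
  (@lebesgue_measure R).-integrable setT (EFin \o f) ->
  abs_continuous a b (fun y => \int[lebesgue_measure]_(t in `[a, y]) f t).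
Proof.
move=> intf e e0; have [d [d0 Hd]] := integral_normr_continuous intf e0.
exists d => // n u v uv disj suv.
have intS (A : set R) : measurable A -> (@lebesgue_measure R).-integrable A (EFin \o f).
  by move=> mA; apply: integrableS intf => //.
have tI : trivIset [set` index_enum 'I_n] (fun i => `]u i, v i]%classic).
  move=> i j _ _ [x [/=]]; rewrite !in_itv/= => /andP[ui vi] /andP[uj vj].
  apply/eqP; apply: contrapT => /negP /disj [] h.
    by move: (le_lt_trans (le_trans vi h) uj); rewrite ltxx.
  by move: (le_lt_trans (le_trans vj h) ui); rewrite ltxx.
pose D := \big[setU/set0]_(i <- index_enum 'I_n) `]u i, v i]%classic.
have mD : measurable D by apply: bigsetU_measurable.
have muD : (lebesgue_measure D < d%:E)%E.
  rewrite /D -bigcup_seq measure_fin_bigcup//= -fsbig_seq ?index_enum_uniq//.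
  rewrite (eq_bigr (fun i => (v i - u i)%:E)); first by rewrite sumEFin lte_fin.
  move=> i _; rewrite lebesgue_measure_itv/= lte_fin -EFinB.
  have [_ ui _] := uv i; case: ltP => // vi.
  by rewrite (_ : v i = u i) ?subrr//; apply/le_anti; rewrite ui vi.
apply: le_lt_trans (Hd D mD muD).
have -> : \int[lebesgue_measure]_(x in D) `|f x| =
    \sum_i \int[lebesgue_measure]_(x in `]u i, v i]) `|f x|.
  rewrite /Rintegral ge0_integral_bigsetU ?index_enum_uniq//=; last first.
  - apply/measurable_EFinP; apply: measurableT_comp => //.
    by apply/measurable_EFinP; have /measurable_int := intS _ mD.
  rewrite -sum_fine// => i _.
  have h := intS _ (measurable_itv `]u i, v i]).
  by have := integrable_fin_num _ (integrable_abse h); exact.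
apply: ler_sum => i _; have [au ui vb] := uv i.
rewrite Rintegral_itvB ?bnd_simp//; last exact: intS.
by apply: le_normr_Rintegral => //; exact: intS.
Qed.

(** Multiplying the difference quotient by [(s - t) ^+ 2] covers both sides of [t] at once and
    avoids dividing by zero at [s = t]. *)
Lemma is_derive_slope_le (R : realType) (g : R -> R) (t l e : R) :
  is_derive t 1 g l -> l <= 0 -> 0 < e ->
  \forall s \near t, (g s - g t) * (s - t) <= e * (s - t) ^+ 2.
Proof.
move=> [dg gl] l0 e0.
have : h^-1 *: (g (h + t) - g t) @[h --> 0^'] --> l.
  move: dg; rewrite /derivable => /cvg_ex[l' hl'].
  have : l' = l by rewrite -gl /derive; apply/esym/cvg_lim => //.
  by move=> <-; move: hl'; under eq_fun do rewrite /= [_ *: 1]mulr1.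
move/cvgrPdist_lt => /(_ _ e0).
move=> /nbhs_ballP[r /= r0 rO]; apply/nbhs_ballP; exists r => //= s st.
have [->|snt] := eqVneq s t; first by rewrite !subrr expr0n/= !mulr0.
move: st; rewrite /ball/= distrC => st.
have := rO (s - t); rewrite /ball/= sub0r normrN subr_eq0.
move=> /(_ st snt); rewrite subrK => h.
have : (s - t)^-1 * (g s - g t) < l + e.
  by rewrite -ltrBlDl; apply: le_lt_trans h; rewrite distrC ler_norm.
move=> {}h; have st0 : 0 < (s - t) ^+ 2 by rewrite exprn_even_gt0//= subr_eq0.
have -> : (g s - g t) * (s - t) = (s - t)^-1 * (g s - g t) * (s - t) ^+ 2.
  by field; rewrite subr_eq0.
by rewrite ler_pM2r//; lra.
Qed.

Lemma is_derive_sub_derive1 (R : realType) (g F : R -> R) (t l k : R) :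
  is_derive t 1 g l -> derivable F t 1 -> (F^`())%classic t = k ->
  is_derive t 1 (fun t => g t - F t) (l - k).
Proof.
move=> dg dF Fk; apply: is_deriveB => //.
by apply: DeriveDef => //; rewrite -derive1E.
Qed.

(** By Lebesgue differentiation the primitive [F] of [D] has derivative [D] almost everywhere, so
    [g - F] has nonpositive derivative almost everywhere and is nonincreasing. [D] is
    extended-valued because it will be an area density. *)
Lemma abs_continuous_le_integral (R : realType) (g : R -> R) (D : R -> \bar R) (a b : R) :
  a <= b -> abs_continuous a b g ->
  measurable_fun setT D -> (forall t, 0 <= D t)%E ->
  (\int[lebesgue_measure]_(t in `[a, b]) D t < +oo)%E ->
  (@lebesgue_measure R).-negligible [set t | a <= t <= b /\
    ~ exists2 l, is_derive t 1 g l & (`|l|%:E <= D t)%E] ->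
  ((g b - g a)%:E <= \int[lebesgue_measure]_(t in `[a, b]) D t)%E.
Proof.
move=> ab ac mD D0 intD Nneg.
(* A finite-valued integrable function on the whole line; it agrees with [D] almost everywhere on
   the interval. *)
pose f := (fine \o D) \_ `[a, b].
have intDab : lebesgue_measure.-integrable `[a, b] D.
  apply/integrableP; split; first exact: measurable_funTS.
  by under eq_integral do rewrite gee0_abs//.
have finD : \forall t \ae lebesgue_measure, `[a, b]%classic t -> D t \is a fin_num.
  exact: (integrable_ae _ intDab).
have intf1 : lebesgue_measure.-integrable `[a, b] (EFin \o (fine \o D)).
  apply/integrableP; split.
    by apply/measurable_EFinP; apply: (measurableT_comp (fine_measurable measurableT)); exact: measurable_funTS.
  apply: le_lt_trans intD; apply: ge0_le_integral => //.
  - apply: measurableT_comp => //; apply/measurable_EFinP.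
    by apply: (measurableT_comp (fine_measurable measurableT)); exact: measurable_funTS.
  - exact: measurable_funTS.
  - move=> x _ /=; move: (D0 x); case: (D x) => [r| |] //=; rewrite ?leey//.
    by rewrite lee_fin => r0; rewrite lee_fin ger0_norm.
have intf : lebesgue_measure.-integrable setT (EFin \o f).
  by rewrite /f -restrict_EFin; apply/integrable_restrict => //=; rewrite setTI.
have locf : locally_integrable setT f by apply: open_integrable_locally => //; exact: openT.
have intfy y : lebesgue_measure.-integrable [set` Interval (BLeft a) (BRight y)] (EFin \o f).
  by apply: integrableS intf.
have HF := FTC1 intfy locf.
set F := fun y => \int[lebesgue_measure]_(t in `[a, y]) f t.
have acF : abs_continuous a b F by exact: abs_continuous_Rintegral.
have : g b - F b <= g a - F a.
  apply: (@abs_continuous_nonincreasing _ (fun t => g t - F t) a b ab).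
    apply: (abs_continuous_dominated ac acF (k := 1)) => s t _ _ _.
    rewrite mul1r [X in `|X|](_ : _ = (g t - g s) - (F t - F s)); last by ring.
    exact: ler_normB.
  have Na : (@lebesgue_measure R).-negligible [set a].
    by apply/negligibleP => //; exact: lebesgue_measure_set1.
  have neg2 := negligibleU Nneg (negligibleU finD (negligibleU HF Na)).
  apply: negligibleS neg2 => t [tab nt]; apply: contrapT => /not_orP[h1 /not_orP[h2 /not_orP[h3 h4]]].
  apply: nt => e e0.
  have {h1}[l dl lD] : exists2 l, is_derive t 1 g l & (`|l|%:E <= D t)%E.
    by apply: contrapT => h; apply: h1.
  have {}h2 : D t \is a fin_num by apply: contrapT => h; apply: h2 => /= h'; apply: h; exact: h'.
  have {h3} : derivable F t 1 /\ (F^`())%classic t = f t.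
    apply: contrapT => h; apply: h3 => /= h'; apply: h; apply: h'.
    rewrite lte_fin lt_neqAle; move: tab => /andP[-> _]; rewrite andbT.
    by apply/eqP => at_; apply: h4; rewrite at_.
  move=> [dF Ft].
  have dgF := is_derive_sub_derive1 dl dF Ft.
  apply: (is_derive_slope_le dgF) => //.
  rewrite /f patchE mem_set ?in_itv//= subr_le0 -lee_fin fineK//.
  by apply: le_trans lD; rewrite lee_fin ler_norm.
rewrite /F [X in _ <= _ - X](_ : _ = 0); last first.
  by rewrite set_itv1 Rintegral_set1.
move=> gF; apply: (@le_trans _ _ (F b)%:E); first by rewrite lee_fin; rewrite /F; lra.
have -> : F b = \int[lebesgue_measure]_(t in `[a, b]) (fine (D t)).
  by apply: eq_Rintegral => x xab; rewrite /f patchE xab.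
rewrite /Rintegral fineK; last exact: integrable_fin_num.
apply: ge0_le_integral => //.
- by move=> x _; rewrite lee_fin fine_ge0.
- by have /measurable_int := intf1.
- exact: measurable_funTS.
- move=> x _; move: (D0 x); case: (D x) => //= _; exact: leey.
Qed.

(** * Area densities of planar maps *)

Section Liminf.
Context {R : realType}.
Implicit Types (u v : (\bar R)^nat) (C : \bar R).
Local Open Scope ereal_scope.

Lemma limn_einfE u : limn_einf u = ereal_sup (range (einfs u)).
Proof. by rewrite limn_einf_lim; apply/cvg_lim => //; exact: cvg_einfs_sup. Qed.

Lemma limn_einf_le u C : (forall n, u n <= C) -> limn_einf u <= C.
Proof.
move=> uC; rewrite limn_einfE; apply: ge_ereal_sup => _ [n _ <-].
by apply: ge_ereal_inf; exists (u n) => //; exists n => /=.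
Qed.

Lemma le_limn_einf_ev u C N : (forall n, (N <= n)%N -> C <= u n) -> C <= limn_einf u.
Proof.
move=> uC; rewrite limn_einfE; apply: le_trans (ereal_sup_ubound _).
  2: by exists N.
by apply: le_ereal_inf_tmp => _ [n /= Nn <-]; exact: uC.
Qed.

Lemma limn_einf_lt_frequently u C : limn_einf u < C ->
  forall N, exists2 n, (N <= n)%N & u n < C.
Proof.
move=> uC N; apply: contrapT => H; move: uC; rewrite ltNge => /negP; apply.
apply: (@le_limn_einf_ev _ _ N) => n Nn; rewrite leNgt; apply/negP => unC.
by apply: H; exists n.
Qed.

Lemma limn_einf_eq_ev u v N : (forall n, (N <= n)%N -> u n = v n) -> limn_einf u = limn_einf v.
Proof.
suff H u1 v1 : (forall n, (N <= n)%N -> u1 n = v1 n) -> limn_einf u1 <= limn_einf v1.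
  move=> uv; apply/le_anti; rewrite !H// => n Nn; exact/esym/uv.
move=> uv; rewrite limn_einfE; apply: ge_ereal_sup => _ [n _ <-].
apply: (@le_limn_einf_ev _ _ (maxn n N)) => k; rewrite geq_max => /andP[nk Nk].
rewrite -uv//; apply: ge_ereal_inf; exists (u1 k) => //; by exists k.
Qed.

Lemma measurable_fun_liminf d (T : measurableType d) (f : (T -> \bar R)^nat) :
  (forall n, measurable_fun setT (f n)) ->
  measurable_fun setT (fun x => limn_einf (f ^~ x)).
Proof.
move=> mf; rewrite /limn_einf; apply: measurableT_comp => //.
by apply: measurable_fun_limn_esup => n; exact: measurableT_comp.
Qed.

End Liminf.

(** The neighbourhood filters [N] stand in for a topology on the measurable type [T]. A countable
    base of measurable sets is what puts the open sets of R x R and of (R x R) x (R x R) into the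
    product sigma-algebra. *)
Definition countable_base d (T : measurableType d) (N : T -> set_system T) :=
  exists B : nat -> set T, (forall n, measurable (B n)) /\
    forall O x, (forall y, O y -> N y O) -> O x -> exists n, B n x /\ B n `<=` O.

Lemma countable_base_measurable d (T : measurableType d) (N : T -> set_system T) O :
  countable_base N -> (forall y, O y -> N y O) -> measurable O.
Proof.
move=> [B [mB HB]] oO.
have -> : O = \bigcup_n (if `[< B n `<=` O >] then B n else set0).
  apply/seteqP; split => x.
    move=> Ox; have [n [Bnx BO]] := HB _ _ oO Ox.
    by exists n => //; case: asboolP.
  by move=> [n _]; case: asboolP => // BO; exact: BO.
apply: bigcupT_measurable => n; by case: asboolP.
Qed.

Lemma countable_base_real (R : realType) : countable_base (fun x : R => nbhs x).
Proof.
pose B n : set R := if @unpickle (rat * rat)%type n is Some p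
  then [set` `]ratr p.1, ratr p.2[] else set0.
exists B; split; first by move=> n; rewrite /B; case: unpickle.
move=> O x oO Ox; have /nbhs_ballP[e /= e0 eO] := oO _ Ox.
have h1 : x - e < x by rewrite ltrBlDr ltrDl.
have h2 : x < x + e by rewrite ltrDl.
have [q qx] := rat_in_itvoo h1; have [r rx] := rat_in_itvoo h2.
exists (pickle (q, r)); rewrite /B pickleK.
move: qx rx; rewrite !in_itv/= => /andP[q1 q2] /andP[r1 r2].
split; first by rewrite /= in_itv/= q2.
move=> y /=; rewrite in_itv/= => /andP[y1 y2]; apply: eO.
by rewrite /ball/= ltr_norml; apply/andP; split; lra.
Qed.

Lemma countable_base_prod d1 d2 (T1 : measurableType d1) (T2 : measurableType d2)
    (N1 : T1 -> set_system T1) (N2 : T2 -> set_system T2) :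
  (forall x A, N1 x A -> exists A', [/\ A' `<=` A, A' x & forall y, A' y -> N1 y A']) ->
  (forall x A, N2 x A -> exists A', [/\ A' `<=` A, A' x & forall y, A' y -> N2 y A']) ->
  countable_base N1 -> countable_base N2 ->
  countable_base (fun x : T1 * T2 => filter_prod (N1 x.1) (N2 x.2)).
Proof.
move=> o1 o2 [B1 [mB1 H1]] [B2 [mB2 H2]].
exists (fun n => if @unpickle (nat * nat)%type n is Some p then B1 p.1 `*` B2 p.2 else set0).
split; first by move=> n; case: unpickle => // p; exact: measurableX.
move=> O x oO Ox; have [[A1 A2] /= [NA1 NA2] AO] := oO _ Ox.
have [A1' [s1 x1 oA1]] := o1 _ _ NA1; have [A2' [s2 x2 oA2]] := o2 _ _ NA2.
have [n1 [Bx1 Bs1]] := H1 _ _ oA1 x1; have [n2 [Bx2 Bs2]] := H2 _ _ oA2 x2.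
exists (pickle (n1, n2)); rewrite pickleK; split => //= y [y1 y2].
by apply: AO; split; [apply/s1/Bs1|apply/s2/Bs2].
Qed.

Lemma nbhs_open_sub (T : topologicalType) (x : T) (A : set T) :
  nbhs x A -> exists A', [/\ A' `<=` A, A' x & forall y, A' y -> nbhs y A'].
Proof.
move=> NA; exists (interior A); split; [exact: interior_subset|exact: NA|].
by move=> y Ay; apply: open_nbhs_nbhs; split => //; exact: open_interior.
Qed.

Lemma open_measurable2 (R : realType) (O : set (R * R)) : open O -> measurable O.
Proof.
move=> oO; apply: (countable_base_measurable (N := fun x : R * R => filter_prod (nbhs x.1) (nbhs x.2))).
  apply: countable_base_prod; [exact: nbhs_open_sub|exact: nbhs_open_sub|exact: countable_base_real|exact: countable_base_real].
by move=> y Oy; have : nbhs y O by exact: open_nbhs_nbhs.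
Qed.

Lemma open_measurable22 (R : realType) (O : set ((R * R) * (R * R))) : open O -> measurable O.
Proof.
move=> oO; apply: (countable_base_measurable (N := fun x : (R * R) * (R * R) => filter_prod (nbhs x.1) (nbhs x.2))).
  have H : countable_base (fun x : R * R => nbhs x).
    by apply: countable_base_prod; [exact: nbhs_open_sub|exact: nbhs_open_sub|exact: countable_base_real|exact: countable_base_real].
  by apply: countable_base_prod => //; exact: nbhs_open_sub.
by move=> y Oy; have : nbhs y O by exact: open_nbhs_nbhs.
Qed.

(** * Lebesgue measure of the plane *)

Section Lebesgue2.
Context {R : realType}.
Local Open Scope ereal_scope.

(** A name for the product measure, to which the sigma-finite structure is attached below; Tonelli
    for pairs of points of the plane takes it as both factors. *)
Definition leb2 : set (measurableTypeR R * measurableTypeR R) -> \bar R :=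
  (lebesgue_measure \x lebesgue_measure)%E.

HB.instance Definition _ := Measure.on leb2.

Lemma leb2_rect (a b c d : R) : (a <= b)%R -> (c <= d)%R ->
  leb2 (`]a, b[ `*` `]c, d[) = ((b - a) * (d - c))%:E.
Proof.
move=> ab cd; rewrite [LHS]product_measure1E//= !lebesgue_measure_itv/= !lte_fin.
case: ltP => [_|ba]; last first.
  by rewrite mul0e (_ : b = a) ?subrr ?mul0r//; apply/le_anti; rewrite ab ba.
case: ltP => [_|dc]; last first.
  by rewrite mule0 (_ : d = c) ?subrr ?mulr0//; apply/le_anti; rewrite cd dc.
by rewrite -!EFinB -EFinM.
Qed.

Let leb2_sigma_finite : sigma_finite setT leb2.
Proof.
exists (fun n => `](- n%:R)%R, n%:R%R[ `*` `](- n%:R)%R, n%:R%R[).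
  apply/esym/seteqP; split => // -[x y] _.
  exists (Num.truncn (Num.max `|x| `|y|)%R).+1 => //.
  have : (Num.max `|x| `|y| < (Num.truncn (Num.max `|x| `|y|)).+1%:R)%R by exact: truncnS_gt.
  by rewrite gt_max => /andP[xn yn]; split; rewrite /= in_itv/= -ltr_norml.
move=> n; split; first exact: measurableX.
by rewrite leb2_rect ?ltry// lerNl; apply: (le_trans _ (ler0n R n)); rewrite oppr_le0.
Qed.

HB.instance Definition _ := Measure_isSigmaFinite.Build _ _ _ leb2 leb2_sigma_finite.

End Lebesgue2.

(** * Lower area density and its integral *)

Section Density.
Context {R : realType}.
Implicit Types (F : R * R -> R * R) (V : set (R * R)) (z : R * R).
Local Open Scope ereal_scope.

Lemma ball_rect (z : R * R) (r : R) :
  ball z r = `](z.1 - r)%R, (z.1 + r)%R[ `*` `](z.2 - r)%R, (z.2 + r)%R[.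
Proof.
have H (x y : R) : ball x r y <-> y \in `](x - r)%R, (x + r)%R[.
  by rewrite /ball/= in_itv/= ltr_norml; split => /andP[? ?]; apply/andP; split; lra.
by apply/seteqP; split => w [/H w1 /H w2].
Qed.

Lemma leb2_ball z (r : R) : (0 <= r)%R -> leb2 (ball z r) = (4 * r ^+ 2)%:E.
Proof.
move=> r0; rewrite ball_rect leb2_rect; [|lra|lra]; congr (_%:E); ring.
Qed.

Let rad (n : nat) : R := n.+1%:R^-1.

(* The pairs (z, F w) with |w - z| < 1 / (n + 1): its vertical sections are the
   images of balls, its horizontal ones are balls, which is what Tonelli needs. *)
Definition image_graph F V n : set ((R * R) * (R * R)) :=
  [set p | V p.1 /\ exists2 w, V w & ball p.1 (rad n) w /\ F w = p.2].

Definition area_density F V z : \bar R :=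
  limn_einf (fun n => (n.+1%:R ^+ 2)%:E * leb2 (xsection (image_graph F V n) z)).

Lemma open_image_graph F V n : open V ->
  (forall O, open O -> O `<=` V -> open (F @` O)) -> open (image_graph F V n).
Proof.
move=> oV oF; rewrite openE => -[z y] [/= Vz [w Vw [zw Fw]]].
have [e e0 He] : exists2 e : R, (0 < e)%R & forall z', ball z e z' -> forall w', ball w e w' -> ball z' (rad n) w'.
  move: zw; rewrite /ball/= => -[z1 z2].
  exists (Num.min ((rad n - `|z.1 - w.1|) / 2) ((rad n - `|z.2 - w.2|) / 2))%R.
    by rewrite lt_min; apply/andP; split; move: z1 z2; rewrite /ball/=; lra.
  move=> z' [/=]; rewrite /ball/= !lt_min => /andP[a1 a2] /andP[a3 a4].
  move=> w' [/=]; rewrite /ball/= !lt_min => /andP[b1 b2] /andP[b3 b4].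
  split.
    rewrite /ball/=; have -> : (z'.1 - w'.1 = (z.1 - w.1) - (z.1 - z'.1) + (w.1 - w'.1))%R by ring.
    apply: (le_lt_trans (ler_normD _ _)); have := ler_normB (z.1 - w.1)%R (z.1 - z'.1)%R; lra.
  rewrite /ball/=; have -> : (z'.2 - w'.2 = (z.2 - w.2) - (z.2 - z'.2) + (w.2 - w'.2))%R by ring.
  apply: (le_lt_trans (ler_normD _ _)); have := ler_normB (z.2 - w.2)%R (z.2 - z'.2)%R; lra.
have oB (x : R * R) : open (ball x e) by exact: ball_open.
have oVw : open (F @` (V `&` ball w e)) by apply: oF; [exact: openI|exact: subIsetl].
exists (V `&` ball z e, F @` (V `&` ball w e)) => /=.
  split; first by apply: filterI; [exact: open_nbhs_nbhs|exact: nbhsx_ballx].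
  by apply: open_nbhs_nbhs; split => //; exists w => //; split => //; exact: ballxx.
move=> t [] /= [Vz' zz'] [w' [Vw' ww'] Fw']; split => //.
by exists w' => //; split => //; exact: (He _ zz').
Qed.

Section OpenInjective.
Variables (F : R * R -> R * R) (V : set (R * R)).
Hypotheses (oV : open V) (iF : {in V &, injective F})
  (oF : forall O, open O -> O `<=` V -> open (F @` O)).

Let M2 := (measurableTypeR R * measurableTypeR R)%type.

Let mG n : measurable (image_graph F V n : set (M2 * M2)).
Proof. by apply: open_measurable22; exact: open_image_graph. Qed.

Let mxG n : measurable_fun (setT : set M2) (fun z => leb2 (xsection (image_graph F V n) z)).
Proof. exact: (measurable_fun_xsection leb2 (mG n)). Qed.

Let myG n : measurable_fun (setT : set M2) (fun z => leb2 (ysection (image_graph F V n) z)).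
Proof. exact: (measurable_fun_ysection leb2 (mG n)). Qed.

Lemma measurable_area_density :
  measurable_fun (setT : set (measurableTypeR R * measurableTypeR R)) (area_density F V).
Proof.
apply: measurable_fun_liminf => n; apply: measurable_funeM.
exact: mxG.
Qed.

Lemma area_density_ge0 z : 0 <= area_density F V z.
Proof.
apply: (@le_limn_einf_ev _ _ _ 0%N) => n _.
by rewrite mule_ge0// ?lee_fin ?sqr_ge0//; exact: measure_ge0.
Qed.

(** Fatou reduces the claim to one radius. Tonelli then exchanges the images of balls for the
    horizontal sections, and by injectivity the section at [F w] lies in the ball around the single
    point [w], of area 4 / (n + 1)^2, which cancels the normalization. *)
Lemma integral_area_density :
  \int[leb2]_z area_density F V z <= 4%:E * leb2 (F @` V).
Proof.
have mk n : measurable_fun (setT : set M2) (fun z => (n.+1%:R ^+ 2)%:E * leb2 (xsection (image_graph F V n) z)).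
  by apply: measurable_funeM; exact: mxG.
have k0 n z : setT z -> 0 <= (n.+1%:R ^+ 2)%:E * leb2 (xsection (image_graph F V n) z).
  by move=> _; rewrite mule_ge0// ?lee_fin ?sqr_ge0//; exact: measure_ge0.
apply: (le_trans (fatou leb2 measurableT mk k0)).
apply: limn_einf_le => n.
have mFV : measurable (F @` V : set M2) by apply: open_measurable2; exact: oF.
rewrite ge0_integralZl//.
have -> : \int[leb2]_z leb2 (xsection (image_graph F V n) z) =
    \int[leb2]_y leb2 (ysection (image_graph F V n) y).
  have := indic_fubini_tonelli leb2 leb2 (mG n).
  by rewrite indic_fubini_tonelli_FE ?indic_fubini_tonelli_GE.
have H y : leb2 (ysection (image_graph F V n) y) <= (4 * rad n ^+ 2)%:E * (\1_(F @` V) y)%:E.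
  rewrite indicE; have [|/negP] := boolP (y \in F @` V).
    rewrite inE => -[w Vw <-]; rewrite mule1 -(@leb2_ball w) ?invr_ge0//.
    apply: le_measure; rewrite ?inE.
    - by have := measurable_ysection (F w) (mG n).
    - by apply: open_measurable2; exact: ball_open.
    - move=> z; rewrite /ysection/= inE => -[/= Vz [w' Vw' [zw' Fw']]].
      rewrite -(iF _ _ Fw') ?inE//; exact: ball_sym.
  move=> nV; rewrite mule0 (_ : ysection _ _ = set0) ?measure0//.
  apply/seteqP; split => // z; rewrite /ysection/= inE => -[/= Vz [w' Vw' [_ Fw']]].
  by apply: nV; rewrite inE; exists w'.
apply: (@le_trans _ _ ((n.+1%:R ^+ 2)%:E * ((4 * rad n ^+ 2)%:E * leb2 (F @` V)))).
  apply: lee_wpmul2l; first by rewrite lee_fin sqr_ge0.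
  have -> : (4 * rad n ^+ 2)%:E * leb2 (F @` V) = \int[leb2]_y ((4 * rad n ^+ 2)%:E * (\1_(F @` V) y)%:E).
    rewrite ge0_integralZl//.
    - by rewrite integral_indic// setIT.
    - by apply/measurable_EFinP; exact: measurable_indic.
    - by rewrite lee_fin mulr_ge0// sqr_ge0.
  apply: ge0_le_integral => //.
  by apply: measurable_funeM; apply/measurable_EFinP; exact: measurable_indic.
rewrite muleA -EFinM (_ : _ * _ = 4)%R// /rad.
by rewrite mulrCA -exprMn divff ?expr1n ?mulr1.
Qed.

End OpenInjective.

Lemma area_density_local F V V' z : open V' -> V' `<=` V -> V' z ->
  area_density F V' z = area_density F V z.
Proof.
move=> oV' sV Vz; have /nbhs_ballP[e /= e0 eV] : nbhs z V' by exact: open_nbhs_nbhs.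
have [N _ HN] := near_infty_natSinv_lt (PosNum e0).
apply: (@limn_einf_eq_ev _ _ _ N) => n Nn; congr (_ * leb2 _).
apply/seteqP; split => y; rewrite /xsection/= !inE => -[/= _ [w Vw [zw Fw]]].
  by split; [exact: sV|exists w => //; exact: sV].
split => //; exists w => //; apply: eV.
by apply: le_ball zw; exact/ltW/HN.
Qed.

(** A finite lower limit bounds the image areas along infinitely many radii, and arbitrarily small
    good radii are all that [area_preserving_at] asks for. *)
Lemma area_density_lt (F : R * R -> R * R) V z : open V -> V z ->
  area_density F V z < +oo ->
  exists M : R, forall N, exists2 n, (N <= n)%N &
    leb2 (F @` ball z (rad n)) <= (M * rad n ^+ 2)%:E.
Proof.
move=> oV Vz; case E : (area_density F V z) => [r| |] // _; last first.
  by have := area_density_ge0 F V z; rewrite E.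
have /nbhs_ballP[e /= e0 eV] : nbhs z V by exact: open_nbhs_nbhs.
have [N0 _ HN] := near_infty_natSinv_lt (PosNum e0).
exists (r + 1)%R => N.
have [] := @limn_einf_lt_frequently R (fun n => (n.+1%:R ^+ 2)%:E * leb2 (xsection (image_graph F V n) z)) (r + 1)%:E _ (maxn N N0).
  by rewrite -/(area_density F V z) E lte_fin ltrDl.
move=> n; rewrite geq_max => /andP[Nn N0n] H; exists n => //.
have -> : F @` ball z (rad n) = xsection (image_graph F V n) z.
  apply/seteqP; split => y; rewrite /xsection/= inE.
    move=> [w zw <-]; split => //; exists w => //; apply: eV.
    by apply: le_ball zw; exact/ltW/HN.
  by move=> [/= _ [w Vw [zw Fw]]]; exists w.
have -> : (((r + 1) * rad n ^+ 2)%:E = (rad n ^+ 2)%:E * (r + 1)%:E) by rewrite -EFinM mulrC.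
have -> : leb2 (xsection (image_graph F V n) z) = (rad n ^+ 2)%:E * ((n.+1%:R ^+ 2)%:E * leb2 (xsection (image_graph F V n) z)).
  by rewrite muleA -EFinM -exprMn mulVf ?expr1n ?mul1e.
by apply: lee_wpmul2l; [rewrite lee_fin sqr_ge0|exact: ltW].
Qed.

Lemma le_area_density F V z (m e : R) : open V -> V z -> (0 <= m)%R -> (0 < e)%R ->
  (forall r, (0 < r < e)%R -> ((m * r) ^+ 2)%:E <= leb2 (F @` ball z r)) ->
  (m ^+ 2)%:E <= area_density F V z.
Proof.
move=> oV Vz m0 e0 H.
have /nbhs_ballP[e1 /= e10 eV] : nbhs z V by exact: open_nbhs_nbhs.
have [N1 _ HN1] := near_infty_natSinv_lt (PosNum e10).
have [N _ HN] := near_infty_natSinv_lt (PosNum e0).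
apply: (@le_limn_einf_ev _ _ _ (maxn N1 N)) => n; rewrite geq_max => /andP[N1n Nn].
have <- : F @` ball z (rad n) = xsection (image_graph F V n) z.
  apply/seteqP; split => y; rewrite /xsection/= inE.
    move=> [w zw <-]; split => //; exists w => //; apply: eV.
    by apply: le_ball zw; exact/ltW/HN1.
  by move=> [/= _ [w Vw [zw Fw]]]; exists w.
have -> : ((m ^+ 2)%:E = (n.+1%:R ^+ 2)%:E * ((m * rad n) ^+ 2)%:E).
  by rewrite -EFinM -exprMn mulrCA divff ?mulr1.
apply: lee_wpmul2l; first by rewrite lee_fin sqr_ge0.
by apply: H; rewrite invr_gt0 ltr0n/=; exact: HN.
Qed.

End Density.

Section BallImage.
Context {R : realType}.

Lemma convex_connected (V : normedModType R) (A : set V) (c : V) : A c ->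
  (forall y t, A y -> 0 <= t <= 1 -> A (c + t *: (y - c))) -> connected A.
Proof.
move=> Ac star.
have -> : A = \bigcup_(y in A) ((fun t : R => c + t *: (y - c)) @` `[0, 1]).
  apply/seteqP; split => [y Ay|_ [y Ay [t t01 <-]]]; last first.
    by apply: star => //; move: t01; rewrite /= in_itv.
  exists y => //; exists 1; first by rewrite /= in_itv/= ler01 lexx.
  by rewrite scale1r addrC subrK.
apply: bigcup_connected.
  exists c => y Ay; exists 0; first by rewrite /= in_itv/= ler01 lexx.
  by rewrite scale0r addr0.
move=> y Ay; apply: connected_continuous_connected; first exact: segment_connected.
apply: continuous_subspaceT => t.
by apply: cvgD; [exact: cvg_cst|apply: cvgZr_tmp; exact: cvg_id].
Qed.

(* Connectedness of the ball replaces degree theory. *)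
Lemma ball_sub_image (F : R * R -> R * R) (V : set (R * R)) z (r m : R) :
  (forall w, V w -> {for w, continuous F}) ->
  (forall O, open O -> O `<=` V -> open (F @` O)) ->
  0 < r -> (forall w, `|w - z| <= r -> V w) ->
  (forall w, `|w - z| = r -> m <= `|F w - F z|) ->
  ball (F z) m `<=` F @` ball z r.
Proof.
move=> cF oF r0 sV Hm y By.
have m0 : 0 < m.
  by move: By; rewrite -ball_normE/=; apply: le_lt_trans.
pose K := `[z.1 - r, z.1 + r]%classic `*` `[z.2 - r, z.2 + r]%classic.
have KE w : K w <-> `|w - z| <= r.
  rewrite prod_normE/= ge_max !ler_distl /K /=; rewrite !in_itv/=.
  by split => [[-> ->]//|/andP[]].
have sb w : ball z r w -> `|w - z| <= r.
  by rewrite -ball_normE/= distrC => /ltW.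
(* The image of the ball is open, and within [ball (F z) m] it coincides with the compact image of
   the closed square [K], whose boundary is sent outside: it is a nonempty open and closed part of a
   connected set. *)
have zb : ball (F z) m `&` (F @` ball z r) = ball (F z) m.
  have con : connected (ball (F z) m).
    apply: (@convex_connected _ _ (F z)); first exact: ballxx.
    move=> v t; rewrite -!ball_normE/= => v1 /andP[t0 t1].
    rewrite opprD addrA subrr sub0r normrN normrZ ger0_norm//.
    by apply: le_lt_trans v1; rewrite distrC ler_piMl.
  apply: con.
  - by exists (F z); split; [exact: ballxx|exists z => //; exact: ballxx].
  - exists (F @` ball z r) => //; apply: oF; first exact: ball_open.
    by move=> w /sb; exact: sV.
  - exists (F @` K).
      apply: compact_closed; first exact: norm_hausdorff.
      apply: continuous_compact; last by apply: compact_setX; exact: segment_compact.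
      by apply: continuous_in_subspaceT => w; rewrite inE => /KE/sV; exact: cF.
    apply/seteqP; split => w [Bw [v zv vw]]; split => //; exists v => //.
      by apply/KE/sb.
    move: zv => /KE; rewrite le_eqVlt => /orP[/eqP/Hm|]; last by rewrite -ball_normE/= distrC.
    by rewrite vw; move: Bw; rewrite -ball_normE/= distrC ltNge => /negP.
by move: By; rewrite -zb => -[].
Qed.

End BallImage.

(** * Null sets and almost all lines *)

Section NullSections.
Context {R : realType} {d1 d2 : measure_display}.
Context {T1 : measurableType d1} {T2 : measurableType d2}.
Variables (m1 : {sigma_finite_measure set T1 -> \bar R}).
Variables (m2 : {sigma_finite_measure set T2 -> \bar R}).
Local Open Scope ereal_scope.

Let negligible_of_integral d (T : measurableType d) (m : {measure set T -> \bar R}) (f : T -> \bar R) :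
  measurable_fun setT f -> (forall x, 0 <= f x) -> \int[m]_x f x = 0 ->
  m.-negligible [set x | f x != 0].
Proof.
move=> mf f0 If; have : ae_eq m setT f (cst 0).
  apply/(ae_eq_integral_abs m measurableT mf).
  by under eq_integral do rewrite gee0_abs//.
apply: negligibleS => x /= fx H; move: fx; rewrite H ?eqxx//.
Qed.

Lemma negligible_xsection (N : set (T1 * T2)) : (m1 \x m2).-negligible N ->
  m1.-negligible [set x | ~ m2.-negligible (xsection N x)].
Proof.
move=> [A [mA A0 NA]].
have H := negligible_of_integral (measurable_fun_xsection m2 mA) (fun x => measure_ge0 m2 _) A0.
apply: negligibleS H => x /= nx; apply/negP => /eqP Ax; apply: nx.
exists (xsection A x); split => //; first exact: measurable_xsection.
by move=> y; rewrite /xsection/= !inE; exact: NA.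
Qed.

Lemma negligible_ysection (N : set (T1 * T2)) : (m1 \x m2).-negligible N ->
  m2.-negligible [set y | ~ m1.-negligible (ysection N y)].
Proof.
move=> [A [mA A0 NA]].
have A0' : \int[m2]_y m1 (ysection A y) = 0.
  rewrite -[RHS]A0; have := indic_fubini_tonelli m1 m2 mA.
  by rewrite indic_fubini_tonelli_FE ?indic_fubini_tonelli_GE.
have H := negligible_of_integral (measurable_fun_ysection m1 mA) (fun x => measure_ge0 m1 _) A0'.
apply: negligibleS H => x /= nx; apply/negP => /eqP Ax; apply: nx.
exists (ysection A x); split => //; first exact: measurable_ysection.
by move=> y; rewrite /ysection/= !inE; exact: NA.
Qed.

End NullSections.

Section Lines.
Context {R : realType}.
Local Open Scope ereal_scope.

Lemma negligible_not_itv (N : set R) (c d : R) : (c < d)%R ->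
  (@lebesgue_measure R).-negligible N -> exists y, (c < y < d)%R /\ ~ N y.
Proof.
move=> cd [A [mA A0 NA]]; apply: contrapT => H.
have sub : `]c, d[ `<=` A.
  move=> y; rewrite /= in_itv/= => cyd; apply: NA; apply: contrapT => Ny.
  by apply: H; exists y.
have : lebesgue_measure `]c, d[%classic <= lebesgue_measure A by exact: le_lebesgue.
by rewrite [X in _ <= X]A0 lebesgue_measure_itv/= lte_fin cd -EFinB lee_fin subr_le0 leNgt cd.
Qed.

(** The mean of [h] over the interval is at most A / (d - c). The factor 2 makes the contradiction
    strict, and removing a null set does not change the length. *)
Lemma exists_le_mean (h : measurableTypeR R -> \bar R) (N : set R) (c d A : R) : (c < d)%R -> (0 < A)%R ->
  measurable_fun setT h -> (forall y, 0 <= h y) ->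
  \int[lebesgue_measure]_y h y <= A%:E ->
  (@lebesgue_measure R).-negligible N ->
  exists y, [/\ (c < y < d)%R, ~ N y & h y <= (2 * A / (d - c))%:E].
Proof.
move=> cd A0 mh h0 hA [B [mB B0 NB]]; apply: contrapT => H.
have dc0 : (0 < d - c)%R by rewrite subr_gt0.
pose D := `]c, d[ `\` B.
have mD : measurable (D : set (measurableTypeR R)) by exact: measurableD.
have Dbig y : D y -> (2 * A / (d - c))%:E <= h y.
  move=> [/=]; rewrite in_itv/= => cyd nBy; rewrite leNgt; apply/negP => hy; apply: H; exists y.
  by split => //; [move=> /NB|exact: ltW].
have muD : (d - c)%:E <= lebesgue_measure D.
  have : lebesgue_measure `]c, d[%classic <= lebesgue_measure D + lebesgue_measure B.
    apply: le_trans (measureU2 _ mD mB); apply: le_lebesgue => //; first exact: measurableU.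
    by move=> y cyd; have [By|nBy] := pselect (B y); [right|left].
  by rewrite [X in _ + X]B0 adde0 lebesgue_measure_itv/= lte_fin cd -EFinB.
have : \int[lebesgue_measure]_(y in D) (2 * A / (d - c))%:E <= \int[lebesgue_measure]_y h y.
  apply: (@le_trans _ _ (\int[lebesgue_measure]_(y in D) h y)).
    apply: ge0_le_integral => //; first by move=> y _; rewrite lee_fin divr_ge0 ?mulr_ge0// ltW.
    exact: measurable_funTS.
  exact: ge0_subset_integral.
rewrite integral_cst// => /le_trans /(_ hA); apply/negP; rewrite -ltNge.
apply: (@lt_le_trans _ _ ((2 * A / (d - c))%:E * (d - c)%:E)).
  by rewrite -EFinM lte_fin divfK ?gt_eqF//; lra.
by apply: lee_wpmul2l => //; rewrite lee_fin divr_ge0 ?mulr_ge0// ltW.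
Qed.

(** The 8 is the 4 of [integral_area_density] times the 2 of [exists_le_mean]. *)
Lemma area_density_lines (F : R * R -> R * R) (V : set (R * R)) (c d A : R) (N : set R) :
  open V -> {in V &, injective F} ->
  (forall O, open O -> O `<=` V -> open (F @` O)) ->
  (c < d)%R -> (0 < A)%R -> leb2 (F @` V) <= A%:E ->
  (@lebesgue_measure R).-negligible N ->
  (exists y, [/\ (c < y < d)%R, ~ N y &
     \int[lebesgue_measure]_x area_density F V (x, y) <= (8 * A / (d - c))%:E]) /\
  (exists x, [/\ (c < x < d)%R, ~ N x &
     \int[lebesgue_measure]_y area_density F V (x, y) <= (8 * A / (d - c))%:E]).
Proof.
move=> oV iF oF cd A0 FA negN.
have mE := measurable_area_density oV oF.
have E0 := @area_density_ge0 R F V.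
have IE : \int[leb2]_z area_density F V z <= (4 * A)%:E.
  by apply: (le_trans (integral_area_density oV iF oF)); rewrite EFinM; exact: lee_wpmul2l.
have A4 : (0 < 4 * A)%R by rewrite mulr_gt0.
have -> : (8 * A = 2 * (4 * A))%R by ring.
split.
  apply: exists_le_mean => //.
  - exact: (measurable_fun_fubini_tonelli_G (m1 := lebesgue_measure) _ mE E0).
  - by move=> y; apply: integral_ge0.
  - by apply: le_trans IE; rewrite (fubini_tonelli2 (m1 := lebesgue_measure) (m2 := lebesgue_measure) _ mE E0).
apply: exists_le_mean => //.
- exact: (measurable_fun_fubini_tonelli_F (m2 := lebesgue_measure) _ mE E0).
- by move=> y; apply: integral_ge0.
- by apply: le_trans IE; rewrite (fubini_tonelli1 (m1 := lebesgue_measure) (m2 := lebesgue_measure) _ mE E0).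
Qed.

Lemma measurable_area_density_lines (F : R * R -> R * R) (V : set (R * R)) :
  open V -> (forall O, open O -> O `<=` V -> open (F @` O)) ->
  (forall y, measurable_fun (setT : set R) (fun x => area_density F V (x, y))) /\
  (forall x, measurable_fun (setT : set R) (fun y => area_density F V (x, y))).
Proof.
move=> oV oF; have mE := measurable_area_density oV oF.
split=> [y|x].
  exact: (measurableT_comp mE (pair2_measurable (T1 := measurableTypeR R) (T2 := measurableTypeR R) y)).
exact: (measurableT_comp mE (pair1_measurable (T1 := measurableTypeR R) (T2 := measurableTypeR R) x)).
Qed.

End Lines.

(** * The contact form along small rectangles *)

Section ContactForm.
Context {R : realType}.
Implicit Types X Y : 'rV[R]_4.

(* omega q X = eta q X; omega itself is half the differential of eta. *)
Definition omega X Y : R :=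
  X 0 0 * Y 0 1 - X 0 1 * Y 0 0 + X 0 2 * Y 0 3 - X 0 3 * Y 0 2.

Lemma le_coord_norm X i : `|X 0 i| <= `|X|.
Proof. by rewrite [leRHS]mx_normrE; apply: (le_bigmax _ (fun ij : 'I_1 * 'I_4 => `|X ij.1 ij.2|) (0, i)). Qed.

Lemma norm_omega_le X Y : `|omega X Y| <= 4 * (`|X| * `|Y|).
Proof.
have H i j : `|X 0 i * Y 0 j| <= `|X| * `|Y| by rewrite normrM ler_pM// le_coord_norm.
rewrite /omega; apply: (le_trans (ler_normB _ _)); apply: (le_trans (lerD (ler_normD _ _) (lexx _))).
apply: (le_trans (lerD (lerD (ler_normB _ _) (lexx _)) (lexx _))).
by have := H 0 1; have := H 1 0; have := H 2 3; have := H 3 2; lra.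
Qed.

Lemma omegaDl X X' Y : omega (X + X') Y = omega X Y + omega X' Y.
Proof. by rewrite /omega !mxE; ring. Qed.
Lemma omegaBl X X' Y : omega (X - X') Y = omega X Y - omega X' Y.
Proof. by rewrite /omega !mxE; ring. Qed.
Lemma omegaDr X Y Y' : omega X (Y + Y') = omega X Y + omega X Y'.
Proof. by rewrite /omega !mxE; ring. Qed.
Lemma omegaBr X Y Y' : omega X (Y - Y') = omega X Y - omega X Y'.
Proof. by rewrite /omega !mxE; ring. Qed.
Lemma omegaZl k X Y : omega (k *: X) Y = k * omega X Y.
Proof. by rewrite /omega !mxE; ring. Qed.
Lemma omegaZr k X Y : omega X (k *: Y) = k * omega X Y.
Proof. by rewrite /omega !mxE; ring. Qed.
Lemma omegaNl X Y : omega (- X) Y = - omega X Y.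
Proof. by rewrite /omega !mxE; ring. Qed.
Lemma omegaNr X Y : omega X (- Y) = - omega X Y.
Proof. by rewrite /omega !mxE; ring. Qed.
Lemma omegaC X Y : omega X Y = - omega Y X.
Proof. by rewrite /omega; ring. Qed.
Lemma omegaXX X : omega X X = 0.
Proof. by rewrite /omega; ring. Qed.

Lemma is_derive_omega (f h : R -> 'rV[R]_4) (s : R) (k l : 'rV[R]_4) :
  (forall i, is_derive s 1 (fun t => f t 0 i) (k 0 i)) ->
  (forall i, is_derive s 1 (fun t => h t 0 i) (l 0 i)) ->
  is_derive s 1 (fun t => omega (f t) (h t)) (omega k (h s) + omega (f s) l).
Proof.
move=> df dh.
have H i j : is_derive s 1 (fun t => f t 0 i * h t 0 j) (f s 0 i * l 0 j + h s 0 j * k 0 i).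
  by have := is_deriveM (df i) (dh j); rewrite /GRing.scale/=.
have H' := is_deriveB (is_deriveD (is_deriveB (H 0 1) (H 1 0)) (H 2 3)) (H 3 2).
by apply: (is_derive_eq H'); rewrite /omega; ring.
Qed.

Lemma is_derive_mulr (c s : R) : is_derive s 1 (fun t : R => t * c) c.
Proof.
have h := is_deriveM (is_derive_id s 1) (is_derive_cst c s 1).
by apply: (is_derive_eq h); rewrite /GRing.scale/= mulr0 add0r mulr1.
Qed.

(** With [l] the derivative of [b], the derivative of [omega (p + s *: a) (b s)] is
    [omega a (b s) + omega (p + s *: a) l]. Since [omega (b s) l = c], it differs from the constant
    [omega a p + c] only by terms linear in [b s - (p + s *: a)], hence by at most
    [4 * delta * (|l| + |a|)], even though [l] may be far from [a]. *)
Lemma edge_estimate (b : R -> 'rV[R]_4) (p a : 'rV[R]_4) (s1 s2 c delta : R) (D : R -> \bar R) (L : R) :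
  s1 <= s2 -> abs_continuous s1 s2 b ->
  (forall s, s1 <= s <= s2 -> `|b s - (p + s *: a)| <= delta) ->
  measurable_fun setT D -> (forall s, 0 <= D s)%E ->
  (\int[lebesgue_measure]_(s in `[s1, s2]) D s <= L%:E)%E ->
  (@lebesgue_measure R).-negligible [set s | s1 <= s <= s2 /\
    ~ exists l : 'rV[R]_4, [/\ forall i, is_derive s 1 (fun t => b t 0 i) (l 0 i),
         omega (b s) l = c & (`|l|%:E <= D s)%E]] ->
  `|omega (p + s2 *: a) (b s2) - omega (p + s1 *: a) (b s1) - (omega a p + c) * (s2 - s1)|
    <= 4 * delta * (L + `|a| * (s2 - s1)).
Proof.
move=> s12 acb bd mD D0 IL neg.
have d0 : 0 <= delta by apply: le_trans (bd s1 _); rewrite ?lexx.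
pose G s := omega (p + s *: a) (b s) - (omega a p + c) * s.
pose D' s : \bar R := ((4 * delta)%:E * (D s + `|a|%:E))%E.
have mD' : measurable_fun setT D'.
  by apply: measurable_funeM; apply: emeasurable_funD => //; exact: measurable_cst.
have D'0 s : (0 <= D' s)%E.
  by apply: mule_ge0; [rewrite lee_fin mulr_ge0|apply: adde_ge0; rewrite ?lee_fin].
have ID' : (\int[lebesgue_measure]_(s in `[s1, s2]) D' s <= (4 * delta * (L + `|a| * (s2 - s1)))%:E)%E.
  rewrite ge0_integralZl//; last 3 first.
  - by apply: measurable_funTS; apply: emeasurable_funD => //; exact: measurable_cst.
  - by move=> s _; apply: adde_ge0; rewrite ?lee_fin.
  - by rewrite lee_fin mulr_ge0.
  rewrite ge0_integralD//; last exact: measurable_funTS.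
  rewrite integral_cst//= lebesgue_measure_itv/= lte_fin [leRHS]EFinM; apply: lee_wpmul2l.
    by rewrite lee_fin mulr_ge0.
  rewrite EFinD; apply: leeD => //; case: ltP => [_|s21]; first by rewrite -EFinB -EFinM.
  by rewrite mule0 lee_fin mulr_ge0// subr_ge0.
have ID'f : (\int[lebesgue_measure]_(s in `[s1, s2]) D' s < +oo)%E.
  by apply: le_lt_trans ID' _; rewrite ltry.
have acG : abs_continuous s1 s2 G.
  have [B HB] : exists B, forall s, s1 <= s <= s2 -> `|b s| <= B /\ `|p + s *: a| <= B.
    exists (delta + (`|p| + (`|s1| + `|s2|) * `|a|)) => s ss.
    have h : `|p + s *: a| <= `|p| + (`|s1| + `|s2|) * `|a|.
      apply: (le_trans (ler_normD _ _)); rewrite lerD2l normrZ ler_wpM2r//.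
      move: ss => /andP[h1 h2]; rewrite ler_norml; apply/andP; split.
        have := ler_norm (- s1); rewrite normrN; have := normr_ge0 s2; lra.
      have := ler_norm s2; have := normr_ge0 s1; lra.
    split; last by rewrite (le_trans h)// lerDr.
    rewrite -(subrK (p + s *: a) (b s)); apply: (le_trans (ler_normD _ _)).
    by apply: lerD => //; exact: bd.
  apply: (abs_continuous_dominated (k := 4 * `|B| * (1 + `|a|) + `|omega a p + c|) acb (abs_continuous_id s1 s2)).
  move=> s t s1s st ts2.
  have [Bs1 Bs2] := HB s (introT andP (conj s1s (le_trans st ts2))).
  have [Bt1 Bt2] := HB t (introT andP (conj (le_trans s1s st) ts2)).
  have -> : G t - G s = omega (p + t *: a) (b t - b s) + (t - s) * omega a (b s) - (omega a p + c) * (t - s).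
    by rewrite /G omegaBr !omegaDl !omegaZl; ring.
  apply: (le_trans (ler_normB _ _)); apply: (le_trans (lerD (ler_normD _ _) (lexx _))).
  rewrite !normrM.
  have h1 : `|omega (p + t *: a) (b t - b s)| <= 4 * (`|B| * `|b t - b s|).
    apply: (le_trans (norm_omega_le _ _)); rewrite ler_pM2l// ler_wpM2r//.
    exact: le_trans Bt2 (ler_norm _).
  have h2 : `|t - s| * `|omega a (b s)| <= `|t - s| * (4 * (`|a| * `|B|)).
    rewrite ler_wpM2l//; apply: (le_trans (norm_omega_le _ _)); rewrite ler_pM2l// ler_wpM2l//.
    exact: le_trans Bs1 (ler_norm _).
  have h3 : 0 <= 4 * `|B| * `|a| * `|b t - b s| by rewrite !mulr_ge0.
  have h4 : 0 <= `|omega a p + c| * `|b t - b s| by rewrite mulr_ge0.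
  have h5 : 0 <= 4 * `|B| * `|t - s| by rewrite !mulr_ge0.
  lra.
have dG (s : R) : (exists l : 'rV[R]_4, [/\ forall i, is_derive s 1 (fun t => b t 0 i) (l 0 i),
         omega (b s) l = c & (`|l|%:E <= D s)%E]) -> s1 <= s <= s2 ->
    exists2 l, is_derive s 1 G l & (`|l|%:E <= D' s)%E.
  move=> [l [dl lc lD]] ss.
  have dp i : is_derive s 1 (fun t => (p + t *: a) 0 i) (a 0 i).
    have -> : (fun t => (p + t *: a) 0 i) = (fun t => p 0 i + t * a 0 i) by apply/funext => t; rewrite !mxE.
    have h := is_deriveD (is_derive_cst (p 0 i) s 1) (is_derive_mulr (a 0 i) s).
    by apply: (is_derive_eq h); rewrite add0r.
  exists (omega a (b s) + omega (p + s *: a) l - (omega a p + c)).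
    have h := is_derive_omega dp dl.
    apply: is_deriveB; have -> : *%R (omega a p + c) = fun t => t * (omega a p + c) by apply/funext => t; rewrite mulrC.
    exact: is_derive_mulr.
  have -> : omega a (b s) + omega (p + s *: a) l - (omega a p + c) =
      omega a (b s - (p + s *: a)) - omega (b s - (p + s *: a)) l.
    by rewrite -lc omegaBr omegaBl !omegaDr omegaZr omegaXX; ring.
  rewrite /D'; apply: (@le_trans _ _ ((4 * delta)%:E * (`|l|%:E + `|a|%:E))%E); last first.
    by apply: lee_wpmul2l; [rewrite lee_fin mulr_ge0|exact: leeD2r].
  rewrite -EFinD -EFinM lee_fin.
  have bs := bd s ss.
  apply: (le_trans (ler_normB _ _)).
  have := norm_omega_le a (b s - (p + s *: a)); have := norm_omega_le (b s - (p + s *: a)) l.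
  have : `|b s - (p + s *: a)| * `|l| <= delta * `|l| by rewrite ler_wpM2r.
  have : `|b s - (p + s *: a)| * `|a| <= delta * `|a| by rewrite ler_wpM2r.
  lra.
have H1 : ((G s2 - G s1)%:E <= \int[lebesgue_measure]_(s in `[s1, s2]) D' s)%E.
  apply: abs_continuous_le_integral => //.
  by apply: negligibleS neg => s [ss H]; split => // /dG /(_ ss).
have H2 : ((- G s2 - - G s1)%:E <= \int[lebesgue_measure]_(s in `[s1, s2]) D' s)%E.
  apply: (@abs_continuous_le_integral _ (fun s => - G s)) => //.
    apply: (abs_continuous_dominated (k := 1) acG acG) => s t _ _ _.
    by rewrite -opprB opprK mul1r addrC -opprB normrN lerDl.
  apply: negligibleS neg => s [ss H]; split => // /dG /(_ ss) [l dl lD]; apply: H.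
  by exists (- l); rewrite ?normrN//; exact: is_deriveN.
have := le_trans H1 ID'; have := le_trans H2 ID'; rewrite !lee_fin => h2 h1.
have -> : omega (p + s2 *: a) (b s2) - omega (p + s1 *: a) (b s1) - (omega a p + c) * (s2 - s1) = G s2 - G s1.
  by rewrite /G; ring.
by rewrite ler_norml; apply/andP; split; lra.
Qed.

(** What an edge needs for [edge_estimate]: [L] bounds the integral of a majorant of the speed, and
    [c] is the prescribed value of the contact form on the velocity. *)
Definition controlled_edge (b : R -> 'rV[R]_4) (s1 s2 c L : R) : Prop :=
  exists D : R -> \bar R, [/\ abs_continuous s1 s2 b,
    measurable_fun setT D, (forall s, 0 <= D s)%E,
    (\int[lebesgue_measure]_(s in `[s1, s2]) D s <= L%:E)%E &
    (@lebesgue_measure R).-negligible [set s | s1 <= s <= s2 /\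
      ~ exists l : 'rV[R]_4, [/\ forall i, is_derive s 1 (fun t => b t 0 i) (l 0 i),
         omega (b s) l = c & (`|l|%:E <= D s)%E]]].

(** Going once round the boundary, the corner terms telescope. The edge constants add up to
    [2 * omega a b] times the area from the affine map, minus half the area from the prescribed
    values [- y1 / 2] and [- y2 / 2]. *)
Lemma rectangle_estimate (g : R * R -> 'rV[R]_4) (p a b : 'rV[R]_4) (z : R * R)
    (x1 x2 y1 y2 delta L : R) : x1 <= x2 -> y1 <= y2 ->
  (forall x y, x1 <= x <= x2 -> y1 <= y <= y2 ->
     `|g (x, y) - (p + (x - z.1) *: a + (y - z.2) *: b)| <= delta) ->
  controlled_edge (fun x => g (x, y1)) x1 x2 (- y1 / 2) L ->
  controlled_edge (fun x => g (x, y2)) x1 x2 (- y2 / 2) L ->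
  controlled_edge (fun y => g (x1, y)) y1 y2 0 L ->
  controlled_edge (fun y => g (x2, y)) y1 y2 0 L ->
  `|2 * omega a b - 2^-1| * ((x2 - x1) * (y2 - y1)) <=
    4 * delta * (4 * L + 2 * (`|a| * (x2 - x1)) + 2 * (`|b| * (y2 - y1))).
Proof.
move=> x12 y12 close.
move=> [D1 [ac1 mD1 D10 I1 n1]] [D2 [ac2 mD2 D20 I2 n2]].
move=> [D3 [ac3 mD3 D30 I3 n3]] [D4 [ac4 mD4 D40 I4 n4]].
have H y (yy : y1 <= y <= y2) x : x1 <= x <= x2 ->
    `|g (x, y) - ((p - z.1 *: a + (y - z.2) *: b) + x *: a)| <= delta.
  move=> xx; have := close x y xx yy; congr (`|_| <= _); congr (_ - _).
  by rewrite scalerBl; apply/matrixP => i j; rewrite !mxE; ring.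
have V x (xx : x1 <= x <= x2) y : y1 <= y <= y2 ->
    `|g (x, y) - ((p + (x - z.1) *: a - z.2 *: b) + y *: b)| <= delta.
  move=> yy; have := close x y xx yy; congr (`|_| <= _); congr (_ - _).
  by rewrite [(y - _) *: _]scalerBl; apply/matrixP => i j; rewrite !mxE; ring.
have h1 : x1 <= x1 <= x2 by rewrite lexx.
have h2 : x1 <= x2 <= x2 by rewrite lexx andbT.
have h3 : y1 <= y1 <= y2 by rewrite lexx.
have h4 : y1 <= y2 <= y2 by rewrite lexx andbT.
have e1 := edge_estimate x12 ac1 (H y1 h3) mD1 D10 I1 n1.
have e2 := edge_estimate x12 ac2 (H y2 h4) mD2 D20 I2 n2.
have e3 := edge_estimate y12 ac3 (V x1 h1) mD3 D30 I3 n3.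
have e4 := edge_estimate y12 ac4 (V x2 h2) mD4 D40 I4 n4.
have xy0 : 0 <= (x2 - x1) * (y2 - y1) by rewrite mulr_ge0// subr_ge0.
rewrite -[X in _ * X <= _]ger0_norm// -normrM.
move: e1 e2 e3 e4.
set A1 := (X in `|X| <= _ -> _); set A2 := (X in _ -> `|X| <= _ -> _).
set A3 := (X in _ -> _ -> `|X| <= _ -> _); set A4 := (X in _ -> _ -> _ -> `|X| <= _ -> _).
have -> : (2 * omega a b - 2^-1) * ((x2 - x1) * (y2 - y1)) = A1 - A2 - A3 + A4.
  rewrite /A1 /A2 /A3 /A4 !(omegaDl, omegaNl, omegaZl, omegaDr, omegaNr, omegaZr).
  by rewrite !omegaXX (omegaC b a); field.
move=> e1 e2 e3 e4.
apply: (le_trans (ler_normD _ _)); apply: (le_trans (lerD (ler_normB _ _) (lexx _))).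
apply: (le_trans (lerD (lerD (ler_normB _ _) (lexx _)) (lexx _))).
lra.
Qed.

(** [24 * M * r] is what [area_density_lines] yields on a strip of width r / 3 when the image of the
    square of radius r has area at most M r^2. *)
Lemma controlled_edge_density (b : R -> 'rV[R]_4) (h : R -> \bar R) (s1 s2 c C M r : R) :
  0 <= C -> measurable_fun setT h -> (forall s, 0 <= h s)%E -> s1 <= s2 -> s2 - s1 <= 2 * r ->
  (\int[lebesgue_measure]_s h s <= (24 * M * r)%:E)%E ->
  abs_continuous s1 s2 b ->
  (@lebesgue_measure R).-negligible [set s | s1 <= s <= s2 /\
      ~ exists l : 'rV[R]_4, [/\ forall i, is_derive s 1 (fun t => b t 0 i) (l 0 i),
         omega (b s) l = c & (`|l|%:E <= C%:E * (1 + h s))%E]] ->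
  controlled_edge b s1 s2 c (C * (2 + 24 * M) * r).
Proof.
move=> C0 mh h0 s12 s12r Ih ac neg.
have h1 s : (0 <= 1 + h s)%E by apply: adde_ge0.
have mh1 : measurable_fun setT (fun s => 1 + h s)%E by exact: emeasurable_funD.
exists (fun s => C%:E * (1 + h s))%E; split => //.
- exact: measurable_funeM.
- by move=> s; apply: mule_ge0; rewrite ?lee_fin.
- rewrite ge0_integralZl//; last exact: measurable_funTS.
  rewrite ge0_integralD//; last exact: measurable_funTS.
  have -> : C * (2 + 24 * M) * r = C * (2 * r + 24 * M * r) by ring.
  rewrite integral_cst//= lebesgue_measure_itv/= lte_fin [leRHS]EFinM; apply: lee_wpmul2l.
    by rewrite lee_fin.
  rewrite EFinD; apply: leeD; last by apply: le_trans Ih; exact: ge0_subset_integral.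
  rewrite mul1e; case: ltP => _; first by rewrite -EFinB lee_fin.
  by rewrite lee_fin (le_trans _ s12r)// subr_ge0.
Qed.

(* Integrate omega (g, dg) around small rectangles close to z. The last two
   hypotheses prescribe omega (g, g_x) = - y / 2 and omega (g, g_y) = 0, while
   the affine approximation of g gives 2 omega a b times the area. Finiteness
   of the area density provides rectangles of size r over whose edges |dg|
   integrates to O(r), so that the error is o(r ^ 2). *)
Lemma area_preserving_at (F : R * R -> R * R) (g : R * R -> 'rV[R]_4) (z : R * R)
    (a b : 'rV[R]_4) (r0 C : R) (Nx Ny : set R) :
  0 < r0 -> 0 <= C ->
  {in (ball z r0 : set (R * R)) &, injective F} ->
  (forall O, open O -> O `<=` ball z r0 -> open (F @` O)) ->
  (area_density F (ball z r0) z < +oo)%E ->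
  (forall e, 0 < e -> \forall w \near z,
     `|g w - (g z + (w.1 - z.1) *: a + (w.2 - z.2) *: b)| <= e * `|w - z|) ->
  (@lebesgue_measure R).-negligible Nx -> (@lebesgue_measure R).-negligible Ny ->
  (forall y s1 s2, ~ Ny y -> `|y - z.2| < r0 -> z.1 - r0 < s1 -> s1 <= s2 -> s2 < z.1 + r0 ->
     abs_continuous s1 s2 (fun x => g (x, y)) /\
     (@lebesgue_measure R).-negligible [set s | s1 <= s <= s2 /\
      ~ exists l : 'rV[R]_4, [/\ forall i, is_derive s 1 (fun t => g (t, y) 0 i) (l 0 i),
         omega (g (s, y)) l = - y / 2 &
         (`|l|%:E <= C%:E * (1 + area_density F (ball z r0) (s, y)))%E]]) ->
  (forall x s1 s2, ~ Nx x -> `|x - z.1| < r0 -> z.2 - r0 < s1 -> s1 <= s2 -> s2 < z.2 + r0 ->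
     abs_continuous s1 s2 (fun y => g (x, y)) /\
     (@lebesgue_measure R).-negligible [set s | s1 <= s <= s2 /\
      ~ exists l : 'rV[R]_4, [/\ forall i, is_derive s 1 (fun t => g (x, t) 0 i) (l 0 i),
         omega (g (x, s)) l = 0 &
         (`|l|%:E <= C%:E * (1 + area_density F (ball z r0) (x, s)))%E]]) ->
  omega a b = 4^-1.
Proof.
move=> r00 C0 iF oF fin diff nNx nNy hor ver.
apply/eqP/negPn/negP => nab.
pose k := `|2 * omega a b - 2^-1|.
have k0 : 0 < k.
  rewrite normr_gt0; apply: contra nab => /eqP h; apply/eqP; lra.
have [M0 HM0] := area_density_lt (ball_open z r0) (ballxx z r00) fin.
(* [area_density_lines] asks for a positive bound on the area of the image. *)
pose M := Num.max M0 1.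
have M1 : 1 <= M by rewrite le_max lexx orbT.
pose Q := 4 * (C * (2 + 24 * M)) + 4 * `|a| + 4 * `|b|.
have Q0 : 0 <= Q.
  by rewrite /Q !addr_ge0// !mulr_ge0// addr_ge0// mulr_ge0//; lra.
(* The sides of the rectangle will exceed 2 r / 3, so its area is at least 4 r^2 / 9; with this [e]
   the total error stays below 4 k r^2 / 10. *)
pose e := k / (10 * (Q + 1)).
have e0 : 0 < e by rewrite divr_gt0// mulr_gt0//; lra.
have /nbhs_ballP[r1 /= r10 diffr] := diff e e0.
have [r [r_gt0 rr0 rr1 Fr]] : exists r, [/\ 0 < r, r < r0, r < r1 &
    (leb2 (F @` ball z r) <= (M * r ^+ 2)%:E)%E].
  have [N _ HN] : \forall n \near \oo, (n.+1%:R^-1 : R) < Num.min r0 r1.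
    have m0 : 0 < Num.min r0 r1 by rewrite lt_min r00.
    exact: (near_infty_natSinv_lt (PosNum m0)).
  have [n Nn Fn] := HM0 N.
  exists n.+1%:R^-1; have := HN n Nn; rewrite /= lt_min => /andP[-> ->].
  rewrite invr_gt0 ltr0n; split => //; apply: (le_trans Fn).
  by rewrite lee_fin ler_wpM2r ?sqr_ge0// le_max lexx.
have sub : ball z r `<=` ball z r0 by apply: le_ball; exact: ltW.
have iFr : {in (ball z r : set (R * R)) &, injective F}.
  by move=> u v; rewrite !inE => /sub uV /sub vV; apply: iF; rewrite inE.
have oFr O : open O -> O `<=` ball z r -> open (F @` O).
  by move=> oO Oz; apply: oF => // w /Oz /sub.
have A0 : 0 < M * r ^+ 2 by rewrite mulr_gt0 ?exprn_gt0//; lra.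
have lines (c d : R) N' := @area_density_lines R F (ball z r) c d (M * r ^+ 2) N' (ball_open z r) iFr oFr.
have Lr (t : R) : 8 * (M * r ^+ 2) / ((t + 2 * r / 3) - (t + r / 3)) = 24 * M * r.
  have -> : (t + 2 * r / 3) - (t + r / 3) = r / 3 by field.
  by field; rewrite gt_eqF.
have Lr' (t : R) : 8 * (M * r ^+ 2) / ((t - r / 3) - (t - 2 * r / 3)) = 24 * M * r.
  have -> : (t - r / 3) - (t - 2 * r / 3) = r / 3 by field.
  by field; rewrite gt_eqF.
have lt1 (t : R) : t + r / 3 < t + 2 * r / 3 by lra.
have lt2 (t : R) : t - 2 * r / 3 < t - r / 3 by lra.
(* Each edge is picked at distance between r / 3 and 2 r / 3 from the centre, off the exceptional
   lines, with a density integral of order r. *)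
have [[y2 [/andP[y21 y22] nNy2 Iy2]] _] := lines _ _ _ (lt1 z.2) A0 Fr nNy.
have [[y1 [/andP[y11 y12] nNy1 Iy1]] _] := lines _ _ _ (lt2 z.2) A0 Fr nNy.
have [_ [x2 [/andP[x21 x22] nNx2 Ix2]]] := lines _ _ _ (lt1 z.1) A0 Fr nNx.
have [_ [x1 [/andP[x11 x12] nNx1 Ix1]]] := lines _ _ _ (lt2 z.1) A0 Fr nNx.
rewrite (Lr z.2) in Iy2; rewrite (Lr z.1) in Ix2; rewrite (Lr' z.2) in Iy1; rewrite (Lr' z.1) in Ix1.
have [mh mv] := measurable_area_density_lines (ball_open z r) oFr.
have E0 := @area_density_ge0 R F (ball z r).
pose L := C * (2 + 24 * M) * r.
have inball x y : x1 <= x <= x2 -> y1 <= y <= y2 -> ball z r (x, y).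
  move=> /andP[h1 h2] /andP[h3 h4]; rewrite -ball_normE/= prod_normE/= gt_max !ltr_distl.
  by apply/andP; split; apply/andP; split; clear -h1 h2 h3 h4 x11 x22 y11 y22 r_gt0; lra.
have loc x y : x1 <= x <= x2 -> y1 <= y <= y2 ->
    area_density F (ball z r0) (x, y) = area_density F (ball z r) (x, y).
  by move=> xx yy; apply/esym/area_density_local; [exact: ball_open|exact: sub|exact: inball].
have x12' : x1 <= x2 by clear -x12 x21 r_gt0; lra.
have xr : x2 - x1 <= 2 * r by clear -x11 x22 r_gt0; lra.
have y12' : y1 <= y2 by clear -y12 y21 r_gt0; lra.
have yr : y2 - y1 <= 2 * r by clear -y11 y22 r_gt0; lra.
have hx1 : x1 <= x1 <= x2 by rewrite lexx.
have hx2 : x1 <= x2 <= x2 by rewrite lexx andbT.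
have hy1 : y1 <= y1 <= y2 by rewrite lexx.
have hy2 : y1 <= y2 <= y2 by rewrite lexx andbT.
have Hedge y : y1 <= y <= y2 -> ~ Ny y -> (\int[lebesgue_measure]_x area_density F (ball z r) (x, y) <= (24 * M * r)%:E)%E ->
    controlled_edge (fun x => g (x, y)) x1 x2 (- y / 2) L.
  move=> yy nNyy Iy; have yyr : `|y - z.2| < r0.
    by move: yy => /andP[h1 h2]; rewrite ltr_norml; apply/andP; split; clear -h1 h2 y11 y22 rr0 r_gt0; lra.
  have [|||ac neg] := hor y x1 x2 nNyy yyr; [by clear -x11 x22 x12' rr0 r_gt0; lra|by []|by clear -x11 x22 x12' rr0 r_gt0; lra|].
  apply: (controlled_edge_density (h := fun s => area_density F (ball z r) (s, y)) C0 (mh y) (fun s => E0 (s, y)) x12' xr Iy ac).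
  apply: negligibleS neg => s [ss H]; split; first exact: ss.
  move=> [l [dl ol ll]]; apply: H; exists l; split; [exact: dl|exact: ol|].
  by rewrite -(loc _ _ ss yy).
have Vedge x : x1 <= x <= x2 -> ~ Nx x -> (\int[lebesgue_measure]_y area_density F (ball z r) (x, y) <= (24 * M * r)%:E)%E ->
    controlled_edge (fun y => g (x, y)) y1 y2 0 L.
  move=> xx nNxx Ix; have xxr : `|x - z.1| < r0.
    by move: xx => /andP[h1 h2]; rewrite ltr_norml; apply/andP; split; clear -h1 h2 x11 x22 rr0 r_gt0; lra.
  have [|||ac neg] := ver x y1 y2 nNxx xxr; [by clear -y11 y22 y12' rr0 r_gt0; lra|by []|by clear -y11 y22 y12' rr0 r_gt0; lra|].
  apply: (controlled_edge_density (h := fun s => area_density F (ball z r) (x, s)) C0 (mv x) (fun s => E0 (x, s)) y12' yr Ix ac).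
  apply: negligibleS neg => s [ss H]; split; first exact: ss.
  move=> [l [dl ol ll]]; apply: H; exists l; split; [exact: dl|exact: ol|].
  by rewrite -(loc _ _ xx ss).
have close x y : x1 <= x <= x2 -> y1 <= y <= y2 ->
     `|g (x, y) - (g z + (x - z.1) *: a + (y - z.2) *: b)| <= e * r.
  move=> xx yy; have zxy := inball _ _ xx yy.
  have := diffr (x, y) (le_ball (ltW rr1) zxy); move=> /le_trans; apply.
  by rewrite ler_pM2l//; move: zxy; rewrite -ball_normE/= distrC => /ltW.
have := rectangle_estimate x12' y12' close (Hedge _ hy1 nNy1 Iy1) (Hedge _ hy2 nNy2 Iy2)
  (Vedge _ hx1 nNx1 Ix1) (Vedge _ hx2 nNx2 Ix2).
rewrite -/k; apply/negP; rewrite -ltNge.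
have hl : k * (4 / 9 * r ^+ 2) <= k * ((x2 - x1) * (y2 - y1)).
  rewrite ler_pM2l// (_ : 4 / 9 * r ^+ 2 = (2 * r / 3) * (2 * r / 3)); last by field.
  by apply: ler_pM; clear -x12 x21 y12 y21 r_gt0; lra.
apply: lt_le_trans hl.
have ha : `|a| * (x2 - x1) <= `|a| * (2 * r) by rewrite ler_wpM2l.
have hb : `|b| * (y2 - y1) <= `|b| * (2 * r) by rewrite ler_wpM2l.
apply: (@le_lt_trans _ _ (4 * (e * r) * (Q * r))).
  apply: ler_wpM2l; first by rewrite mulr_ge0// mulr_ge0// ltW.
  rewrite (_ : Q * r = 4 * L + 2 * (`|a| * (2 * r)) + 2 * (`|b| * (2 * r))); last by rewrite /Q /L; ring.
  by clear -ha hb; lra.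
have -> : 4 * (e * r) * (Q * r) = (4 * e * Q) * r ^+ 2 by ring.
have -> : k * (4 / 9 * r ^+ 2) = (4 / 9 * k) * r ^+ 2 by ring.
rewrite ltr_pM2r ?exprn_gt0//.
have -> : 4 * e * Q = (4 * k / 10) * (Q / (Q + 1)) by rewrite /e; field; clear -Q0; lra.
apply: (@le_lt_trans _ _ (4 * k / 10)); last by clear -k0; lra.
rewrite ler_piMr//; first by clear -k0; lra.
by rewrite ler_pdivrMr; clear -Q0; lra.
Qed.

End ContactForm.

(** * Calculus of smooth maps *)

Section Smoothness.
Context {R : realType}.
Implicit Types V W : normedModType R.

Lemma differentiable_eps V W (f : V -> W) x e : differentiable f x -> 0 < e ->
  \forall w \near x, `|f w - (f x + 'd f x (w - x))| <= e * `|w - x|.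
Proof.
move=> df e0; have /eqaddoP/(_ _ e0) := diff_locally df.
move=> /nbhs_ballP[r /= r0 rO]; apply/nbhs_ballP; exists r => //= w wx.
have := rO (w - x); rewrite -ball_normE/= sub0r normrN => /(_ _).
rewrite -ball_normE/= distrC in wx => /(_ wx).
by rewrite /= !fctE/= subrK.
Qed.

Lemma near_eq_diff V W (f g : V -> W) x : (\forall y \near x, f y = g y) ->
  differentiable f x -> differentiable g x /\ 'd g x = 'd f x :> (V -> W).
Proof.
move=> fg df.
have fgx : f x = g x := nbhs_singleton fg.
have Hg : g \o shift x = cst (g x) + 'd f x +o_ 0 id.
  apply/eqaddoP => e e0; have /eqaddoP/(_ _ e0) := diff_locally df.
  have fg0 : \forall h \near 0, f (h + x) = g (h + x).
    move: fg => /nbhs_ballP[r /= r0 rO]; apply/nbhs_ballP; exists r => //= h.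
    rewrite -ball_normE/= sub0r normrN => hr; apply: rO.
    by rewrite -ball_normE/= opprD addrCA subrr addr0 normrN.
  apply: filterS2 fg0 => h; rewrite /= !fctE/= => -> ; by rewrite fgx.
have dgE := diff_unique (diff_continuous df) Hg.
split=> //; apply/diff_locallyP; rewrite dgE; split => //; exact: diff_continuous.
Qed.

Lemma class_C_congr V W k (U : set V) (f g : V -> W) : open U ->
  (forall x, U x -> f x = g x) -> class_C k U f -> class_C k U g.
Proof.
move=> oU; elim: k f g => [|k IH] f g fg /=.
  move=> H x Ux; have Unbhs : \forall y \near x, f y = g y.
    by apply: filterS (open_nbhs_nbhs (conj oU Ux)) => y; exact: fg.
  have := H x Ux; rewrite /continuous_at /prop_for/= -(fg x Ux).
  by apply: cvg_trans; apply: near_eq_cvg; apply: filterS Unbhs => y ->.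
have near x : U x -> \forall y \near x, f y = g y.
  by move=> Ux; apply: filterS (open_nbhs_nbhs (conj oU Ux)) => y; exact: fg.
move=> [H1 H2]; split=> [x Ux|v].
  by have [] := near_eq_diff (near x Ux) (H1 x Ux).
apply: IH (H2 v) => x Ux.
by have [_ ->] := near_eq_diff (near x Ux) (H1 x Ux).
Qed.

Lemma class_CS V W k (U : set V) (f : V -> W) : class_C k.+1 U f -> class_C k U f.
Proof.
elim: k f => [|k IH] f; first by move=> [H _] x Ux; apply: differentiable_continuous; exact: H.
by move=> [H1 H2]; split => // v; apply: IH; exact: H2.
Qed.

Lemma class_C_cst V W k (U : set V) (a : W) : class_C k U (fun _ => a).
Proof.
elim: k a => [|k IH] a /=; first by move=> x _; exact: cst_continuous.
split=> [x _|v]; first exact: differentiable_cst.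
rewrite (_ : (fun x => _) = (fun _ => 0)); first exact: IH.
by apply/funext => x; rewrite diff_cst.
Qed.

Lemma class_C_id V k (U : set V) : class_C k U (fun x : V => x).
Proof.
case: k => [|k] /=; first by move=> x _; exact: cvg_id.
split=> [x _|v]; first exact: ex_diff.
rewrite (_ : (fun x => _) = fun _ => v); first exact: class_C_cst.
by apply/funext => x; rewrite diff_val.
Qed.

Lemma class_CD V W k (U : set V) (f g : V -> W) : open U ->
  class_C k U f -> class_C k U g -> class_C k U (fun x => f x + g x).
Proof.
move=> oU; elim: k f g => [|k IH] f g /=.
  by move=> Hf Hg x Ux; apply: continuousD; [exact: Hf|exact: Hg].
move=> [f1 f2] [g1 g2]; split=> [x Ux|v]; first exact: (differentiableD (f1 x Ux) (g1 x Ux)).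
apply: (class_C_congr oU _ (IH _ _ (f2 v) (g2 v))) => x Ux.
by rewrite [in RHS](diffD (f1 x Ux) (g1 x Ux)).
Qed.

Lemma class_CM V k (U : set V) (f g : V -> R) : open U ->
  class_C k U f -> class_C k U g -> class_C k U (fun x => f x * g x).
Proof.
move=> oU; elim: k f g => [|k IH] f g.
  by move=> Hf Hg x Ux; apply: continuousM; [exact: Hf|exact: Hg].
move=> Hf Hg; have cf := class_CS Hf; have cg := class_CS Hg.
move: Hf Hg => /= [f1 f2] [g1 g2]; split=> [x Ux|v]; first exact: (differentiableM (f1 x Ux) (g1 x Ux)).
have := class_CD oU (IH _ _ cf (g2 v)) (IH _ _ cg (f2 v)).
apply: (class_C_congr oU) => x Ux.
by rewrite [in RHS](diffM (f1 x Ux) (g1 x Ux)).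
Qed.

Lemma class_CZl V W k (U : set V) (f : V -> R) (a : W) : open U ->
  class_C k U f -> class_C k U (fun x => f x *: a).
Proof.
move=> oU; elim: k f => [|k IH] f /=.
  by move=> Hf x Ux; apply: cvgZl; exact: Hf.
move=> [f1 f2]; split=> [x Ux|v]; first exact: differentiableZl (f1 x Ux).
apply: (class_C_congr oU _ (IH _ (f2 v))) => x Ux.
by rewrite [in RHS](diffZl _ (f1 x Ux)).
Qed.

Lemma diff_comp1 V (phi : R -> R) (f : V -> R) x d v :
  is_derive (f x) 1 phi d -> differentiable f x ->
  differentiable (fun x => phi (f x)) x /\ 'd (fun x => phi (f x)) x v = 'd f x v * d.
Proof.
move=> [dphi phid] df; have dphi' := (derivable1_diffP _ _).1 dphi.
split; first exact: (differentiable_comp df dphi').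
rewrite [LHS](congr1 (fun F => F v) (diff_comp df dphi'))/= diff1E// derive1E phid.
by [].
Qed.

(** Only class [k] is asked of the derivative [psi (f x)]. For the inverse, the square root, the
    sine and the cosine it is built from these same functions of [f], so the inductions on [k] below
    close. *)
Lemma class_C_comp1 V k (U : set V) (phi psi : R -> R) (f : V -> R) : open U ->
  (forall x, U x -> is_derive (f x) 1 phi (psi (f x))) ->
  class_C k.+1 U f -> class_C k U (fun x => psi (f x)) ->
  class_C k.+1 U (fun x => phi (f x)).
Proof.
move=> oU dphi [f1 f2] cpsi; split=> [x Ux|v].
  by have [] := diff_comp1 0 (dphi x Ux) (f1 x Ux).
apply: (class_C_congr oU _ (class_CM oU (f2 v) cpsi)) => x Ux.
by have [_ ->] := diff_comp1 v (dphi x Ux) (f1 x Ux).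
Qed.

Lemma class_C_comp0 V (U : set V) (phi : R -> R) (f : V -> R) :
  (forall x, U x -> {for f x, continuous phi}) ->
  class_C 0 U f -> class_C 0 U (fun x => phi (f x)).
Proof. by move=> cphi cf x Ux; apply: (continuous_comp (cf x Ux) (cphi x Ux)). Qed.

Lemma class_CN V k (U : set V) (f : V -> R) : open U ->
  class_C k U f -> class_C k U (fun x => - f x).
Proof.
move=> oU Hf; have := class_CM oU (class_C_cst k U (-1 : R)) Hf.
by apply: class_C_congr => // x _; rewrite mulN1r.
Qed.

Lemma class_C_inv V k (U : set V) (f : V -> R) : open U ->
  (forall x, U x -> f x != 0) -> class_C k U f -> class_C k U (fun x => (f x)^-1).
Proof.
move=> oU f0; elim: k => [|k IH].
  by apply: class_C_comp0 => x Ux; apply: inv_continuous; exact: f0.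
move=> Hf; have IHf := IH (class_CS Hf).
apply: (class_C_comp1 (phi := GRing.inv) (psi := fun y => - (y^-1 * y^-1)) oU _ Hf).
  move=> x Ux; have h := is_deriveV (f0 x Ux) (is_derive_id (f x) (1 : R)).
  by apply: (is_derive_eq h); rewrite /GRing.scale/= mulr1 -exprVn expr2.
by apply: class_CN => //; exact: class_CM.
Qed.

Lemma class_C_sqrt V k (U : set V) (f : V -> R) : open U ->
  (forall x, U x -> 0 < f x) -> class_C k U f -> class_C k U (fun x => Num.sqrt (f x)).
Proof.
move=> oU f0; elim: k => [|k IH].
  by apply: class_C_comp0 => x Ux; exact: sqrt_continuous.
move=> Hf; have IHf := IH (class_CS Hf).
apply: (class_C_comp1 (phi := Num.sqrt) (psi := fun y => (2 * Num.sqrt y)^-1) oU _ Hf).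
  by move=> x Ux; apply: is_derive1_sqrt; exact: f0.
apply: class_C_inv => //; last by apply: class_CM => //; exact: class_C_cst.
by move=> x Ux; rewrite mulf_neq0// gt_eqF// sqrtr_gt0 f0.
Qed.

Lemma class_C_cos_sin V k (U : set V) (f : V -> R) : open U -> class_C k U f ->
  class_C k U (fun x => cos (f x)) /\ class_C k U (fun x => sin (f x)).
Proof.
move=> oU; elim: k => [|k IH] Hf.
  by split; apply: class_C_comp0 => // x _; [exact: continuous_cos|exact: continuous_sin].
have [IHc IHs] := IH (class_CS Hf); split.
  apply: (class_C_comp1 (phi := cos) (psi := fun y => - sin y) oU _ Hf) => //.
  exact: class_CN.
exact: (class_C_comp1 (phi := sin) (psi := cos) oU _ Hf).
Qed.

Lemma class_C_linear V W k (U : set V) (f : {linear V -> W}) : continuous f -> class_C k U f.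
Proof.
move=> cf; case: k => [|k] /=; first by move=> x _; exact: cf.
split=> [x _|v]; first exact: linear_differentiable.
rewrite (_ : (fun x => _) = (fun _ => f v)); first exact: class_C_cst.
by apply/funext => x; rewrite diff_lin.
Qed.

Lemma class_C_row V k n (U : set V) (f : 'I_n -> V -> R) : open U ->
  (forall i, class_C k U (f i)) -> class_C k U (fun x => \row_i f i x : 'rV[R]_n).
Proof.
move=> oU Hf.
have H s : class_C k U (fun x => \sum_(i <- s) f i x *: (delta_mx 0 i : 'rV[R]_n)).
  elim: s => [|i s IHs].
    by apply: (class_C_congr oU _ (class_C_cst k U 0)) => x _; rewrite big_nil.
  apply: (class_C_congr oU _ (class_CD oU (class_CZl _ oU (Hf i)) IHs)) => x _.
  by rewrite big_cons.
apply: (class_C_congr oU _ (H (index_enum 'I_n))) => x _.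
apply/rowP => j; rewrite mxE summxE (bigD1 j)//= !mxE !eqxx mulr1 big1 ?addr0// => i ij.
by rewrite !mxE eq_sym (negPf ij) andbF mulr0.
Qed.

(** Packaging a projection as a linear map makes its differential available through [diff_lin]; the
    same is done for [fst] and [snd]. *)
Lemma coord_linear_exists n (i : 'I_n) : {f : {linear 'rV[R]_n -> R} | f = (fun M => M 0 i) :> (_ -> _)}.
Proof.
have lin : linear (fun M : 'rV[R]_n => M 0 i : R^o) by move=> k u v; rewrite !mxE.
pose fM := GRing.isLinear.Build _ _ _ _ _ lin.
pose f : {linear 'rV[R]_n -> R^o} := HB.pack (fun M : 'rV[R]_n => M 0 i : R^o) fM.
by exists f.
Qed.

Lemma diff_coord V n (f : V -> 'rV[R]_n) x v i : differentiable f x ->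
  differentiable (fun y => f y 0 i) x /\ 'd (fun y => f y 0 i) x v = 'd f x v 0 i.
Proof.
move=> df; have dc := @differentiable_coord R 1 n (f x) 0 i.
split; first exact: (differentiable_comp df dc).
rewrite [LHS](congr1 (fun F => F v) (diff_comp df dc))/=.
have [c cE] := coord_linear_exists i.
have cc : continuous c.
  by rewrite cE => M; apply: differentiable_continuous; exact: differentiable_coord.
by rewrite -[X in 'd X _ _]cE diff_lin// cE.
Qed.

Lemma diff_row V n (f : 'I_n -> V -> R) x v :
  (forall i, differentiable (f i) x) ->
  differentiable (fun y => \row_i f i y : 'rV[R]_n) x /\
  'd (fun y => \row_i f i y : 'rV[R]_n) x v = \row_i 'd (f i) x v.
Proof.
move=> df.
have d : differentiable (fun y => \row_i f i y : 'rV[R]_n) x.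
  rewrite (_ : (fun y => _) = \sum_(i < n) (fun y => f i y *: (delta_mx 0 i : 'rV[R]_n))).
    by apply: differentiable_sum => i; exact: differentiableZl.
  apply/funext => y; rewrite fct_sumE; apply/rowP => j; rewrite mxE summxE.
  by rewrite (bigD1 j)//= !mxE !eqxx mulr1 big1 ?addr0// => i ij; rewrite !mxE eq_sym (negPf ij) andbF mulr0.
split => //; apply/rowP => i; rewrite mxE.
have [_ <-] := diff_coord v i d; congr ('d _ x v).
by apply/funext => y; rewrite mxE.
Qed.

Lemma fst_linear_map (V W : normedModType R) : {f : {linear (V * W)%type -> V} | f = fst :> (_ -> _)}.
Proof.
have lin : linear (fst : (V * W)%type -> V) by [].
pose fM := GRing.isLinear.Build _ _ _ _ _ lin.
pose f : {linear (V * W)%type -> V} := HB.pack (fst : (V * W)%type -> V) fM.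
by exists f.
Qed.

Lemma snd_linear_map (V W : normedModType R) : {f : {linear (V * W)%type -> W} | f = snd :> (_ -> _)}.
Proof.
have lin : linear (snd : (V * W)%type -> W) by [].
pose fM := GRing.isLinear.Build _ _ _ _ _ lin.
pose f : {linear (V * W)%type -> W} := HB.pack (snd : (V * W)%type -> W) fM.
by exists f.
Qed.

Lemma diff_fst V W (x : V * W) :
  differentiable (fst : (V * W)%type -> V) x /\ 'd (fst : (V * W)%type -> V) x = fst :> (_ -> _).
Proof.
have [f fE] := fst_linear_map V W; rewrite -fE.
have cf : continuous f by rewrite fE => y; exact: cvg_fst.
by split; [exact: linear_differentiable|rewrite diff_lin].
Qed.

Lemma diff_snd V W (x : V * W) :
  differentiable (snd : (V * W)%type -> W) x /\ 'd (snd : (V * W)%type -> W) x = snd :> (_ -> _).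
Proof.
have [f fE] := snd_linear_map V W; rewrite -fE.
have cf : continuous f by rewrite fE => y; exact: cvg_snd.
by split; [exact: linear_differentiable|rewrite diff_lin].
Qed.

Lemma class_C_fst V W k (U : set (V * W)) : class_C k U (fst : (V * W)%type -> V).
Proof.
have [f fE] := fst_linear_map V W; rewrite -fE; apply: class_C_linear.
by rewrite fE => y; exact: cvg_fst.
Qed.

Lemma class_C_snd V W k (U : set (V * W)) : class_C k U (snd : (V * W)%type -> W).
Proof.
have [f fE] := snd_linear_map V W; rewrite -fE; apply: class_C_linear.
by rewrite fE => y; exact: cvg_snd.
Qed.

Lemma class_C_comp_linear V W W' k (U : set V) (f : V -> W) (l : {linear W -> W'}) : open U ->
  continuous l -> class_C k U f -> class_C k U (fun x => l (f x)).
Proof.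
move=> oU cl; elim: k f => [|k IH] f /=.
  by move=> Hf x Ux; apply: continuous_comp; [exact: Hf|exact: cl].
move=> [f1 f2]; split=> [x Ux|v].
  by apply: (differentiable_comp (f1 x Ux)); exact: linear_differentiable.
apply: (class_C_congr oU _ (IH _ (f2 v))) => x Ux.
have dl : differentiable l (f x) by exact: linear_differentiable.
rewrite [RHS](congr1 (fun F => F v) (diff_comp (f1 x Ux) dl))/=.
by rewrite diff_lin.
Qed.

End Smoothness.

(** * Charts of the sphere and their contact fibrations *)

Section Chart.
Context {R : realType}.
Local Notation P3 := (R * R * R)%type.
Local Notation R4 := 'rV[R]_4.

Lemma diff_compE (U V W : normedModType R) (f : U -> V) (g : V -> W) x v :
  differentiable f x -> differentiable g (f x) ->
  differentiable (fun y => g (f y)) x /\ 'd (fun y => g (f y)) x v = 'd g (f x) ('d f x v).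
Proof.
move=> df dg; split; first exact: (differentiable_comp df dg).
exact: (congr1 (fun F => F v) (diff_comp df dg)).
Qed.

Lemma diff_pairE (U V W : normedModType R) (f : U -> V) (g : U -> W) x v :
  differentiable f x -> differentiable g x ->
  differentiable (fun y => (f y, g y)) x /\
  'd (fun y => (f y, g y)) x v = ('d f x v, 'd g x v).
Proof.
move=> df dg; split; first exact: differentiable_pair.
exact: (congr1 (fun F => F v) (diff_pair df dg)).
Qed.

Lemma smooth_on_differentiable (V W : normedModType R) (U : set V) (f : V -> W) x :
  smooth_on U f -> U x -> differentiable f x.
Proof. by move=> /(_ 1%N) [H _] Ux; exact: H. Qed.

Lemma is_derive_diff (f : R -> R) (x d : R) : is_derive x 1 f d ->
  differentiable f x /\ 'd f x 1 = d.
Proof.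
move=> [df <-]; have df' := (derivable1_diffP _ _).1 df; split => //.
by rewrite -deriveE.
Qed.

Lemma open_setXT (D : set (R * R)) : open D -> open (D `*` setT : set P3).
Proof.
move=> oD; rewrite openE => -[d t] [Dd _]; exists (D, setT) => //=.
by split; [exact: open_nbhs_nbhs|exact: filterT].
Qed.

(* B is the parameter domain, W the domain in the ambient space of a smooth
   left inverse kappa of Theta. *)
Definition chart (B : set P3) (Theta : P3 -> R4) (W : set R4) (kappa : R4 -> P3) : Prop :=
  [/\ open B, smooth_on B Theta, open W, (forall q, W q -> differentiable kappa q) &
   (forall u, B u -> [/\ S3 (Theta u), W (Theta u) & kappa (Theta u) = u]) /\
   (forall q, S3 q -> W q -> B (kappa q) -> Theta (kappa q) = q)].

Section ChartTheory.
Variables (B : set P3) (Theta : P3 -> R4) (W : set R4) (kappa : R4 -> P3).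
Hypothesis ch : chart B Theta W kappa.

Let oB : open B. Proof. by case: ch. Qed.
Let sT : smooth_on B Theta. Proof. by case: ch. Qed.
Let oW : open W. Proof. by case: ch. Qed.
Let dk q : W q -> differentiable kappa q. Proof. by case: ch => ? ? ? H _; exact: H. Qed.
Let TS u : B u -> S3 (Theta u). Proof. by case: ch => ? ? ? ? [H _] /H[]. Qed.
Let TW u : B u -> W (Theta u). Proof. by case: ch => ? ? ? ? [H _] /H[]. Qed.
Let kT u : B u -> kappa (Theta u) = u. Proof. by case: ch => ? ? ? ? [H _] /H[]. Qed.
Let Tk q : S3 q -> W q -> B (kappa q) -> Theta (kappa q) = q.
Proof. by case: ch => ? ? ? ? [_ H]; exact: H. Qed.
Let dT u : B u -> differentiable Theta u.
Proof. by move=> Bu; exact: smooth_on_differentiable sT Bu. Qed.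

Lemma chart_diffK u v : B u -> 'd kappa (Theta u) ('d Theta u v) = v.
Proof.
move=> Bu; have [_ <-] := diff_compE v (dT Bu) (dk (TW Bu)).
have near_id : \forall w \near u, (fun w => w) w = kappa (Theta w).
  by apply: filterS (open_nbhs_nbhs (conj oB Bu)) => w /kT.
have d_id : differentiable (fun w : P3 => w) u by [].
have [_ ->] := near_eq_diff near_id d_id.
by rewrite diff_val.
Qed.

Lemma chart_immersion u v : B u -> 'd Theta u v = 0 -> v = 0.
Proof. by move=> Bu dv; rewrite -(chart_diffK v Bu) dv linear0. Qed.

Lemma chart_inj : {in B &, injective Theta}.
Proof. by move=> u v; rewrite !inE => Bu Bv E; rewrite -(kT Bu) -(kT Bv) E. Qed.

Lemma chart_image (U : set P3) : U `<=` B ->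
  Theta @` U = S3 `&` (W `&` kappa @^-1` U).
Proof.
move=> sU; apply/seteqP; split => [_ [u Uu <-]|q [Sq [Wq Uq]]].
  by split; [exact/TS/sU|split; [exact/TW/sU|rewrite /= kT//; exact: sU]].
by exists (kappa q) => //; apply: Tk => //; exact: sU.
Qed.

Lemma open_chart_preimage (U : set P3) : open U -> open (W `&` kappa @^-1` U).
Proof.
move=> oU; rewrite openE => q [Wq Uq]; apply: filterI; first exact: open_nbhs_nbhs.
by apply: (differentiable_continuous (dk Wq)); exact: open_nbhs_nbhs.
Qed.

Lemma chart_rel_open (U : set P3) : open U -> U `<=` B -> rel_open S3 (Theta @` U).
Proof.
move=> oU sU; exists (W `&` kappa @^-1` U); first exact: open_chart_preimage.
exact: chart_image.
Qed.

Lemma chart_local_param : local_param S3 B Theta.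
Proof.
split => //; [by move=> u v; exact: chart_immersion|exact: chart_inj|].
by move=> U' oU' sU'; exact: chart_rel_open.
Qed.

End ChartTheory.

Section Leaves.
Variables (D : set (R * R)) (Theta : P3 -> R4) (W : set R4) (kappa : R4 -> P3).
Hypothesis ch : chart (D `*` setT) Theta W kappa.
(** Smoothness of composites with [Theta] is requested along curves and slices, the two kinds that
    occur; both are checked on the explicit coordinates. *)
Hypothesis smooth_curves : forall u1 u2 u3 : R -> R, smooth_on setT u1 ->
  smooth_on setT u2 -> smooth_on setT u3 -> (forall t, D (u1 t, u2 t)) ->
  smooth_on setT (fun t => Theta ((u1 t, u2 t), u3 t)).
Hypothesis smooth_slices : forall s0, smooth_on D (fun d => Theta (d, s0)).
Hypothesis horizontal : forall u, (D `*` setT) u -> HS3 (Theta u) ('d Theta u (0, 1)).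
Hypothesis tangent_onto : forall q X, S3 q -> TS3 q X ->
  exists c : R -> R4, [/\ forall t, S3 (c t), c 0 = q, differentiable c 0 & 'd c 0 1 = X].

Let oB : open (D `*` setT : set P3). Proof. by case: ch. Qed.
Let oD : open D.
Proof.
rewrite openE => d Dd.
have /nbhs_ballP[e /= e0 eD] : nbhs ((d, 0) : P3) (D `*` setT) by apply: open_nbhs_nbhs.
apply/nbhs_ballP; exists e => //= d' dd'.
by have [] := eD (d', 0) (conj dd' (ballxx _ e0)).
Qed.
Let sT : smooth_on (D `*` setT) Theta. Proof. by case: ch. Qed.
Let dT u : (D `*` setT) u -> differentiable Theta u.
Proof. by move=> Bu; exact: smooth_on_differentiable sT Bu. Qed.
Let dk q : W q -> differentiable kappa q. Proof. by case: ch => ? ? ? H _; exact: H. Qed.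
Let kT u : (D `*` setT) u -> kappa (Theta u) = u. Proof. by case: ch => ? ? ? ? [H _] /H[]. Qed.
Let TS u : (D `*` setT) u -> S3 (Theta u). Proof. by case: ch => ? ? ? ? [H _] /H[]. Qed.
Let TW u : (D `*` setT) u -> W (Theta u). Proof. by case: ch => ? ? ? ? [H _] /H[]. Qed.
Let Tk q : S3 q -> W q -> (D `*` setT) (kappa q) -> Theta (kappa q) = q.
Proof. by case: ch => ? ? ? ? [_ H]; exact: H. Qed.

Definition leaf d : set R4 := [set Theta (d, t) | t in setT].
Definition leaves : set (set R4) := [set leaf d | d in D].
Definition slice s0 : set R4 := (fun d => Theta (d, s0)) @` D.

Let leaf_inj d d' t t' : D d -> D d' -> Theta (d, t) = Theta (d', t') -> d = d' /\ t = t'.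
Proof.
move=> Dd Dd' E; have := chart_inj ch; move=> /(_ (d, t) (d', t')).
by rewrite !inE => /(_ (conj Dd I) (conj Dd' I) E) [-> ->].
Qed.

Let diff_slice d s0 v : D d -> 'd (fun d => Theta (d, s0)) d v = 'd Theta (d, s0) (v, 0).
Proof.
move=> Dd; have did : differentiable (fun d : R * R => d) d by [].
have dc : differentiable (fun d : R * R => s0) d by [].
have [dp pE] := diff_pairE v did dc.
have [_ ->] := diff_compE v dp (dT (conj Dd I : (D `*` setT) (d, s0))).
rewrite pE; congr ('d Theta _ (_, _)); last by rewrite diff_cst.
by rewrite diff_val.
Qed.

Lemma slice_local_param s0 : local_param (slice s0) D (fun d => Theta (d, s0)).
Proof.
split => //.
- move=> d v Dd; rewrite diff_slice// => dv.
  by have [] := chart_immersion ch (conj Dd I : (D `*` setT) (d, s0)) dv.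
- by move=> d d'; rewrite !inE => Dd Dd' /leaf_inj[].
- move=> U oU sU; exists (W `&` kappa @^-1` (U `*` setT)).
    by apply: (open_chart_preimage ch); exact: open_setXT.
  apply/seteqP; split => [_ [d Ud <-]|_ [[d Dd <-] [_ /=]]].
    split; first by exists d => //; exact: sU.
    split; first by apply: TW; split => //; exact: sU.
    by rewrite /= kT//; split => //; exact: sU.
  by rewrite kT// => -[Ud _]; exists d.
Qed.

Lemma slice_smooth_surface s0 : smooth_surface (slice s0).
Proof.
split; first by move=> _ [d Dd <-]; exact: TS.
move=> x Sx; exists D, (fun d => Theta (d, s0)); split; [exact: slice_local_param|exact: Sx].
Qed.

(** A curve on the sphere with velocity [X] stays in the chart near time 0, hence equals its image
    under [Theta \o kappa]; the chain rule puts [X] in the range of the differential of [Theta]. *)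
Lemma chart_onto u X : (D `*` setT) u -> TS3 (Theta u) X -> exists v, 'd Theta u v = X.
Proof.
move=> Bu TX; have [c [cS c0 dc cX]] := tangent_onto (TS Bu) TX.
have Wc : W (c 0) by rewrite c0; exact: TW.
have [dkc kcE] := diff_compE (1 : R) dc (dk Wc).
have kc0 : kappa (c 0) = u by rewrite c0 kT.
exists ('d kappa (c 0) X).
have dT' : differentiable Theta (kappa (c 0)) by rewrite kc0; exact: dT.
have [dTkc TkcE] := diff_compE (1 : R) dkc dT'.
rewrite cX in kcE; rewrite kcE kc0 in TkcE; rewrite -TkcE -cX.
have nearc : \forall t \near 0, c t = Theta (kappa (c t)).
  have oV := open_chart_preimage ch oB.
  have Vc : (W `&` kappa @^-1` (D `*` setT)) (c 0) by split => //; rewrite /= kc0.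
  have : nbhs (c 0) (W `&` kappa @^-1` (D `*` setT)) by exact: open_nbhs_nbhs.
  move=> H; have : \forall t \near 0, (W `&` kappa @^-1` (D `*` setT)) (c t).
    exact: (differentiable_continuous dc H).
  apply: filterS => t [Wt Bt].
  by rewrite Tk//; exact: cS.
have [_ H] := near_eq_diff nearc dc.
exact: (congr1 (fun F : R -> R4 => F 1) H).
Qed.

Let smooth_linear (a b : R) : smooth_on setT (fun t : R => a + t * b).
Proof.
move=> k; apply: class_CD; [exact: openT|exact: class_C_cst|].
by apply: class_CM; [exact: openT|exact: class_C_id|exact: class_C_cst].
Qed.

Let leaf_curve d (s v : R) : D d ->
  smooth_on setT (fun t : R => Theta (d, s + t * v)) /\
  'd (fun t : R => Theta (d, s + t * v)) 0 1 = 'd Theta (d, s) (0, v).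
Proof.
move=> Dd; split.
  case: d Dd => d1 d2 Dd; apply: (@smooth_curves (fun _ => d1) (fun _ => d2) (fun t => s + t * v)).
  - by move=> k; exact: class_C_cst.
  - by move=> k; exact: class_C_cst.
  - exact: smooth_linear.
  - by move=> _; exact: Dd.
have dc : differentiable (fun t : R => d) 0 by [].
have [dl lE] : differentiable (fun t : R => s + t * v) 0 /\ 'd (fun t : R => s + t * v) 0 1 = v.
  apply: is_derive_diff.
  have h := is_deriveD (is_derive_cst s (0 : R) (1 : R)) (is_deriveM (is_derive_id (0 : R) (1 : R)) (is_derive_cst v (0 : R) (1 : R))).
  by apply: (is_derive_eq h); rewrite /GRing.scale/= mulr0 !add0r mulr1.
have [dp pE] := diff_pairE (1 : R) dc dl.
have dT0 : differentiable Theta (d, s + 0 * v) by apply: dT.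
have [_ ->] := diff_compE (1 : R) dp dT0.
by rewrite pE lE diff_cst mul0r addr0.
Qed.

Let slice_curve d s (v : R * R) : D d -> exists c : R -> R4,
  [/\ smooth_on setT c, forall t, slice s (c t), c 0 = Theta (d, s) & 'd c 0 1 = 'd Theta (d, s) (v, 0)].
Proof.
move=> Dd; have /nbhs_ballP[e /= e0 eD] : nbhs d D by exact: open_nbhs_nbhs.
have [del del0 delv] : exists2 del, 0 < del & del * `|v| < e.
  have v1 : 0 < `|v| + 1 by rewrite ltr_wpDl.
  exists (e / (`|v| + 1)); first by rewrite divr_gt0.
  by rewrite mulrAC ltr_pdivrMr// ltr_pM2l// ltrDl.
(* [tangent] asks for a curve that stays in the slice for all times: [del * sin (t / del)] has slope
   1 at 0 and is bounded by [del]. *)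
pose u (a b : R) (t : R) := a + del * sin (t / del) * b.
have inD t : D (u d.1 v.1 t, u d.2 v.2 t).
  apply: eD; rewrite -ball_normE/= prod_normE/= gt_max /u.
  have H (a b : R) : `|b| <= `|v| -> `|a - (a + del * sin (t / del) * b)| < e.
    move=> bv; rewrite opprD addrA subrr sub0r normrN !normrM (gtr0_norm del0).
    have s1 : `|sin (t / del)| <= 1 by rewrite ler_norml sin_geN1 sin_le1.
    by apply: le_lt_trans delv; rewrite -mulrA ler_pM2l// -[leRHS]mul1r ler_pM.
  by rewrite !H// prod_normE le_max lexx ?orbT.
have su (a b : R) : smooth_on setT (u a b).
  move=> k; apply: class_CD; [exact: openT|exact: class_C_cst|].
  apply: class_CM; [exact: openT| |exact: class_C_cst].
  apply: class_CM; [exact: openT|exact: class_C_cst|].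
  have [] // := @class_C_cos_sin R _ k setT (fun t : R => t / del) openT.
  have := smooth_linear 0 del^-1 k.
  by congr (class_C _ _ _); apply/funext => t; rewrite add0r.
have du (a b : R) : differentiable (u a b) 0 /\ 'd (u a b) 0 1 = b.
  have dlin := smooth_on_differentiable (smooth_linear 0 del^-1) (I : setT (0 : R)).
  apply: is_derive_diff.
  have h1 : is_derive (0 : R) 1 (fun t : R => t / del) del^-1.
    have h := is_deriveM (is_derive_id (0 : R) (1 : R)) (is_derive_cst (del^-1) (0 : R) (1 : R)).
    by apply: (is_derive_eq h); rewrite /GRing.scale/= mulr0 !add0r mulr1.
  have h2 : is_derive (0 : R) 1 (fun t : R => sin (t / del)) del^-1.
    have hs : is_derive (0 / del) 1 (@sin R) (cos (0 / del)) by exact: is_derive_sin.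
    have h := is_derive1_comp (f := @sin R) (g := fun t => t / del) hs h1.
    by apply: (is_derive_eq h); rewrite mul0r cos0 /GRing.scale/= ?mulr1 ?mul1r.
  have h3 := is_deriveM (is_deriveM (is_derive_cst del (0 : R) (1 : R)) h2) (is_derive_cst b (0 : R) (1 : R)).
  have h := is_deriveD (is_derive_cst a (0 : R) (1 : R)) h3.
  apply: (is_derive_eq h); rewrite /GRing.scale/= add0r mulr0 add0r mulr0 addr0.
  by rewrite mulfV ?gt_eqF// mulr1.
exists (fun t => Theta ((u d.1 v.1 t, u d.2 v.2 t), s)); split.
- by apply: smooth_curves => //; move=> k; exact: class_C_cst.
- by move=> t; exists (u d.1 v.1 t, u d.2 v.2 t).
- by rewrite /u !mul0r sin0 !mulr0 !mul0r !addr0 -surjective_pairing.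
- have [du1 u1E] := du d.1 v.1; have [du2 u2E] := du d.2 v.2.
  have [dp pE] := diff_pairE (1 : R) du1 du2.
  have dc : differentiable (fun t : R => s) 0 by [].
  have [dp' pE'] := diff_pairE (1 : R) dp dc.
  have dT0 : differentiable Theta (u d.1 v.1 0, u d.2 v.2 0, s) by apply: dT; split => //; exact: inD.
  have [_ ->] := diff_compE (1 : R) dp' dT0.
  rewrite pE' pE u1E u2E diff_cst -surjective_pairing.
  by rewrite /u !mul0r sin0 !mulr0 !mul0r !addr0 -surjective_pairing.
Qed.

Lemma slice_transversal s0 gamma : leaves gamma -> Defs.transversal (slice s0) gamma.
Proof.
move=> [d Dd <-] q [d0 Dd0 <-] [s _ /(leaf_inj Dd Dd0) [? ?]] X TX; subst d0 s.
have Bu : (D `*` setT) (d, s0) by [].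
have [v dv] := chart_onto Bu TX.
exists ('d Theta (d, s0) (v.1, 0)), ('d Theta (d, s0) (0, v.2)); split.
- have [c [sc cS c0 dc]] := slice_curve s0 v.1 Dd; exists c; split => //.
  by rewrite derive1E' //; exact: smooth_on_differentiable sc I.
- have [sc dc] := leaf_curve s0 v.2 Dd; exists (fun t => Theta (d, s0 + t * v.2)); split => //.
  + by move=> t; exists (s0 + t * v.2).
  + by rewrite mul0r addr0.
  + by rewrite derive1E' //; exact: smooth_on_differentiable sc I.
- by rewrite -linearD -dv; congr ('d Theta _ _); case: v {dv} => v1 v2; congr (_, _); rewrite /= ?addr0 ?add0r.
Qed.

(** Read through [kappa], a curve in the leaf has constant first component, so its velocity is a
    multiple of the horizontal vector ['d Theta (d, s) (0, 1)]. *)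
Lemma leaf_legendrian d : D d -> legendrian (leaf d).
Proof.
move=> Dd q X [s _ <-] [c [sc cl c0 dX]].
have Bu : (D `*` setT) (d, s) by [].
have dc := smooth_on_differentiable sc (I : setT (0 : R)).
have [sig sigE] : {sig : R -> R & forall t, c t = Theta (d, sig t)}.
  have /choice[sig H] : forall t, exists s, c t = Theta (d, s).
    by move=> t; have [s' _ <-] := cl t; exists s'.
  by exists sig.
have Wc : W (c 0) by rewrite c0; exact: TW.
have [dkc kcE] := diff_compE (1 : R) dc (dk Wc).
have kcP : (fun t => kappa (c t)) = fun t => (d, sig t).
  by apply/funext => t; rewrite sigE kT.
have dT' : differentiable Theta (kappa (c 0)) by rewrite c0 kT//; exact: dT.
have [_ TkcE] := diff_compE (1 : R) dkc dT'.
have TkcP : (fun t => Theta (kappa (c t))) = c.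
  by apply/funext => t; rewrite [in RHS]sigE; congr Theta; rewrite sigE kT.
rewrite TkcP -derive1E' // dX c0 kT// in TkcE.
have v10 : ('d (fun t => kappa (c t)) 0 1).1 = 0.
  have [dfst fstE] := @diff_fst R (R * R)%type R (kappa (c 0)).
  have [_ h] := diff_compE (1 : R) dkc dfst.
  rewrite fstE in h; rewrite -h.
  have -> : (fun y => (kappa (c y)).1) = cst d by apply/funext => y; rewrite sigE kT.
  by rewrite diff_cst.
set v := 'd (fun t => kappa (c t)) 0 (1 : R) in TkcE v10.
have -> : X = v.2 *: 'd Theta (d, s) (0, 1).
  rewrite TkcE -linearZ; congr ('d Theta _ _); rewrite [LHS]surjective_pairing v10.
  by congr (_, _); rewrite /= ?scaler0// /GRing.scale/= mulr1.
have [h1 h2] := horizontal Bu; split.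
  rewrite /TS3/= (eq_bigr (fun i => v.2 * (Theta (d, s) 0 i * 'd Theta (d, s) (0, 1) 0 i))).
    by rewrite -mulr_sumr h1 mulr0.
  by move=> i _; rewrite mxE; ring.
move: h2; set Y := 'd Theta _ _ => h2.
have -> : eta (Theta (d, s)) (v.2 *: Y) = v.2 * eta (Theta (d, s)) Y.
  by rewrite /eta /w1 /w2 !mxE /=; ring.
by rewrite h2 mulr0.
Qed.

Let leaves_union (G : set (R * R)) : \bigcup_(c in [set leaf d | d in G]) c = Theta @` (G `*` setT).
Proof.
apply/seteqP; split => [q [_ [d Gd <-] [t _ <-]]|_ [[d t] [/= Gd _] <-]].
  by exists (d, t).
by exists (leaf d); [exists d|exists t].
Qed.

Let leaf_ne d d' : D d -> D d' -> leaf d `&` leaf d' !=set0 -> d = d'.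
Proof. by move=> Dd Dd' [q [[t _ <-] [t' _ /(leaf_inj Dd' Dd) []]]]. Qed.

Lemma chart_contact_fibration : contact_fibration (Theta @` (D `*` setT)) leaves.
Proof.
have ro G : open G -> G `<=` D -> rel_open S3 (\bigcup_(c in [set leaf d | d in G]) c).
  move=> oG sG; rewrite leaves_union; apply: (chart_rel_open ch).
    exact: open_setXT.
  by move=> [d t] [/= /sG].
split.
- by apply: (chart_rel_open ch) => //.
- split; first exact: leaves_union.
  by move=> _ _ [d Dd <-] [d' Dd' <-] /= /(leaf_ne Dd Dd') ->.
- move=> _ [d Dd <-]; exists D, Theta; split; last by exists d.
  split => //; [exact: (chart_immersion ch)|by move=> d' Dd'; exists d'|].
  by left; exact: (chart_inj ch).
- move=> _ _ [d Dd <-] [d' Dd' <-] ne.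
  have dd' : d != d' by apply/eqP => dd; apply: ne; rewrite dd.
  have e0 : 0 < `|d - d'| / 2 by rewrite divr_gt0// normr_gt0 subr_eq0.
  exists [set leaf x | x in D `&` ball d (`|d - d'| / 2)], [set leaf x | x in D `&` ball d' (`|d - d'| / 2)].
  split.
  + by split => _ [x [Dx _] <-]; exists x.
  + by split; [exists d|exists d'] => //; split => //; exact: ballxx.
  + rewrite -subset0 => _ [[x [Dx dx] <-] [x' [Dx' dx'] E]].
    have : x = x'.
      apply: leaf_ne => //; exists (Theta (x, 0)); split; first by exists 0.
      by rewrite E; exists 0.
    move=> xx'; subst x'.
    move: dx dx'; rewrite -!ball_normE/= => h1 h2.
    have := ler_distD x d d'; rewrite (distrC x); rewrite leNgt => /negP; apply; lra.
  + by apply: ro; [apply: openI => //; exact: ball_open|exact: subIsetl].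
  + by apply: ro; [apply: openI => //; exact: ball_open|exact: subIsetl].
- by move=> _ [d Dd <-]; exact: leaf_legendrian.
Qed.

(** The slice at 0 is a transversal surface that meets each leaf exactly once, and
    [d |-> Theta (d, 0)] parametrizes it; a subfamily of measure zero therefore corresponds to a
    null set of parameters [d]. *)
Lemma chart_ACL f : ACL f ->
  (@lebesgue_measure R \x @lebesgue_measure R)%E.-negligible
    (D `&` [set d | ~ forall a b, abs_continuous a b (fun s => f (Theta (d, s)))]).
Proof.
move=> /(_ _ _ chart_contact_fibration) [G1 [sG1 G1null] acG].
have := G1null _ (slice_smooth_surface 0) (slice_transversal (s0 := 0)) D (fun d => Theta (d, 0)) (slice_local_param 0).
apply: negligibleS => d [Dd nac]; split => //=; split; first by exists d.
exists (leaf d); last by exists 0.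
apply: contrapT => nG1; apply: nac => a b.
have [sc _] := leaf_curve 0 1 Dd.
have E : (fun t => Theta (d, 0 + t * 1)) = (fun t => Theta (d, t)).
  by apply/funext => t; rewrite add0r mulr1.
rewrite E in sc.
apply: (acG _ _ nG1 (fun t => Theta (d, t))) => //; first by exists d.
  move=> t; apply/eqP => d0.
  have : 'd Theta (d, t) (0, 1) = 0.
    have dc : differentiable (fun t : R => d) t by [].
    have did : differentiable (fun t : R => t) t by [].
    have [dp pE] := diff_pairE (1 : R) dc did.
    have [dTd TdE] := diff_compE (1 : R) dp (dT (conj Dd I : (D `*` setT) (d, t))).
    rewrite pE diff_cst diff_val in TdE.
    by rewrite -TdE -derive1E'.
  move=> /(chart_immersion ch (conj Dd I : (D `*` setT) (d, t))) [] /eqP.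
  by rewrite oner_eq0.
by move=> t; exists t.
Qed.

End Leaves.
End Chart.

(** * Hopf coordinates *)

Section Coordinates.
Context {R : realType}.
Local Notation P3 := (R * R * R)%type.
Local Notation R4 := 'rV[R]_4.
Implicit Types (V W : normedModType R) (q : R4).

Definition hopf_rad (y : R) : R := Num.sqrt ((1 + y) / 2).

(* w1 = sqrt ((1 + y) / 2) e^(i (t - x / 2)), w2 = sqrt ((1 - y) / 2)
   e^(i (t + x / 2)); here eta = dt - (y / 2) dx, the circle acts by translation
   of t, and (x, y) are the longitude and the height of the Hopf projection. *)
Definition Psi (x y t : R) : R4 :=
  \row_k [:: hopf_rad y * cos (t - x / 2); hopf_rad y * sin (t - x / 2);
             hopf_rad (- y) * cos (t + x / 2); hopf_rad (- y) * sin (t + x / 2)]`_k.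

(** The partial derivatives of [Psi] in x, y and t, written as functions of the point
    [q = Psi x y t]. *)
Definition Psi_x q : R4 := \row_k [:: q 0 1 / 2; - q 0 0 / 2; - q 0 3 / 2; q 0 2 / 2]`_k.
Definition Psi_y q (y : R) : R4 :=
  \row_k [:: q 0 0 / (2 * (1 + y)); q 0 1 / (2 * (1 + y));
             - q 0 2 / (2 * (1 - y)); - q 0 3 / (2 * (1 - y))]`_k.
Definition Psi_t q : R4 := \row_k [:: - q 0 1; q 0 0; - q 0 3; q 0 2]`_k.

Lemma S3E q : S3 q <-> q 0 0 ^+ 2 + q 0 1 ^+ 2 + q 0 2 ^+ 2 + q 0 3 ^+ 2 = 1.
Proof.
rewrite /S3 /sphere/= !big_ord_recl big_ord0 !addr0.
have -> : lift ord0 (ord0 : 'I_3) = 1 :> 'I_4 by apply/val_inj.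
have -> : lift ord0 (lift ord0 (ord0 : 'I_2)) = 2 :> 'I_4 by apply/val_inj.
have -> : lift ord0 (lift ord0 (lift ord0 (ord0 : 'I_1))) = 3 :> 'I_4 by apply/val_inj.
by rewrite !addrA.
Qed.

Lemma TS3E q X : TS3 q X <-> q 0 0 * X 0 0 + q 0 1 * X 0 1 + q 0 2 * X 0 2 + q 0 3 * X 0 3 = 0.
Proof.
rewrite /TS3/= !big_ord_recl big_ord0 !addr0.
have -> : lift ord0 (ord0 : 'I_3) = 1 :> 'I_4 by apply/val_inj.
have -> : lift ord0 (lift ord0 (ord0 : 'I_2)) = 2 :> 'I_4 by apply/val_inj.
have -> : lift ord0 (lift ord0 (lift ord0 (ord0 : 'I_1))) = 3 :> 'I_4 by apply/val_inj.
by rewrite !addrA.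
Qed.

Lemma eta_omega q X : eta q X = omega q X.
Proof. by rewrite /eta /omega /w1 /w2 /=; ring. Qed.

Lemma HS3E q X : HS3 q X <-> TS3 q X /\ omega q X = 0.
Proof. by rewrite /HS3/= eta_omega. Qed.

Lemma row4P q q' : q 0 0 = q' 0 0 -> q 0 1 = q' 0 1 -> q 0 2 = q' 0 2 -> q 0 3 = q' 0 3 -> q = q'.
Proof.
move=> h0 h1 h2 h3; apply/rowP => -[[|[|[|[|//]]]]] i.
- by rewrite (_ : Ordinal i = 0) //; apply/val_inj.
- by rewrite (_ : Ordinal i = 1) //; apply/val_inj.
- by rewrite (_ : Ordinal i = 2) //; apply/val_inj.
- by rewrite (_ : Ordinal i = 3) //; apply/val_inj.
Qed.

Lemma rad_sqr y : -1 <= y -> hopf_rad y ^+ 2 = (1 + y) / 2.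
Proof. by move=> y1; rewrite sqr_sqrtr// divr_ge0//; lra. Qed.

Lemma rad_gt0 y : -1 < y -> 0 < hopf_rad y.
Proof. by move=> y1; rewrite sqrtr_gt0 divr_gt0//; lra. Qed.

Lemma Psi_w1 x y t : -1 <= y -> Psi x y t 0 0 ^+ 2 + Psi x y t 0 1 ^+ 2 = (1 + y) / 2.
Proof.
move=> y1; rewrite !mxE/= -(rad_sqr y1) !exprMn -mulrDr cos2Dsin2 mulr1 //.
Qed.

Lemma Psi_w2 x y t : y <= 1 -> Psi x y t 0 2 ^+ 2 + Psi x y t 0 3 ^+ 2 = (1 - y) / 2.
Proof.
move=> y1; have y1' : -1 <= - y by lra.
by rewrite !mxE/= -(rad_sqr y1') !exprMn -mulrDr cos2Dsin2 mulr1.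
Qed.

Lemma Psi_S3 x y t : -1 <= y <= 1 -> S3 (Psi x y t).
Proof.
move=> /andP[y1 y2]; apply/S3E.
have := Psi_w1 x t y1; have := Psi_w2 x t y2; lra.
Qed.

(** Carrying the value of the directional derivative along with differentiability lets the rules
    below compute it by chaining. *)
Definition has_diff V W (f : V -> W) u v (d : W) : Prop :=
  differentiable f u /\ 'd f u v = d.

Lemma has_diff_cst V W (a : W) (u v : V) : has_diff (fun _ => a) u v 0.
Proof. by split; [exact: differentiable_cst|rewrite diff_cst]. Qed.

Lemma has_diffD V W (f g : V -> W) u v d e :
  has_diff f u v d -> has_diff g u v e -> has_diff (fun w => f w + g w) u v (d + e).
Proof.
move=> [df <-] [dg <-]; split; first exact: (differentiableD df dg).
exact: (congr1 (fun F : V -> W => F v) (diffD df dg)).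
Qed.

Lemma has_diffM V (f g : V -> R) u v d e :
  has_diff f u v d -> has_diff g u v e -> has_diff (fun w => f w * g w) u v (d * g u + f u * e).
Proof.
move=> [df <-] [dg <-]; split; first exact: (differentiableM df dg).
rewrite [LHS](congr1 (fun F : V -> R => F v) (diffM df dg)) /=.
change (f u * 'd g u v + g u * 'd f u v = 'd f u v * g u + f u * 'd g u v).
by rewrite addrC (mulrC (g u)).
Qed.

Lemma has_diff_comp1 V (phi : R -> R) (f : V -> R) u v d e :
  is_derive (f u) 1 phi e -> has_diff f u v d -> has_diff (fun w => phi (f w)) u v (d * e).
Proof. by move=> dphi [df <-]; exact: diff_comp1. Qed.

Lemma has_diff_eq V W (f : V -> W) u v d e : has_diff f u v d -> d = e -> has_diff f u v e.
Proof. by move=> h <-. Qed.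

Lemma has_diff_row V n (f : 'I_n -> V -> R) u v (d : 'I_n -> R) :
  (forall i, has_diff (f i) u v (d i)) ->
  has_diff (fun w => \row_i f i w : 'rV[R]_n) u v (\row_i d i).
Proof.
move=> H; have [dP PE] := diff_row v (fun i => (H i).1).
by split; [exact: dP|rewrite PE; apply/rowP => i; rewrite !mxE (H i).2].
Qed.

Lemma has_diffN V (f : V -> R) u v d :
  has_diff f u v d -> has_diff (fun w => - f w) u v (- d).
Proof.
move=> [df <-]; split; first exact: (differentiableN df).
exact: (congr1 (fun F : V -> R => F v) (diffN df)).
Qed.

Lemma has_diff_cos V (f : V -> R) u v d :
  has_diff f u v d -> has_diff (fun w => cos (f w)) u v (d * - sin (f u)).
Proof. exact: has_diff_comp1. Qed.

Lemma has_diff_sin V (f : V -> R) u v d :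
  has_diff f u v d -> has_diff (fun w => sin (f w)) u v (d * cos (f u)).
Proof. exact: has_diff_comp1. Qed.

Lemma has_diff_rad V (y : V -> R) u v d : -1 < y u -> has_diff y u v d ->
  has_diff (fun w => hopf_rad (y w)) u v (d * (hopf_rad (y u) / (2 * (1 + y u)))).
Proof.
move=> y1; apply: has_diff_comp1.
have h1 : is_derive (y u) 1 (fun s : R => (1 + s) / 2) (2^-1).
  have h := is_deriveM (is_deriveD (is_derive_cst (1 : R) (y u) (1 : R)) (is_derive_id (y u) (1 : R))) (is_derive_cst (2^-1 : R) (y u) (1 : R)).
  by apply: (is_derive_eq h); rewrite /GRing.scale/= mulr0 !add0r mulr1.
have p0 : 0 < (1 + y u) / 2 by rewrite divr_gt0//; lra.
have h := is_derive1_comp (f := @Num.sqrt R) (g := fun s : R => (1 + s) / 2) (is_derive1_sqrt p0) h1.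
apply: (is_derive_eq h); rewrite /GRing.scale/=.
have r0 := rad_gt0 y1; have := rad_sqr (ltW y1); rewrite -/(hopf_rad (y u)) => r2.
have -> : 1 + y u = 2 * hopf_rad (y u) ^+ 2 by rewrite r2; field.
by field; rewrite gt_eqF.
Qed.

Lemma has_diff_Psi V (x y t : V -> R) u v dx dy dt : -1 < y u < 1 ->
  has_diff x u v dx -> has_diff y u v dy -> has_diff t u v dt ->
  has_diff (fun w => Psi (x w) (y w) (t w)) u v
    (dx *: Psi_x (Psi (x u) (y u) (t u)) + dy *: Psi_y (Psi (x u) (y u) (t u)) (y u)
     + dt *: Psi_t (Psi (x u) (y u) (t u))).
Proof.
move=> /andP[y1 y2] hx hy ht.
have y2' : -1 < - y u by clear -y2; lra.
have hx2 : has_diff (fun w => x w / 2) u v (dx / 2).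
  apply: has_diff_eq (has_diffM hx (has_diff_cst _ _ _)) _; by rewrite mulr0 addr0.
have r1 := has_diff_rad y1 hy; have r2 := has_diff_rad (y := fun w => - y w) y2' (has_diffN hy).
have a1 := has_diffD ht (has_diffN hx2); have a2 := has_diffD ht hx2.
have c0 := has_diffM r1 (has_diff_cos a1).
have c1 := has_diffM r1 (has_diff_sin a1).
have c2 := has_diffM r2 (has_diff_cos a2).
have c3 := has_diffM r2 (has_diff_sin a2).
pose F (i : 'I_4) w := [:: hopf_rad (y w) * cos (t w - x w / 2); hopf_rad (y w) * sin (t w - x w / 2);
             hopf_rad (- y w) * cos (t w + x w / 2); hopf_rad (- y w) * sin (t w + x w / 2)]`_i.
have [dF HF] : {dF : 'I_4 -> R | forall i, has_diff (F i) u v (dF i) /\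
    dF i = (dx *: Psi_x (Psi (x u) (y u) (t u)) + dy *: Psi_y (Psi (x u) (y u) (t u)) (y u)
     + dt *: Psi_t (Psi (x u) (y u) (t u))) 0 i}.
  eexists (fun i : 'I_4 => [:: _; _; _; _]`_i) => -[[|[|[|[|//]]]]] i; rewrite /F/= !mxE/=.
  - by split; [exact: c0|ring].
  - by split; [exact: c1|ring].
  - by split; [exact: c2|ring].
  - by split; [exact: c3|ring].
apply: (has_diff_eq (has_diff_row (fun i => (HF i).1))).
by apply/rowP => i; rewrite mxE (HF i).2.
Qed.

Lemma class_C_Psi V k (U : set V) (x y t : V -> R) : open U ->
  (forall u, U u -> -1 < y u < 1) ->
  class_C k U x -> class_C k U y -> class_C k U t ->
  class_C k U (fun w => Psi (x w) (y w) (t w)).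
Proof.
move=> oU y1 cx cy ct.
have cN := class_CN oU cy.
have crad (z : V -> R) : (forall u, U u -> -1 < z u) -> class_C k U z -> class_C k U (fun w => hopf_rad (z w)).
  move=> z1 cz; apply: class_C_sqrt => //.
    by move=> u Uu; rewrite divr_gt0//; have := z1 u Uu; lra.
  by apply: class_CM => //; [apply: class_CD => //|]; exact: class_C_cst.
have c1 : class_C k U (fun w => hopf_rad (y w)) by apply: crad => // u /y1 /andP[].
have c2 : class_C k U (fun w => hopf_rad (- y w)) by apply: crad => // u /y1 /andP[_ h]; lra.
have cx2 : class_C k U (fun w => x w / 2) by apply: class_CM => //; exact: class_C_cst.
have [a1 a2] := class_C_cos_sin oU (class_CD oU ct (class_CN oU cx2)).
have [b1 b2] := class_C_cos_sin oU (class_CD oU ct cx2).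
pose F (i : 'I_4) w := [:: hopf_rad (y w) * cos (t w - x w / 2); hopf_rad (y w) * sin (t w - x w / 2);
             hopf_rad (- y w) * cos (t w + x w / 2); hopf_rad (- y w) * sin (t w + x w / 2)]`_i.
have := @class_C_row R V k 4 U F oU; apply.
by case=> -[|[|[|[|//]]]] i; rewrite /F/=; exact: class_CM.
Qed.

Lemma omega_Psi_t q : S3 q -> omega q (Psi_t q) = 1.
Proof. by move=> /S3E <-; rewrite /omega !mxE/=; ring. Qed.

Lemma omega_Psi_x x y t : -1 <= y <= 1 -> omega (Psi x y t) (Psi_x (Psi x y t)) = - y / 2.
Proof.
move=> /andP[y1 y2]; have := Psi_w1 x t y1; have := Psi_w2 x t y2.
move: (Psi x y t) => q h1 h2; rewrite /omega !mxE/=; lra.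
Qed.

Lemma omega_Psi_y q y : omega q (Psi_y q y) = 0.
Proof. by rewrite /omega !mxE/=; ring. Qed.

Lemma TS3_Psi_x q : TS3 q (Psi_x q).
Proof. by apply/TS3E; rewrite !mxE/=; ring. Qed.

Lemma TS3_Psi_t q : TS3 q (Psi_t q).
Proof. by apply/TS3E; rewrite !mxE/=; ring. Qed.

Lemma TS3_Psi_y x y t : -1 < y < 1 -> TS3 (Psi x y t) (Psi_y (Psi x y t) y).
Proof.
move=> /andP[y1 y2]; apply/TS3E; have := Psi_w1 x t (ltW y1); have := Psi_w2 x t (ltW y2).
move: (Psi x y t) => q h1 h2; rewrite !mxE/=.
have -> : q 0 0 * (q 0 0 / (2 * (1 + y))) + q 0 1 * (q 0 1 / (2 * (1 + y))) +
  q 0 2 * (- q 0 2 / (2 * (1 - y))) + q 0 3 * (- q 0 3 / (2 * (1 - y))) =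
  (q 0 0 ^+ 2 + q 0 1 ^+ 2) / (2 * (1 + y)) - (q 0 2 ^+ 2 + q 0 3 ^+ 2) / (2 * (1 - y)) by ring.
have p1 : 1 + y != 0 by rewrite gt_eqF//; lra.
have p2 : 1 - y != 0 by rewrite gt_eqF//; lra.
by rewrite h1 h2; field; rewrite ?p1 ?p2.
Qed.

Lemma circle_actE phi q : circle_act phi q = \row_k
  [:: cos phi * q 0 0 - sin phi * q 0 1; cos phi * q 0 1 + sin phi * q 0 0;
      cos phi * q 0 2 - sin phi * q 0 3; cos phi * q 0 3 + sin phi * q 0 2]`_k.
Proof. by []. Qed.

Lemma circle_act_Psi phi x y t : circle_act phi (Psi x y t) = Psi x y (phi + t).
Proof.
have aE : phi + t - x / 2 = phi + (t - x / 2) by ring.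
have bE : phi + t + x / 2 = phi + (t + x / 2) by ring.
rewrite circle_actE; apply: row4P; rewrite !mxE/= ?aE ?bE;
  move: (t - x / 2) (t + x / 2) => a b; rewrite ?cosD ?sinD; ring.
Qed.

(* The quotient w2 / w1 written as e^(i x0) |w2 / w1| e^(i x). *)
Definition cross_re (x0 : R) q : R :=
  cos x0 * (q 0 0 * q 0 2 + q 0 1 * q 0 3) + sin x0 * (q 0 0 * q 0 3 - q 0 1 * q 0 2).
Definition cross_im (x0 : R) q : R :=
  cos x0 * (q 0 0 * q 0 3 - q 0 1 * q 0 2) - sin x0 * (q 0 0 * q 0 2 + q 0 1 * q 0 3).

Definition base_x x0 q : R := atan (cross_im x0 q / cross_re x0 q).
Definition base_y q : R := q 0 0 ^+ 2 + q 0 1 ^+ 2 - q 0 2 ^+ 2 - q 0 3 ^+ 2.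

Definition rot_re (x0 : R) q : R := cos (x0 / 2) * q 0 0 - sin (x0 / 2) * q 0 1.
Definition rot_im (x0 : R) q : R := cos (x0 / 2) * q 0 1 + sin (x0 / 2) * q 0 0.
Definition fibre_t x0 q : R := atan (rot_im x0 q / rot_re x0 q) + base_x x0 q / 2.

Lemma cross_re_Psi x0 x y t : cross_re x0 (Psi (x0 + x) y t) = hopf_rad y * hopf_rad (- y) * cos x.
Proof.
rewrite /cross_re !mxE/=.
have : x = (t + (x0 + x) / 2) - (t - (x0 + x) / 2) - x0 by field.
move: (t - _) (t + _) => a b ->; rewrite !cosB !sinB.
have := cos2Dsin2 x0 => h.
transitivity ((hopf_rad y * hopf_rad (- y)) * (cos x0 * (cos b * cos a + sin b * sin a) + sin x0 * (sin b * cos a - cos b * sin a))); first by ring.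
by congr (_ * _); ring.
Qed.

Lemma cross_im_Psi x0 x y t : cross_im x0 (Psi (x0 + x) y t) = hopf_rad y * hopf_rad (- y) * sin x.
Proof.
rewrite /cross_im !mxE/=.
have : x = (t + (x0 + x) / 2) - (t - (x0 + x) / 2) - x0 by field.
move: (t - _) (t + _) => a b ->; rewrite [in RHS]sinB !sinB !cosB.
by ring.
Qed.

Lemma base_y_Psi x y t : -1 <= y <= 1 -> base_y (Psi x y t) = y.
Proof.
move=> /andP[y1 y2]; have := Psi_w1 x t y1; have := Psi_w2 x t y2.
rewrite /base_y; lra.
Qed.

Let atan_quotient (r a : R) : r != 0 -> - (pi / 2) < a < pi / 2 -> atan (r * sin a / (r * cos a)) = a.
Proof.
move=> r0 a1; have c0 := cos_gt0_pihalf a1.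
rewrite -[RHS]tanK ?in_itv//=; congr atan; rewrite /tan.
by field; rewrite r0 gt_eqF.
Qed.

Lemma base_x_Psi x0 x y t : - (pi / 2) < x < pi / 2 -> -1 < y < 1 ->
  0 < cross_re x0 (Psi (x0 + x) y t) /\ base_x x0 (Psi (x0 + x) y t) = x.
Proof.
move=> hx /andP[y1 y2].
have r0 : 0 < hopf_rad y * hopf_rad (- y) by rewrite mulr_gt0// rad_gt0//; lra.
rewrite /base_x cross_re_Psi cross_im_Psi; split.
  by rewrite mulr_gt0// cos_gt0_pihalf.
by rewrite atan_quotient// gt_eqF.
Qed.

Lemma fibre_t_Psi x0 x y t : - (pi / 2) < x < pi / 2 -> -1 < y < 1 ->
  - (pi / 2) < t - x / 2 < pi / 2 ->
  0 < rot_re x0 (Psi (x0 + x) y t) /\ fibre_t x0 (Psi (x0 + x) y t) = t.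
Proof.
move=> hx hy ht; have [_ xE] := base_x_Psi x0 t hx hy.
have /andP[y1 _] := hy; have r0 := rad_gt0 y1.
have reE : rot_re x0 (Psi (x0 + x) y t) = hopf_rad y * cos (t - x / 2).
  rewrite /rot_re !mxE/=; have -> : t - x / 2 = (t - (x0 + x) / 2) + x0 / 2 by field.
  by rewrite [in RHS]cosD; ring.
have imE : rot_im x0 (Psi (x0 + x) y t) = hopf_rad y * sin (t - x / 2).
  rewrite /rot_im !mxE/=; have -> : t - x / 2 = (t - (x0 + x) / 2) + x0 / 2 by field.
  by rewrite [in RHS]sinD; ring.
rewrite /fibre_t xE reE imE atan_quotient// ?gt_eqF//; split; last by ring.
by rewrite mulr_gt0// cos_gt0_pihalf.
Qed.

Lemma polar (a b : R) : a ^+ 2 + b ^+ 2 = 1 -> exists t, a = cos t /\ b = sin t.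
Proof.
move=> ab; have a1 : -1 <= a <= 1.
  by rewrite -ler_norml -(@ler_pXn2r _ 2)// ?nnegrE// expr1n -normrX ger0_norm ?sqr_ge0//; have := sqr_ge0 b; lra.
have ca : cos (acos a) = a by rewrite acosK// in_itv.
have sa : sin (acos a) = `|b| by rewrite sin_acos// -sqrtr_sqr; congr Num.sqrt; lra.
have [b0|b0] := leP 0 b.
  by exists (acos a); rewrite ca sa ger0_norm.
by exists (- acos a); rewrite cosN sinN ca sa ltr0_norm// opprK.
Qed.

Lemma atan_polar (r a b : R) : 0 < r -> 0 < a -> a ^+ 2 + b ^+ 2 = r ^+ 2 ->
  r * cos (atan (b / a)) = a /\ r * sin (atan (b / a)) = b.
Proof.
move=> r0 a0 ab.
have c : r * cos (atan (b / a)) = a.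
  rewrite cos_atan (_ : 1 + (b / a) ^+ 2 = (r / a) ^+ 2); last first.
    by rewrite !exprMn -ab; field; rewrite gt_eqF.
  by rewrite sqrtr_sqr ger0_norm ?divr_ge0 ?ltW//; field; rewrite !gt_eqF.
split=> //; have c0 : 0 < cos (atan (b / a)).
  by apply: cos_gt0_pihalf; rewrite atan_gtNpi2 atan_ltpi2.
have : tan (atan (b / a)) = b / a by rewrite atanK.
rewrite /tan => h; rewrite -[sin _](divfK (lt0r_neq0 c0)) h.
by rewrite mulrCA c divfK// gt_eqF.
Qed.

Let cross_norm q : S3 q -> 4 * (q 0 0 ^+ 2 + q 0 1 ^+ 2) * (q 0 2 ^+ 2 + q 0 3 ^+ 2) = 1 - base_y q ^+ 2.
Proof. move=> /S3E h; transitivity ((q 0 0 ^+ 2 + q 0 1 ^+ 2 + q 0 2 ^+ 2 + q 0 3 ^+ 2) ^+ 2 - base_y q ^+ 2).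
  by rewrite /base_y; ring.
by rewrite h expr1n. Qed.

Let cross_sqr x0 q : cross_re x0 q ^+ 2 + cross_im x0 q ^+ 2 =
  (q 0 0 ^+ 2 + q 0 1 ^+ 2) * (q 0 2 ^+ 2 + q 0 3 ^+ 2).
Proof.
transitivity ((cos x0 ^+ 2 + sin x0 ^+ 2) * ((q 0 0 * q 0 2 + q 0 1 * q 0 3) ^+ 2 + (q 0 0 * q 0 3 - q 0 1 * q 0 2) ^+ 2)).
  by rewrite /cross_re /cross_im; ring.
by rewrite cos2Dsin2 mul1r; ring.
Qed.

Let rads q : S3 q -> hopf_rad (base_y q) ^+ 2 = q 0 0 ^+ 2 + q 0 1 ^+ 2 /\
  hopf_rad (- base_y q) ^+ 2 = q 0 2 ^+ 2 + q 0 3 ^+ 2.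
Proof.
move=> /S3E h; have h0 := sqr_ge0 (q 0 0); have h1 := sqr_ge0 (q 0 1).
have h2 := sqr_ge0 (q 0 2); have h3 := sqr_ge0 (q 0 3).
by rewrite !rad_sqr /base_y; lra.
Qed.

Lemma base_y_bounds x0 q : S3 q -> 0 < cross_re x0 q -> -1 < base_y q < 1.
Proof.
move=> Sq c0; have := cross_norm Sq; have := cross_sqr x0 q => h1 h2.
have : 0 < cross_re x0 q ^+ 2 by rewrite exprn_gt0.
have := sqr_ge0 (cross_im x0 q) => h3 h4.
have : base_y q ^+ 2 < 1 by lra.
by rewrite -[X in _ < X](expr1n _ 2) -real_normK ?num_real// ltr_pXn2r ?nnegrE// ltr_norml.
Qed.

(** [cross_re] and [cross_im] are the parts of e^(- i x0) times the product of w2 with the conjugate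
    of w1, whose argument is [base_x]. So the argument [a] of w1 determines that of w2, and [base_y]
    determines both moduli. *)
Lemma Psi_base x0 q a : S3 q -> 0 < cross_re x0 q ->
  q 0 0 = hopf_rad (base_y q) * cos a -> q 0 1 = hopf_rad (base_y q) * sin a ->
  q = Psi (x0 + base_x x0 q) (base_y q) (a + (x0 + base_x x0 q) / 2).
Proof.
move=> Sq c0 q0 q1; have /andP[y1 y2] := base_y_bounds Sq c0.
have r1 := rad_gt0 y1; have r2 : 0 < hopf_rad (- base_y q) by apply: rad_gt0; lra.
have [R1 R2] := rads Sq.
have rr : 0 < hopf_rad (base_y q) * hopf_rad (- base_y q) by rewrite mulr_gt0.
have csq : cross_re x0 q ^+ 2 + cross_im x0 q ^+ 2 = (hopf_rad (base_y q) * hopf_rad (- base_y q)) ^+ 2.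
  by rewrite cross_sqr exprMn R1 R2.
have [] := atan_polar rr c0 csq.
rewrite -/(base_x x0 q); set x := base_x x0 q => C S.
have key1 : q 0 0 * q 0 2 + q 0 1 * q 0 3 = hopf_rad (base_y q) * hopf_rad (- base_y q) * cos (x0 + x).
  rewrite cosD mulrBr (mulrCA _ (cos x0)) (mulrCA _ (sin x0)) C S /cross_re /cross_im.
  by transitivity ((cos x0 ^+ 2 + sin x0 ^+ 2) * (q 0 0 * q 0 2 + q 0 1 * q 0 3)); [rewrite cos2Dsin2 mul1r|ring].
have key2 : q 0 0 * q 0 3 - q 0 1 * q 0 2 = hopf_rad (base_y q) * hopf_rad (- base_y q) * sin (x0 + x).
  rewrite sinD mulrDr (mulrCA _ (cos x0)) (mulrCA _ (sin x0)) C S /cross_re /cross_im.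
  by transitivity ((cos x0 ^+ 2 + sin x0 ^+ 2) * (q 0 0 * q 0 3 - q 0 1 * q 0 2)); [rewrite cos2Dsin2 mul1r|ring].
have half : a + (x0 + x) / 2 - (x0 + x) / 2 = a by ring.
have full : a + (x0 + x) / 2 + (x0 + x) / 2 = a + (x0 + x) by field.
have w1p : 0 < q 0 0 ^+ 2 + q 0 1 ^+ 2 by rewrite -R1 exprn_gt0.
have R1' := R1; rewrite q0 q1 in R1' key1 key2.
have ca := cos2Dsin2 a.
have q2E : hopf_rad (base_y q) * q 0 2 = hopf_rad (base_y q) * (hopf_rad (- base_y q) * cos (a + (x0 + x))).
  rewrite cosD !mulrBr; move: key1 key2; move: (hopf_rad _) (hopf_rad _) (cos (x0 + x)) (sin (x0 + x)) => s r C' S' k1 k2.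
  transitivity (cos a * (r * cos a * q 0 2 + r * sin a * q 0 3) - sin a * (r * cos a * q 0 3 - r * sin a * q 0 2)).
    by rewrite -[LHS]mulr1 -ca; ring.
  by rewrite k1 k2; ring.
have q3E : hopf_rad (base_y q) * q 0 3 = hopf_rad (base_y q) * (hopf_rad (- base_y q) * sin (a + (x0 + x))).
  rewrite sinD !mulrDr; move: key1 key2; move: (hopf_rad _) (hopf_rad _) (cos (x0 + x)) (sin (x0 + x)) => s r C' S' k1 k2.
  transitivity (sin a * (r * cos a * q 0 2 + r * sin a * q 0 3) + cos a * (r * cos a * q 0 3 - r * sin a * q 0 2)).
    by rewrite -[LHS]mulr1 -ca; ring.
  by rewrite k1 k2; ring.
by apply: row4P; rewrite [RHS]mxE/= ?half ?full //; apply: (mulfI (lt0r_neq0 r1)).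
Qed.

Lemma Psi_base_exists x0 q : S3 q -> 0 < cross_re x0 q ->
  exists t, q = Psi (x0 + base_x x0 q) (base_y q) t.
Proof.
move=> Sq c0; have /andP[y1 y2] := base_y_bounds Sq c0.
have r1 := rad_gt0 y1; have [R1 _] := rads Sq.
have [] := @polar (q 0 0 / hopf_rad (base_y q)) (q 0 1 / hopf_rad (base_y q)).
  by rewrite !exprMn -mulrDl -R1 exprVn mulfV// expf_neq0// gt_eqF.
move=> a [ca sa]; exists (a + (x0 + base_x x0 q) / 2); apply: Psi_base => //.
- by rewrite -ca mulrC divfK// gt_eqF.
- by rewrite -sa mulrC divfK// gt_eqF.
Qed.

Lemma Psi_fibre x0 q : S3 q -> 0 < cross_re x0 q -> 0 < rot_re x0 q ->
  Psi (x0 + base_x x0 q) (base_y q) (fibre_t x0 q) = q.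
Proof.
move=> Sq c0 r0; have /andP[y1 y2] := base_y_bounds Sq c0.
have r1 := rad_gt0 y1; have [R1 _] := rads Sq.
have h0 := cos2Dsin2 (x0 / 2).
have rsq : rot_re x0 q ^+ 2 + rot_im x0 q ^+ 2 = hopf_rad (base_y q) ^+ 2.
  rewrite R1 -[RHS]mul1r -h0 /rot_re /rot_im; ring.
have [C S] := atan_polar r1 r0 rsq.
rewrite [RHS](@Psi_base x0 q (atan (rot_im x0 q / rot_re x0 q) - x0 / 2))//.
- by congr (Psi _ _ _); rewrite /fibre_t; ring.
- move: (atan (rot_im _ _ / _)) C S => a C S; rewrite cosB.
  transitivity (cos (x0 / 2) * (hopf_rad (base_y q) * cos a) + sin (x0 / 2) * (hopf_rad (base_y q) * sin a)); last by ring.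
  rewrite C S; transitivity ((cos (x0 / 2) ^+ 2 + sin (x0 / 2) ^+ 2) * q 0 0); first by rewrite h0 mul1r.
  by rewrite /rot_re /rot_im; ring.
- move: (atan (rot_im _ _ / _)) C S => a C S; rewrite sinB.
  transitivity (cos (x0 / 2) * (hopf_rad (base_y q) * sin a) - sin (x0 / 2) * (hopf_rad (base_y q) * cos a)); last by ring.
  rewrite C S; transitivity ((cos (x0 / 2) ^+ 2 + sin (x0 / 2) ^+ 2) * q 0 1); first by rewrite h0 mul1r.
  by rewrite /rot_re /rot_im; ring.
Qed.

End Coordinates.

(** * The radial retraction and tangent vectors of the sphere *)

Section Sphere.
Context {R : realType}.
Local Notation P3 := (R * R * R)%type.
Local Notation R4 := 'rV[R]_4.
Implicit Types (V W : normedModType R) (q : R4).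

Definition nsq q : R := q 0 0 ^+ 2 + q 0 1 ^+ 2 + q 0 2 ^+ 2 + q 0 3 ^+ 2.

Lemma sum4 (F : 'I_4 -> R) : \sum_i F i = F 0 + F 1 + F 2 + F 3.
Proof.
rewrite !big_ord_recl big_ord0 !addr0 !addrA.
by congr (_ + F _ + F _ + F _); apply/val_inj.
Qed.

Lemma nsq_ge0 q : 0 <= nsq q.
Proof. by rewrite /nsq !addr_ge0// sqr_ge0. Qed.

Lemma nsq_eq0 q : (nsq q == 0) = (q == 0).
Proof.
apply/eqP/eqP => [|->]; last by rewrite /nsq !mxE; ring.
have h0 := sqr_ge0 (q 0 0); have h1 := sqr_ge0 (q 0 1).
have h2 := sqr_ge0 (q 0 2); have h3 := sqr_ge0 (q 0 3); rewrite /nsq => E.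
by apply: row4P; rewrite mxE; apply/eqP; rewrite -sqrf_eq0; apply/eqP; lra.
Qed.

Lemma S3_nsq q : S3 q <-> nsq q = 1.
Proof. exact: S3E. Qed.

Lemma retrE q : retr q = (Num.sqrt (nsq q))^-1 *: q.
Proof. by rewrite /retr sum4. Qed.

Lemma retr_id q : S3 q -> retr q = q.
Proof. by move=> /S3_nsq h; rewrite retrE h sqrtr1 invr1 scale1r. Qed.

Lemma nsqZ a q : nsq (a *: q) = a ^+ 2 * nsq q.
Proof. by rewrite /nsq !mxE; ring. Qed.

Lemma retr_S3 q : 0 < nsq q -> S3 (retr q).
Proof.
move=> n0; apply/S3_nsq; rewrite retrE nsqZ exprVn sqr_sqrtr ?mulVf ?gt_eqF//.
exact: ltW.
Qed.

Lemma has_diff_coord V (f : V -> R4) u v d i : has_diff f u v d ->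
  has_diff (fun w => f w 0 i) u v (d 0 i).
Proof. by move=> [df <-]; exact: diff_coord. Qed.

Lemma has_diff_id V (u v : V) : has_diff (fun w : V => w) u v v.
Proof. by split; [exact: ex_diff|rewrite diff_val]. Qed.

Lemma has_diff_nsq V (f : V -> R4) u v d : has_diff f u v d ->
  has_diff (fun w => nsq (f w)) u v
    (2 * (f u 0 0 * d 0 0 + f u 0 1 * d 0 1 + f u 0 2 * d 0 2 + f u 0 3 * d 0 3)).
Proof.
move=> h.
have sq i : has_diff (fun w => f w 0 i ^+ 2) u v (d 0 i * f u 0 i + f u 0 i * d 0 i).
  exact: has_diffM (has_diff_coord i h) (has_diff_coord i h).
apply: (has_diff_eq (has_diffD (has_diffD (has_diffD (sq 0) (sq 1)) (sq 2)) (sq 3))).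
by ring.
Qed.

Lemma has_diff_retr q X : S3 q ->
  has_diff (@retr R 4) q X
    (X - (q 0 0 * X 0 0 + q 0 1 * X 0 1 + q 0 2 * X 0 2 + q 0 3 * X 0 3) *: q).
Proof.
move=> Sq; have n1 : nsq q = 1 by apply/S3_nsq.
have hn := has_diff_nsq (has_diff_id q X).
have h1 : is_derive (nsq q) 1 (fun s : R => (Num.sqrt s)^-1) (- 2^-1).
  have n0 : 0 < nsq q by rewrite n1.
  have s0 : Num.sqrt (nsq q) != 0 by rewrite gt_eqF// sqrtr_gt0.
  have h := is_deriveV s0 (is_derive1_sqrt n0).
  by apply: (is_derive_eq h); rewrite n1 sqrtr1 /GRing.scale/= expr1n invr1; field.
have hr := has_diff_comp1 h1 hn.
have hi i := has_diffM hr (has_diff_coord i (has_diff_id q X)).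
have := has_diff_row hi.
rewrite (_ : (fun w => _) = @retr R 4); last by apply/funext => w; apply/rowP => i; rewrite retrE !mxE.
move=> /has_diff_eq; apply; apply/rowP => i; rewrite !mxE n1 sqrtr1 invr1.
by field.
Qed.

Lemma has_diff_retr_tangent q X : S3 q -> TS3 q X -> has_diff (@retr R 4) q X X.
Proof.
move=> Sq /TS3E TX; apply: (has_diff_eq (has_diff_retr X Sq)).
by rewrite TX scale0r subr0.
Qed.

Lemma has_diff_comp V W V' (f : V -> W) (g : W -> V') u v d e :
  has_diff f u v d -> has_diff g (f u) d e -> has_diff (fun w => g (f w)) u v e.
Proof.
move=> [df <-] [dg <-].
have [dgf E] := diff_compE v df dg.
by split; [exact: dgf|exact: E].
Qed.

Lemma has_diffZ (X : R4) (s v : R) : has_diff (fun t : R => t *: X) s v (v *: X).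
Proof.
have := has_diff_row (fun i : 'I_4 => has_diffM (has_diff_id s v) (has_diff_cst (X 0 i) s v)).
rewrite (_ : (fun w => _) = (fun t : R => t *: X)); last by apply/funext => w; apply/rowP => i; rewrite !mxE.
move=> /has_diff_eq; apply; apply/rowP => i; rewrite !mxE; ring.
Qed.

Lemma tangent_curve q X : S3 q -> TS3 q X ->
  exists c : R -> R4, [/\ forall t, S3 (c t), c 0 = q, differentiable c 0 & 'd c 0 1 = X].
Proof.
move=> Sq TX; exists (fun t => retr (q + t *: X)).
have h := has_diffD (has_diff_cst q (0 : R) 1) (has_diffZ X 0 1).
have q0 : q + 0 *: X = q by rewrite scale0r addr0.
have hr : has_diff (@retr R 4) (q + 0 *: X) (0 + 1 *: X) X.
  by rewrite q0 add0r scale1r; exact: has_diff_retr_tangent.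
have [dc dE] := has_diff_comp h hr; split => //.
- move=> t; apply: retr_S3; move: Sq TX => /S3E Sq /TS3E TX.
  have -> : nsq (q + t *: X) = nsq q + t ^+ 2 * nsq X +
      2 * t * (q 0 0 * X 0 0 + q 0 1 * X 0 1 + q 0 2 * X 0 2 + q 0 3 * X 0 3).
    by rewrite /nsq !mxE; ring.
  by rewrite TX mulr0 addr0 /nsq Sq ltr_wpDr// mulr_ge0 ?sqr_ge0// nsq_ge0.
- by rewrite q0 retr_id.
Qed.

End Sphere.

(** * Smoothness and differentiability of composite functions *)

Section SmoothCoordinates.
Context {R : realType}.
Implicit Types (V W : normedModType R).

Lemma class_C_fst_of V W W' k (U : set V) (f : V -> (W * W')%type) : open U ->
  class_C k U f -> class_C k U (fun x => (f x).1).
Proof.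
move=> oU cf; have [l lE] := fst_linear_map W W'.
have cl : continuous l by rewrite lE => y; exact: cvg_fst.
by have := class_C_comp_linear oU cl cf; rewrite lE.
Qed.

Lemma class_C_snd_of V W W' k (U : set V) (f : V -> (W * W')%type) : open U ->
  class_C k U f -> class_C k U (fun x => (f x).2).
Proof.
move=> oU cf; have [l lE] := snd_linear_map W W'.
have cl : continuous l by rewrite lE => y; exact: cvg_snd.
by have := class_C_comp_linear oU cl cf; rewrite lE.
Qed.

Lemma is_derive_atan (x : R) : is_derive x 1 atan ((1 + x ^+ 2)^-1).
Proof.
by split; [exact: derivable_atan|rewrite -derive1E derive1_atan].
Qed.

Lemma class_C_atan V k (U : set V) (f : V -> R) : open U ->
  class_C k U f -> class_C k U (fun x => atan (f x)).
Proof.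
move=> oU; case: k => [|k] Hf.
  by apply: class_C_comp0 => // x _; exact: continuous_atan.
apply: (class_C_comp1 (psi := fun y => (1 + y ^+ 2)^-1) oU (fun x _ => is_derive_atan (f x)) Hf).
have Hf' := class_CS Hf.
apply: class_C_inv => //.
  by move=> x _; rewrite gt_eqF// ltr_wpDr// sqr_ge0.
by apply: class_CD => //; [exact: class_C_cst|exact: class_CM].
Qed.

Lemma diffbleD V (f g : V -> R) x : differentiable f x -> differentiable g x ->
  differentiable (fun y => f y + g y) x.
Proof. exact: differentiableD. Qed.

Lemma diffbleN V (f : V -> R) x : differentiable f x -> differentiable (fun y => - f y) x.
Proof. exact: differentiableN. Qed.

Lemma diffbleM V (f g : V -> R) x : differentiable f x -> differentiable g x ->
  differentiable (fun y => f y * g y) x.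
Proof. exact: differentiableM. Qed.

Lemma diffbleX2 V (f : V -> R) x : differentiable f x -> differentiable (fun y => f y ^+ 2) x.
Proof. by move=> df; exact: (differentiableM df df). Qed.

Lemma diffble_comp1 V (phi : R -> R) (f : V -> R) x d : is_derive (f x) 1 phi d ->
  differentiable f x -> differentiable (fun y => phi (f y)) x.
Proof. by move=> dphi df; have [] := diff_comp1 0 dphi df. Qed.

Lemma diffble_div V (f g : V -> R) x : g x != 0 -> differentiable f x -> differentiable g x ->
  differentiable (fun y => f y / g y) x.
Proof.
move=> g0 df dg; apply: diffbleM => //.
exact: (diffble_comp1 (is_deriveV g0 (is_derive_id (g x) (1 : R))) dg).
Qed.

Lemma class_C_fst_fst k (U : set (R * R * R)) : open U -> class_C k U (fun u => u.1.1 : R).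
Proof. by move=> oU; apply: class_C_fst_of => //; exact: class_C_fst. Qed.

Lemma class_C_fst_snd k (U : set (R * R * R)) : open U -> class_C k U (fun u => u.1.2 : R).
Proof. by move=> oU; apply: class_C_snd_of => //; exact: class_C_fst. Qed.

End SmoothCoordinates.

(** * A box chart and the two families of Legendrian leaves *)

Section HopfCharts.
Context {R : realType}.
Local Notation P3 := (R * R * R)%type.
Local Notation R4 := 'rV[R]_4.
Implicit Types (q : R4).
Variable x0 : R.

Definition coord_dom : set R4 := [set q | 0 < cross_re x0 q /\ 0 < rot_re x0 q].

Let dcoord q i : differentiable (fun q : R4 => q 0 i) q.
Proof. by have [] := has_diff_coord i (has_diff_id q 0). Qed.

Let dcross_re q : differentiable (cross_re x0) q.
Proof.
by repeat first [exact: dcoord | exact: differentiable_cst | apply: diffbleD | apply: diffbleN | apply: diffbleM].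
Qed.

Let dcross_im q : differentiable (cross_im x0) q.
Proof.
by repeat first [exact: dcoord | exact: differentiable_cst | apply: diffbleD | apply: diffbleN | apply: diffbleM].
Qed.

Let drot_re q : differentiable (rot_re x0) q.
Proof.
by repeat first [exact: dcoord | exact: differentiable_cst | apply: diffbleD | apply: diffbleN | apply: diffbleM].
Qed.

Let drot_im q : differentiable (rot_im x0) q.
Proof.
by repeat first [exact: dcoord | exact: differentiable_cst | apply: diffbleD | apply: diffbleN | apply: diffbleM].
Qed.

Lemma differentiable_base_y q : differentiable (@base_y R) q.
Proof.
by repeat first [exact: dcoord | exact: differentiable_cst | apply: diffbleD | apply: diffbleN | apply: diffbleX2].
Qed.

Lemma differentiable_cross_re q : differentiable (cross_re x0) q.
Proof. exact: dcross_re. Qed.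

Lemma differentiable_base_x q : 0 < cross_re x0 q -> differentiable (base_x x0) q.
Proof.
move=> c0; apply: (diffble_comp1 (is_derive_atan _)).
by apply: diffble_div; [rewrite gt_eqF|exact: dcross_im|exact: dcross_re].
Qed.

Lemma differentiable_fibre_t q : coord_dom q -> differentiable (fibre_t x0) q.
Proof.
move=> [c0 r0]; apply: diffbleD.
  apply: (diffble_comp1 (is_derive_atan _)).
  by apply: diffble_div; [rewrite gt_eqF|exact: drot_im|exact: drot_re].
by apply: diffbleM; [exact: differentiable_base_x|exact: differentiable_cst].
Qed.

Lemma open_pos_preimage (h : R4 -> R) : (forall q, differentiable h q) -> open [set q | 0 < h q].
Proof.
move=> dh; have ch : continuous h by move=> q; exact: differentiable_continuous.
have /continuousP H := ch; have := H _ (@open_gt R 0); exact.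
Qed.

Lemma open_coord_dom : open coord_dom.
Proof.
apply: (@openI _ [set q | 0 < cross_re x0 q] [set q | 0 < rot_re x0 q]); exact: open_pos_preimage.
Qed.

Lemma open_rect (a b : R) : open [set u : R * R | `|u.1| < a /\ `|u.2| < b].
Proof.
rewrite openE => -[x y] [/= xa yb].
apply/nbhs_ballP; exists (Num.min (a - `|x|) (b - `|y|)) => /=.
  by rewrite lt_min !subr_gt0 xa.
move=> [x' y']; rewrite /ball/= /prod_ball/= /ball/= !lt_min => -[/andP[h _] /andP[_ h']]; split.
  have := ler_distD x x' 0; rewrite !subr0 distrC; lra.
have := ler_distD y y' 0; rewrite !subr0 distrC; lra.
Qed.

Lemma open_setX (D : set (R * R)) (T : set R) : open D -> open T -> open (D `*` T : set P3).
Proof.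
move=> oD oT; rewrite openE => -[d t] [Dd Tt]; exists (D, T) => //=.
by split; exact: open_nbhs_nbhs.
Qed.

(** These bounds keep [t - x / 2] in ]-1, 1[, inside the range of [atan], so that t can be
    recovered. *)
Definition box3 : set P3 := [set u : R * R | `|u.1| < 1 /\ `|u.2| < 2^-1] `*` [set t : R | `|t| < 8^-1].

Let pihalf : (1 : R) <= pi / 2.
Proof. exact: pihalf_ge1. Qed.

Let within_pihalf (z : R) : -1 < z < 1 -> - (pi / 2) < z < pi / 2.
Proof.
move=> /andP[z1 z2]; rewrite (lt_le_trans z2 pihalf) andbT (le_lt_trans _ z1)//.
by rewrite lerN2.
Qed.

Lemma Psi_chart : chart box3 (fun u : P3 => Psi (x0 + u.1.1) u.1.2 u.2) coord_dom
  (fun q => ((base_x x0 q, base_y q), fibre_t x0 q)).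
Proof.
have oB : open box3.
  apply: open_setX; first exact: open_rect.
  rewrite (_ : [set t | _] = ball 0 8^-1); first exact: ball_open.
  by apply/seteqP; split => t; rewrite -ball_normE/= sub0r normrN.
split => //; [|exact: open_coord_dom| |split].
- move=> k; apply: class_C_Psi => //.
  + by move=> u [[_ h] _]; move: h; rewrite /= ltr_norml => /andP[? ?]; apply/andP; split; lra.
  + by apply: class_CD => //; [exact: class_C_cst|exact: class_C_fst_fst].
  + exact: class_C_fst_snd.
  + exact: class_C_snd.
- move=> q Wq; apply: differentiable_pair; last exact: differentiable_fibre_t.
  by apply: differentiable_pair; [apply: differentiable_base_x; exact: Wq.1|exact: differentiable_base_y].
- move=> [[x y] t] [[/= hx hy] ht]; move: hx hy ht; rewrite !ltr_norml => /andP[x1 x2] /andP[y1 y2] /andP[t1 t2].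
  have hx : - (pi / 2) < x < pi / 2 by apply: within_pihalf; apply/andP; split; lra.
  have hy : -1 < y < 1 by apply/andP; split; lra.
  have ht : - (pi / 2) < t - x / 2 < pi / 2 by apply: within_pihalf; apply/andP; split; lra.
  have [c0 xE] := base_x_Psi x0 t hx hy; have [r0 tE] := fibre_t_Psi x0 hx hy ht.
  split; [by apply: Psi_S3; apply/andP; split; lra|by split|].
  by rewrite xE tE base_y_Psi//; apply/andP; split; lra.
- by move=> q Sq [c0 r0] _ /=; exact: Psi_fibre.
Qed.

Definition xleaf_dom : set (R * R) := [set u | `|u.1| < 2^-1 /\ `|u.2| < 8^-1].

(* The Legendrian curves y = y0, t = t0 + x y0 / 2, parametrized by R. *)
Definition xleaf (u : P3) : R4 :=
  Psi (x0 + atan u.2) u.1.1 (u.1.2 + u.1.1 * (atan u.2 / 2)).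

Let atan_bounds (s : R) : - (pi / 2) < atan s < pi / 2.
Proof. by rewrite atan_gtNpi2 atan_ltpi2. Qed.

Lemma xleaf_chart : chart (xleaf_dom `*` setT) xleaf coord_dom
  (fun q => ((base_y q, fibre_t x0 q - base_y q * (base_x x0 q / 2)), cross_im x0 q / cross_re x0 q)).
Proof.
have oB : open (xleaf_dom `*` setT : set P3) by apply: open_setXT; exact: open_rect.
split => //; [|exact: open_coord_dom| |split].
- move=> k; apply: class_C_Psi => //.
  + by move=> u [[h _] _]; move: h; rewrite /= ltr_norml => /andP[? ?]; apply/andP; split; lra.
  + by apply: class_CD => //; [exact: class_C_cst|apply: class_C_atan => //; exact: class_C_snd].
  + exact: class_C_fst_fst.
  + apply: class_CD => //; first exact: class_C_fst_snd.
    apply: class_CM => //; first exact: class_C_fst_fst.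
    apply: class_CM => //; last exact: class_C_cst.
    by apply: class_C_atan => //; exact: class_C_snd.
- move=> q Wq; have dx := differentiable_base_x Wq.1; have dy := differentiable_base_y q.
  apply: differentiable_pair; last by apply: diffble_div; [rewrite gt_eqF//; exact: Wq.1|exact: dcross_im|exact: dcross_re].
  apply: differentiable_pair => //; apply: diffbleD; first exact: differentiable_fibre_t.
  apply: diffbleN; apply: diffbleM => //; apply: diffbleM => //; exact: differentiable_cst.
- move=> [[y t] s] [[/= hy ht] _]; move: hy ht; rewrite !ltr_norml => /andP[y1 y2] /andP[t1 t2].
  have hx := atan_bounds s; rewrite /xleaf/=; set x := atan s in hx *.
  have hy : -1 < y < 1 by apply/andP; split; lra.
  (* As |y| < 1 / 2, the number (1 - y) |x| / 2 is below three quarters of pi / 2, and |t| < 1 / 8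
     fits in the remaining quarter. *)
  have ht : - (pi / 2) < t + y * (x / 2) - x / 2 < pi / 2.
    have /andP[x1 x2] := hx; move: (pi / 2) pihalf x1 x2 => p p1 x1 x2.
    have h1 : 0 < (1 - y) * (p - x) by rewrite mulr_gt0// subr_gt0//; lra.
    have h2 : 0 < (1 - y) * (p + x) by rewrite mulr_gt0//; lra.
    have h3 : 0 < p * (y + 2^-1) by rewrite mulr_gt0//; lra.
    by clear -h1 h2 h3 t1 t2 p1; apply/andP; split; lra.
  have [c0 xE] := base_x_Psi x0 (t + y * (x / 2)) hx hy; have [r0 tE] := fibre_t_Psi x0 hx hy ht.
  split; [by apply: Psi_S3; apply/andP; split; lra|by split|].
  have <- : tan (base_x x0 (Psi (x0 + x) y (t + y * (x / 2)))) = 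
     cross_im x0 (Psi (x0 + x) y (t + y * (x / 2))) / cross_re x0 (Psi (x0 + x) y (t + y * (x / 2))).
    by rewrite /base_x atanK.
  rewrite xE tE base_y_Psi; last by apply/andP; split; lra.
  by rewrite /x atanK addrK.
- by move=> q Sq [c0 r0] _ /=; rewrite /xleaf/= -/(base_x x0 q) subrK; exact: Psi_fibre.
Qed.

Definition yleaf_dom : set (R * R) := [set u | `|u.1| < 1 /\ `|u.2| < 8^-1].

(** The Legendrian curves x, t constant. The height [atan s / 2] sweeps ]- pi / 4, pi / 4[, which
    contains [- 1 / 2, 1 / 2] and stays within ]-1, 1[. *)
Definition yleaf (u : P3) : R4 := Psi (x0 + u.1.1) (atan u.2 / 2) u.1.2.

Let atan2_bounds (s : R) : - (1 : R) < atan s / 2 < 1.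
Proof.
have /andP[h1 h2] := atan_bounds s; have := @pihalf_lt2 R => h3; apply/andP; split; lra.
Qed.

Lemma atan_half_bounds (s : R) : - (1 : R) < atan s / 2 < 1.
Proof. exact: atan2_bounds. Qed.

Lemma yleaf_chart : chart (yleaf_dom `*` setT) yleaf
  (coord_dom `&` [set q | - (pi / 2) < 2 * base_y q < pi / 2])
  (fun q => ((base_x x0 q, fibre_t x0 q), tan (2 * base_y q))).
Proof.
have oB : open (yleaf_dom `*` setT : set P3) by apply: open_setXT; exact: open_rect.
have d2y q : differentiable (fun q => 2 * base_y q) q.
  by apply: diffbleM; [exact: differentiable_cst|exact: differentiable_base_y].
split => //; [| | |split].
- move=> k; apply: class_C_Psi => //.
  + by apply: class_CD => //; [exact: class_C_cst|exact: class_C_fst_fst].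
  + by apply: class_CM => //; [apply: class_C_atan => //; exact: class_C_snd|exact: class_C_cst].
  + exact: class_C_fst_snd.
- apply: openI; first exact: open_coord_dom.
  have -> : [set q : R4 | - (pi / 2) < 2 * base_y q < pi / 2] =
    [set q | 0 < 2 * base_y q + pi / 2] `&` [set q | 0 < pi / 2 - 2 * base_y q].
    by apply/seteqP; split => q /= => [/andP[h1 h2]|[h1 h2]]; [split; lra|apply/andP; split; lra].
  apply: openI; apply: open_pos_preimage => q; apply: diffbleD => //; try exact: differentiable_cst.
  exact: diffbleN.
- move=> q [Wq hy]; apply: differentiable_pair.
    by apply: differentiable_pair; [apply: differentiable_base_x; exact: Wq.1|exact: differentiable_fibre_t].
  apply: (diffble_comp1 (is_derive_tan _)) => //; first by rewrite gt_eqF// cos_gt0_pihalf.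
- move=> [[x t] s] [[/= hx ht] _]; move: hx ht; rewrite !ltr_norml => /andP[x1 x2] /andP[t1 t2].
  have hy := atan2_bounds s; rewrite /yleaf/=; set y := atan s / 2 in hy *.
  have hx : - (pi / 2) < x < pi / 2 by apply: within_pihalf; apply/andP; split; lra.
  have ht : - (pi / 2) < t - x / 2 < pi / 2 by apply: within_pihalf; apply/andP; split; lra.
  have y2E : 2 * y = atan s by rewrite /y mulrC divfK.
  have [c0 xE] := base_x_Psi x0 t hx hy; have [r0 tE] := fibre_t_Psi x0 hx hy ht.
  have yE : base_y (Psi (x0 + x) y t) = y.
    by rewrite base_y_Psi//; move: hy => /andP[? ?]; apply/andP; split; lra.
  split; [by apply: Psi_S3; move: hy => /andP[? ?]; apply/andP; split; lra| |].
    by split; [split|rewrite /= yE y2E; exact: atan_bounds].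
  by rewrite xE tE yE y2E atanK.
- move=> q Sq [[c0 r0] /= hy] _; rewrite /yleaf/= tanK ?in_itv//=.
  rewrite (_ : 2 * base_y q / 2 = base_y q); last by field.
  exact: Psi_fibre.
Qed.

Lemma has_diff_xleaf u : (xleaf_dom `*` setT) u ->
  has_diff xleaf u (0, 1)
    ((1 + u.2 ^+ 2)^-1 *: (Psi_x (xleaf u) + (u.1.1 / 2) *: Psi_t (xleaf u))).
Proof.
move=> [[/= h _] _]; have y1 : -1 < u.1.1 < 1.
  by move: h; rewrite ltr_norml => /andP[? ?]; apply/andP; split; lra.
have h11 : has_diff (fun u : P3 => u.1.1) u (0, 1) 0.
  have [d E] := diff_fst u; have [d' E'] := diff_fst u.1.
  by apply: (has_diff_comp (d := 0)); split => //; rewrite ?E ?E'.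
have h12 : has_diff (fun u : P3 => u.1.2) u (0, 1) 0.
  have [d E] := diff_fst u; have [d' E'] := diff_snd u.1.
  by apply: (has_diff_comp (d := 0)); split => //; rewrite ?E ?E'.
have h2 : has_diff (fun u : P3 => atan u.2) u (0, 1) (1 * (1 + u.2 ^+ 2)^-1).
  apply: (has_diff_comp1 (f := fun u : P3 => u.2) (is_derive_atan _)).
  by have [d E] := diff_snd u; split => //; rewrite E.
have hx := has_diffD (has_diff_cst x0 u (0, 1)) h2.
have ht := has_diffD h12 (has_diffM h11 (has_diffM h2 (has_diff_cst (2^-1 : R) u (0, 1)))).
have := has_diff_Psi (y := fun u : P3 => u.1.1) y1 hx h11 ht; rewrite -/(xleaf u).
move=> /has_diff_eq; apply; rewrite scale0r addr0 !add0r !mul1r mulr0 addr0 mul0r add0r.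
by rewrite scalerDr scalerA; congr (_ *: _ + _ *: _); ring.
Qed.

Lemma has_diff_yleaf u : (yleaf_dom `*` setT) u ->
  has_diff yleaf u (0, 1) (((1 + u.2 ^+ 2)^-1 / 2) *: Psi_y (yleaf u) (atan u.2 / 2)).
Proof.
move=> _; have y1 := atan2_bounds u.2.
have h11 : has_diff (fun u : P3 => u.1.1) u (0, 1) 0.
  have [d E] := diff_fst u; have [d' E'] := diff_fst u.1.
  by apply: (has_diff_comp (d := 0)); split => //; rewrite ?E ?E'.
have h12 : has_diff (fun u : P3 => u.1.2) u (0, 1) 0.
  have [d E] := diff_fst u; have [d' E'] := diff_snd u.1.
  by apply: (has_diff_comp (d := 0)); split => //; rewrite ?E ?E'.
have h2 : has_diff (fun u : P3 => atan u.2) u (0, 1) (1 * (1 + u.2 ^+ 2)^-1).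
  apply: (has_diff_comp1 (f := fun u : P3 => u.2) (is_derive_atan _)).
  by have [d E] := diff_snd u; split => //; rewrite E.
have hx := has_diffD (has_diff_cst x0 u (0, 1)) h11.
have hy := has_diffM h2 (has_diff_cst (2^-1 : R) u (0, 1)).
have := has_diff_Psi (y := fun u => atan u.2 / 2) y1 hx hy h12; rewrite -/(yleaf u).
move=> /has_diff_eq; apply; rewrite addr0 !scale0r add0r addr0 mulr0 addr0.
by congr (_ *: _); ring.
Qed.

Lemma TS3_lin q X Y (a b : R) : TS3 q X -> TS3 q Y -> TS3 q (a *: X + b *: Y).
Proof.
move=> /TS3E h1 /TS3E h2; apply/TS3E; rewrite !mxE.
transitivity (a * (q 0 0 * X 0 0 + q 0 1 * X 0 1 + q 0 2 * X 0 2 + q 0 3 * X 0 3) +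
  b * (q 0 0 * Y 0 0 + q 0 1 * Y 0 1 + q 0 2 * Y 0 2 + q 0 3 * Y 0 3)); first by ring.
by rewrite h1 h2 !mulr0 addr0.
Qed.

Lemma xleaf_ACL (f : R4 -> R4) : ACL f ->
  (@lebesgue_measure R \x @lebesgue_measure R)%E.-negligible
    (xleaf_dom `&` [set d | ~ forall a b, abs_continuous a b (fun s => f (xleaf (d, s)))]).
Proof.
apply: (chart_ACL xleaf_chart).
- move=> u1 u2 u3 s1 s2 s3 Du k; rewrite /xleaf/=; apply: class_C_Psi => //; first exact: openT.
  + by move=> t _; have [/= + _] := Du t; rewrite ltr_norml => /andP[? ?]; apply/andP; split; lra.
  + apply: class_CD; [exact: openT|exact: class_C_cst|].
    by apply: class_C_atan; [exact: openT|exact: s3].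
  + apply: class_CD; [exact: openT|exact: s2|].
    apply: class_CM; [exact: openT|exact: s1|].
    apply: class_CM; [exact: openT| |exact: class_C_cst].
    by apply: class_C_atan; [exact: openT|exact: s3].
- move=> s0 k; have oD : open xleaf_dom by exact: open_rect.
  rewrite /xleaf/=.
  apply: class_C_Psi => //.
  + by move=> t [/= + _]; rewrite ltr_norml => /andP[? ?]; apply/andP; split; lra.
  + exact: class_C_cst.
  + exact: class_C_fst.
  + apply: class_CD => //; first exact: class_C_snd.
    by apply: class_CM => //; [exact: class_C_fst|exact: class_C_cst].
- move=> u Bu; have [_ ->] := has_diff_xleaf Bu; apply/HS3E; split.
    rewrite -[_ *: _]addr0 -(scale0r (Psi_x (xleaf u))); apply: TS3_lin; last exact: TS3_Psi_x.
    rewrite -[Psi_x _]scale1r; apply: TS3_lin; [exact: TS3_Psi_x|exact: TS3_Psi_t].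
  have y1 : -1 <= u.1.1 <= 1.
    by case: Bu => -[/= + _] _; rewrite ltr_norml => /andP[? ?]; apply/andP; split; lra.
  rewrite omegaZr omegaDr omegaZr omega_Psi_x// omega_Psi_t; last exact: Psi_S3.
  by rewrite mulr1 mulNr addNr mulr0.
- exact: tangent_curve.
Qed.

Lemma yleaf_ACL (f : R4 -> R4) : ACL f ->
  (@lebesgue_measure R \x @lebesgue_measure R)%E.-negligible
    (yleaf_dom `&` [set d | ~ forall a b, abs_continuous a b (fun s => f (yleaf (d, s)))]).
Proof.
apply: (chart_ACL yleaf_chart).
- move=> u1 u2 u3 s1 s2 s3 Du k; rewrite /yleaf/=; apply: class_C_Psi => //; first exact: openT.
  + by apply: class_CD; [exact: openT|exact: class_C_cst|exact: s1].
  + apply: class_CM; [exact: openT| |exact: class_C_cst].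
    by apply: class_C_atan; [exact: openT|exact: s3].
- move=> s0 k; have oD : open yleaf_dom by exact: open_rect.
  rewrite /yleaf/=.
  apply: class_C_Psi => //.
  + by apply: class_CD => //; [exact: class_C_cst|exact: class_C_fst].
  + exact: class_C_cst.
  + exact: class_C_snd.
- move=> u Bu; have [_ ->] := has_diff_yleaf Bu; apply/HS3E; split.
    rewrite -[_ *: _]addr0 -(scale0r (Psi_x (yleaf u))); apply: TS3_lin; last exact: TS3_Psi_x.
    by apply: TS3_Psi_y; exact: atan2_bounds.
  by rewrite omegaZr omega_Psi_y mulr0.
- exact: tangent_curve.
Qed.

End HopfCharts.

(** * Dilatations *)

Section Horizontal.
Local Open Scope complex_scope.
Local Open Scope ring_scope.
Context {R : realType}.
Local Notation R4 := 'rV[R]_4.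
Local Notation toC := (map_mx (real_complex R)).
Implicit Types (q p X Y U V : R4) (J g : 'M[R]_4).

(* N1 q and N2 q form an orthonormal basis of H_q S^3. *)
Definition N1 q : R4 := \row_k [:: q 0 2; - q 0 3; - q 0 0; q 0 1]`_k.
Definition N2 q : R4 := \row_k [:: q 0 3; q 0 2; - q 0 1; - q 0 0]`_k.

Definition dot X Y : R := X 0 0 * Y 0 0 + X 0 1 * Y 0 1 + X 0 2 * Y 0 2 + X 0 3 * Y 0 3.

Lemma HS3_N1 q : HS3 q (N1 q).
Proof. by apply/HS3E; split; [apply/TS3E|]; rewrite /omega !mxE/=; ring. Qed.

Lemma HS3_N2 q : HS3 q (N2 q).
Proof. by apply/HS3E; split; [apply/TS3E|]; rewrite /omega !mxE/=; ring. Qed.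

Lemma HS3_lin q X Y (a b : R) : HS3 q X -> HS3 q Y -> HS3 q (a *: X + b *: Y).
Proof.
move=> /HS3E[h1 h2] /HS3E[h3 h4]; apply/HS3E; split; first exact: TS3_lin.
by rewrite omegaDr !omegaZr h2 h4 !mulr0 addr0.
Qed.

Lemma HS3Z q X (a : R) : HS3 q X -> HS3 q (a *: X).
Proof. by move=> h; rewrite -[_ *: _]addr0 -(scale0r X); exact: HS3_lin. Qed.

Lemma HS3_coord q X : S3 q -> HS3 q X -> X = dot X (N1 q) *: N1 q + dot X (N2 q) *: N2 q.
Proof.
move=> /S3E Sq /HS3E[/TS3E h1]; rewrite /omega => h2.
apply: row4P; rewrite /dot !mxE/=.
- transitivity (X 0 0 * (q 0 0 ^+ 2 + q 0 1 ^+ 2 + q 0 2 ^+ 2 + q 0 3 ^+ 2)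
    - q 0 0 * (q 0 0 * X 0 0 + q 0 1 * X 0 1 + q 0 2 * X 0 2 + q 0 3 * X 0 3)
    + q 0 1 * (q 0 0 * X 0 1 - q 0 1 * X 0 0 + q 0 2 * X 0 3 - q 0 3 * X 0 2)).
    by rewrite Sq h1 h2; ring.
  by ring.
- transitivity (X 0 1 * (q 0 0 ^+ 2 + q 0 1 ^+ 2 + q 0 2 ^+ 2 + q 0 3 ^+ 2)
    - q 0 1 * (q 0 0 * X 0 0 + q 0 1 * X 0 1 + q 0 2 * X 0 2 + q 0 3 * X 0 3)
    - q 0 0 * (q 0 0 * X 0 1 - q 0 1 * X 0 0 + q 0 2 * X 0 3 - q 0 3 * X 0 2)).
    by rewrite Sq h1 h2; ring.
  by ring.
- transitivity (X 0 2 * (q 0 0 ^+ 2 + q 0 1 ^+ 2 + q 0 2 ^+ 2 + q 0 3 ^+ 2)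
    - q 0 2 * (q 0 0 * X 0 0 + q 0 1 * X 0 1 + q 0 2 * X 0 2 + q 0 3 * X 0 3)
    + q 0 3 * (q 0 0 * X 0 1 - q 0 1 * X 0 0 + q 0 2 * X 0 3 - q 0 3 * X 0 2)).
    by rewrite Sq h1 h2; ring.
  by ring.
- transitivity (X 0 3 * (q 0 0 ^+ 2 + q 0 1 ^+ 2 + q 0 2 ^+ 2 + q 0 3 ^+ 2)
    - q 0 3 * (q 0 0 * X 0 0 + q 0 1 * X 0 1 + q 0 2 * X 0 2 + q 0 3 * X 0 3)
    - q 0 2 * (q 0 0 * X 0 1 - q 0 1 * X 0 0 + q 0 2 * X 0 3 - q 0 3 * X 0 2)).
    by rewrite Sq h1 h2; ring.
  by ring.
Qed.

Lemma dot_N q (a b c d : R) : S3 q ->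
  dot (a *: N1 q + b *: N2 q) (c *: N1 q + d *: N2 q) = a * c + b * d.
Proof.
move=> /S3E Sq; rewrite -[RHS]mulr1 -[X in _ = _ * X]Sq /dot !mxE/=; ring.
Qed.

Lemma omega_N q (a b c d : R) : S3 q ->
  omega (a *: N1 q + b *: N2 q) (c *: N1 q + d *: N2 q) = a * d - b * c.
Proof.
move=> /S3E Sq; rewrite -[RHS]mulr1 -[X in _ = _ * X]Sq /omega !mxE/=; ring.
Qed.

Lemma nsq_dot X : nsq X = dot X X.
Proof. by rewrite /nsq /dot !expr2. Qed.

Lemma omega_dot_HS3 q X Y : S3 q -> HS3 q X -> HS3 q Y ->
  nsq X * nsq Y = omega X Y ^+ 2 + dot X Y ^+ 2.
Proof.
move=> Sq hX hY; rewrite (HS3_coord Sq hX) (HS3_coord Sq hY).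
move: (dot X _) (dot X _) (dot Y _) (dot Y _) => a b c d.
by rewrite !nsq_dot !dot_N// omega_N//; ring.
Qed.

Lemma dot_lin X Y Z (a b : R) : dot Z (a *: X + b *: Y) = a * dot Z X + b * dot Z Y.
Proof. by rewrite /dot !mxE; ring. Qed.

(* If v is such that A v is orthogonal to A u, then |A u| |A v| is at most the
   determinant while |A u| <= K |A v|. *)
Lemma dilatation_det q X Y (K : R) : S3 q -> HS3 q X -> HS3 q Y -> 0 <= K ->
  (forall a b c d : R, a ^+ 2 + b ^+ 2 = 1 -> c ^+ 2 + d ^+ 2 = 1 ->
     nsq (a *: X + b *: Y) <= K ^+ 2 * nsq (c *: X + d *: Y)) ->
  nsq X <= K * `|omega X Y|.
Proof.
move=> Sq hX hY K0 H.
have X0 := nsq_ge0 X.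
have [X00|X00] := eqVneq (nsq X) 0; first by rewrite X00 mulr_ge0.
have X1 : 0 < nsq X by rewrite lt_neqAle eq_sym X00.
pose n := Num.sqrt (nsq X ^+ 2 + dot X Y ^+ 2).
have nn : n ^+ 2 = nsq X ^+ 2 + dot X Y ^+ 2 by rewrite sqr_sqrtr// addr_ge0 ?sqr_ge0.
have n0 : 0 < n by rewrite sqrtr_gt0 ltr_wpDr ?sqr_ge0// exprn_gt0.
pose c := - dot X Y / n; pose d := nsq X / n.
have cd : c ^+ 2 + d ^+ 2 = 1.
  rewrite /c /d !exprMn sqrrN -mulrDl addrC exprVn nn mulfV//.
  by rewrite -nn expf_neq0// gt_eqF.
pose Z := c *: X + d *: Y.
have hZ : HS3 q Z by exact: HS3_lin.
have dXZ : dot X Z = 0.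
  by rewrite dot_lin -nsq_dot /c /d; field; rewrite gt_eqF.
have oXZ : omega X Z = d * omega X Y.
  by rewrite omegaDr !omegaZr omegaXX mulr0 add0r.
have XZ := omega_dot_HS3 Sq hX hZ.
rewrite dXZ expr0n/= addr0 oXZ exprMn in XZ.
have d1 : d ^+ 2 <= 1 by rewrite -cd lerDr sqr_ge0.
have KX : nsq X <= K ^+ 2 * nsq Z.
  by have := @H 1 0 c d; rewrite scale1r scale0r addr0; apply => //; rewrite expr1n expr0n/= addr0.
have Ko : 0 <= K * `|omega X Y| by rewrite mulr_ge0.
rewrite -(@ler_pXn2r _ 2)// ?nnegrE//.
rewrite exprMn real_normK ?num_real// expr2.
apply: (le_trans (ler_wpM2l X0 KX)).
rewrite mulrCA XZ; apply: ler_wpM2l; first exact: sqr_ge0.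
by rewrite -[leRHS]mul1r ler_wpM2r// sqr_ge0.
Qed.

(** Real and imaginary parts of the eigenvalue equation: the right-hand side is V - i U. *)
Lemma toC_eq U V J : (toC U + 'i *: toC V) *m toC J = - 'i *: (toC U + 'i *: toC V) ->
  U *m J = V /\ V *m J = - U.
Proof.
move=> E.
have E' : toC (U *m J) + 'i *: toC (V *m J) = toC V - 'i *: toC U.
  rewrite map_mxM map_mxM scalemxAl -mulmxDl E scalerDr scalerA mulNr -expr2 sqrCi opprK.
  by rewrite scale1r scaleNr addrC.
have H j : (U *m J) 0 j = V 0 j /\ (V *m J) 0 j = - U 0 j.
  move/rowP/(_ j): E'; rewrite !mxE -!complexiE => /eqP.
  rewrite eq_complex/= => /andP[/eqP h1 /eqP h2]; by split; lra.
by split; apply/rowP => j; have [h1 h2] := H j; rewrite ?h1 ?h2 ?mxE.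
Qed.

End Horizontal.

(** * The (0,1) vectors in the real frame [N1], [N2] *)

Section ComplexIdentities.
Variables (C : numClosedFieldType).

Lemma W0_generic (a b : C) :
  a *: (2^-1 *: (delta_mx 0 0 - 'i *: delta_mx 0 1)) - b *: (2^-1 *: (delta_mx 0 2 - 'i *: delta_mx 0 3))
  = 2^-1 *: (\row_k [:: a; - ('i * a); - b; 'i * b]`_k) :> 'rV[C]_4.
Proof.
apply/rowP => j; rewrite !mxE.
by case: j => -[|[|[|[|//]]]] i /=; ring.
Qed.

(** [ring] treats ['i] as a variable, so each use supplies the multiple [z] of ['i * 'i + 1] by
    which the two sides differ. *)
Lemma modulo_i2 (x y z : C) : x = y + z * ('i * 'i + 1) -> x = y.
Proof. by move=> ->; rewrite -expr2 sqrCi addNr mulr0 addr0. Qed.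

(** Let P = w1 w2 with conjugate P'. Twice the standard (0,1) vector is N1 + i N2, and
    multiplication by P' turns nu into r P. Now P' (N1 + i N2) and P (N1 - i N2) are conjugate
    vectors, so the first minus r times the second scales the real part by 1 - r and the imaginary
    part by 1 + r. *)
Lemma deformed_generic (x0 x1 x2 x3 nu r : C) (N1 N2 W0 W0b : 'rV[C]_4) :
  N1 = \row_k [:: x2; - x3; - x0; x1]`_k -> N2 = \row_k [:: x3; x2; - x1; - x0]`_k ->
  W0 = 2^-1 *: (\row_k [:: x2 - 'i * x3; - ('i * (x2 - 'i * x3)); - (x0 - 'i * x1); 'i * (x0 - 'i * x1)]`_k) ->
  W0b = 2^-1 *: (\row_k [:: x2 + 'i * x3; 'i * (x2 + 'i * x3); - (x0 + 'i * x1); - ('i * (x0 + 'i * x1))]`_k) ->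
  (x0 - 'i * x1) * (x2 - 'i * x3) * nu = r * ((x0 + 'i * x1) * (x2 + 'i * x3)) ->
  (2 * ((x0 - 'i * x1) * (x2 - 'i * x3))) *: (W0b - nu *: W0) =
    (1 - r) *: ((x0 * x2 - x1 * x3) *: N1 + (x0 * x3 + x1 * x2) *: N2) +
    'i *: ((1 + r) *: ((x0 * x2 - x1 * x3) *: N2 - (x0 * x3 + x1 * x2) *: N1)).
Proof.
move=> N1E N2E W0E W0bE nuE.
have Wm : 2 *: W0 = N1 - 'i *: N2.
  rewrite W0E scalerA mulfV ?scale1r ?pnatr_eq0// N1E N2E.
  apply/rowP => j; rewrite !mxE; case: j => -[|[|[|[|//]]]] i /=; first by [].
  - by apply: (@modulo_i2 _ _ x3); ring.
  - by ring.
  - by apply: (@modulo_i2 _ _ (- x1)); ring.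
have Wp : 2 *: W0b = N1 + 'i *: N2.
  rewrite W0bE scalerA mulfV ?scale1r ?pnatr_eq0// N1E N2E.
  apply/rowP => j; rewrite !mxE; case: j => -[|[|[|[|//]]]] i /=; first by [].
  - by apply: (@modulo_i2 _ _ x3); ring.
  - by ring.
  - by apply: (@modulo_i2 _ _ (- x1)); ring.
have pm : (x0 - 'i * x1) * (x2 - 'i * x3) = (x0 * x2 - x1 * x3) - 'i * (x0 * x3 + x1 * x2).
  by apply: (@modulo_i2 _ _ (x1 * x3)); ring.
have pp : (x0 + 'i * x1) * (x2 + 'i * x3) = (x0 * x2 - x1 * x3) + 'i * (x0 * x3 + x1 * x2).
  by apply: (@modulo_i2 _ _ (x1 * x3)); ring.
rewrite pp in nuE.
have E : (2 * ((x0 - 'i * x1) * (x2 - 'i * x3))) *: (W0b - nu *: W0) =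
  ((x0 - 'i * x1) * (x2 - 'i * x3)) *: (N1 + 'i *: N2) -
  (r * ((x0 * x2 - x1 * x3) + 'i * (x0 * x3 + x1 * x2))) *: (N1 - 'i *: N2).
  rewrite -nuE -Wm -Wp; apply/rowP => j; rewrite !mxE; ring.
rewrite E pm; move: (_ - x1 * x3) (_ + x1 * x2) => a b.
apply/rowP => j; rewrite !mxE; move: (N1 0 j) (N2 0 j) => u v.
by apply: (@modulo_i2 _ _ (- (1 - r) * b * v)); ring.
Qed.

Lemma conj_row_generic (a b : C) (j : 'I_4) :
  (2^-1 * [:: a^*; - ('i * a^*); - b^*; 'i * b^*]`_j)^* =
  2^-1 * [:: a; 'i * a; - b; - ('i * b)]`_j.
Proof.
rewrite rmorphM fmorphV rmorph_nat.
by case: j => -[|[|[|[|//]]]] i /=; rewrite ?rmorphN ?rmorphM/= ?conjCK ?conjCi; congr (_ * _); ring.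
Qed.

End ComplexIdentities.

(** * Complex structures, Hermitian metrics and pointwise dilatation *)

Section Dilatation.
Local Open Scope complex_scope.
Local Open Scope ring_scope.
Context {R : realType}.
Local Notation R4 := 'rV[R]_4.
Local Notation toC := (map_mx (real_complex R)).
Implicit Types (q p X Y U V : R4) (J g : 'M[R]_4).

Definition prod_re q : R := q 0 0 * q 0 2 - q 0 1 * q 0 3.
Definition prod_im q : R := q 0 0 * q 0 3 + q 0 1 * q 0 2.
(* W1bar is, up to a complex factor, (1 - r) hP + i (1 + r) hiP with
   r = (lam ^ 2 - 1) / (lam ^ 2 + 1); hP is proportional to d/dy and - hiP is the
   horizontal lift of d/dx. *)
Definition hP q : R4 := prod_re q *: N1 q + prod_im q *: N2 q.
Definition hiP q : R4 := prod_re q *: N2 q - prod_im q *: N1 q.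

Let conjE (z : R[i]) : z^* = (complex.Re z)%:C - 'i * (complex.Im z)%:C.
Proof. by case: z => a b; rewrite -complexiE; apply/eqP; rewrite eq_complex/= !mul0r !mul1r; apply/andP; split; apply/eqP; ring. Qed.

Let rectE (z : R[i]) : z = (complex.Re z)%:C + 'i * (complex.Im z)%:C.
Proof. by case: z => a b; rewrite -complexiE; apply/eqP; rewrite eq_complex/= !mul0r !mul1r; apply/andP; split; apply/eqP; ring. Qed.

Lemma W0_row q : W0 q = 2^-1 *: (\row_k [:: (w2 q)^*; - ('i * (w2 q)^*); - (w1 q)^*; 'i * (w1 q)^*]`_k).
Proof. exact: W0_generic. Qed.

Lemma W0bar_row q : W0bar q = 2^-1 *: (\row_k [:: w2 q; 'i * w2 q; - w1 q; - ('i * w1 q)]`_k).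
Proof.
rewrite /W0bar W0_row; apply/rowP => j; rewrite /conj_vec.
rewrite mxE [X in X^*]mxE [X in (_ * X)^*]mxE [RHS]mxE [X in _ = _ * X]mxE.
exact: conj_row_generic.
Qed.

Lemma deformed_W1bar lam q r : nu lam q * ((w1 q)^* * (w2 q)^*) = r%:C * (w1 q * w2 q) ->
  exists z : R[i], z *: W1bar lam q = toC ((1 - r) *: hP q) + 'i *: toC ((1 + r) *: hiP q).
Proof.
move=> nuE.
have w1E : w1 q = (q 0 0)%:C + 'i * (q 0 1)%:C by exact: rectE.
have w2E : w2 q = (q 0 2)%:C + 'i * (q 0 3)%:C by exact: rectE.
have w1cE : (w1 q)^* = (q 0 0)%:C - 'i * (q 0 1)%:C by exact: conjE.
have w2cE : (w2 q)^* = (q 0 2)%:C - 'i * (q 0 3)%:C by exact: conjE.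
have := @deformed_generic R[i] (q 0 0)%:C (q 0 1)%:C (q 0 2)%:C (q 0 3)%:C (nu lam q) r%:C
  (toC (N1 q)) (toC (N2 q)) (W0 q) (W0bar q).
rewrite -w1E -w2E -w1cE -w2cE => H.
eexists; apply: etrans (H _ _ _ _ _) _.
- by apply/rowP => j; rewrite !mxE; case: j => -[|[|[|[|//]]]] i /=; rewrite ?rmorphN.
- by apply/rowP => j; rewrite !mxE; case: j => -[|[|[|[|//]]]] i /=; rewrite ?rmorphN.
- exact: W0_row.
- exact: W0bar_row.
- by rewrite mulrC.
- congr (_ + 'i *: _).
    by rewrite /hP /prod_re /prod_im map_mxZ map_mxD !map_mxZ !rmorphB rmorphD !rmorphM rmorph1.
  by rewrite /hiP /prod_re /prod_im map_mxZ map_mxB !map_mxZ rmorphB !rmorphD !rmorphM rmorph1.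
Qed.

Lemma W0bar_toC q : exists z : R[i], z *: W0bar q = toC (N1 q) + 'i *: toC (N2 q).
Proof.
exists 2; rewrite W0bar_row scalerA mulfV ?pnatr_eq0// scale1r.
have w1E : w1 q = (q 0 0)%:C + 'i * (q 0 1)%:C by exact: rectE.
have w2E : w2 q = (q 0 2)%:C + 'i * (q 0 3)%:C by exact: rectE.
apply/rowP => j; rewrite !mxE; case: j => -[|[|[|[|//]]]] i /=; rewrite ?rmorphN ?w1E ?w2E//.
- by apply: (@modulo_i2 _ _ _ (q 0 3)%:C); ring.
- by ring.
- by apply: (@modulo_i2 _ _ _ (- (q 0 1)%:C)); ring.
Qed.

Lemma complex_structure_eigen Wbar (J : R4 -> 'M[R]_4) q U V (z : R[i]) :
  complex_structure Wbar J -> S3 q -> z *: Wbar q = toC U + 'i *: toC V ->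
  U *m J q = V /\ V *m J q = - U.
Proof.
move=> cJ Sq zE; have [_ _ E] := cJ q Sq.
apply: toC_eq; rewrite -zE -scalemxAl.
rewrite [X in z *: X]E; by rewrite !scalerA mulrC.
Qed.

Lemma form_lin (g : R4 -> 'M[R]_4) q X Y (a b : R) : Defs.form g q X Y = Defs.form g q Y X ->
  Defs.form g q (a *: X + b *: Y) (a *: X + b *: Y) =
  a ^+ 2 * Defs.form g q X X + 2 * a * b * Defs.form g q X Y + b ^+ 2 * Defs.form g q Y Y.
Proof.
rewrite /Defs.form => sym.
have tE : (a *: X + b *: Y)^T = a *: X^T + b *: Y^T by rewrite linearD !linearZ.
rewrite tE !mulmxDl !mulmxDr -!scalemxAl -!scalemxAr.
have E (A B C D : 'M[R]_1) : (a *: (a *: A) + a *: (b *: B) + (b *: (a *: C) + b *: (b *: D))) 0 0 =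
    a * (a * A 0 0) + a * (b * B 0 0) + (b * (a * C 0 0) + b * (b * D 0 0)).
  by rewrite !mxE.
by rewrite E -sym; ring.
Qed.

(** Invariance under J gives X and Y = J X the same length, and J Y = - X gives
    [form g q X Y = - form g q X Y]. So on a contact plane the metric is determined up to scale by
    the complex structure, and dilatations do not depend on its choice. *)
Lemma hermitian_isotropic (J g : R4 -> 'M[R]_4) q X Y : hermitian_metric J g -> S3 q ->
  HS3 q X -> HS3 q Y -> X *m J q = Y -> Y *m J q = - X -> X != 0 ->
  exists2 c, 0 < c & forall a b, Defs.form g q (a *: X + b *: Y) (a *: X + b *: Y) = c * (a ^+ 2 + b ^+ 2).
Proof.
move=> [_ H] Sq hX hY XJ YJ X0; have [sym pos inv] := H q Sq.
have E1 := inv X X hX hX; rewrite XJ in E1.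
have E2 := inv X Y hX hY; rewrite XJ YJ in E2.
have E3 : Defs.form g q Y (- X) = - Defs.form g q X Y.
  by rewrite [in RHS]sym// /Defs.form linearN/= mulmxN mxE.
rewrite E3 in E2.
exists (Defs.form g q X X); first exact: pos.
have E4 : Defs.form g q X Y = 0 by clear -E2; lra.
by move=> a b; rewrite form_lin; [rewrite E1 E4; ring|exact: sym].
Qed.

Lemma hP_N q : hP q = prod_re q *: N1 q + prod_im q *: N2 q. Proof. by []. Qed.

Lemma hiP_N q : hiP q = (- prod_im q) *: N1 q + prod_re q *: N2 q.
Proof. by rewrite /hiP addrC scaleNr. Qed.

Lemma HS3_hP q : HS3 q (hP q).
Proof. by apply: HS3_lin; [exact: HS3_N1|exact: HS3_N2]. Qed.

Lemma HS3_hiP q : HS3 q (hiP q).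
Proof. by rewrite hiP_N; apply: HS3_lin; [exact: HS3_N1|exact: HS3_N2]. Qed.

(** The modulus r of [nu] where w1 w2 is nonzero; it satisfies (1 + r) / (1 - r) = lam^2. *)
Definition lamr (lam : 'rV[R]_3 -> R) q : R :=
  let l := lam (stereo (hopf q)) in (l ^+ 2 - 1) / (l ^+ 2 + 1).

Lemma nu_prod lam q : nu lam q * ((w1 q)^* * (w2 q)^*) = (lamr lam q)%:C * (w1 q * w2 q).
Proof.
rewrite /nu -/(lamr lam q); case: ifPn => [/eqP ->|]; first by rewrite mul0r mulr0.
rewrite mulf_eq0 negb_or => /andP[h1 h2].
by rewrite -mulrA divfK// mulf_neq0// conjC_eq0.
Qed.

Lemma stereo_S2 z : S2 (stereo z : 'rV[R]_3).
Proof.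
rewrite /S2 /sphere/= !big_ord_recl big_ord0 addr0 /stereo; case: z => [[x y]|]; rewrite !mxE/=; last by ring.
have p0 : 1 + x ^+ 2 + y ^+ 2 != 0.
  by rewrite gt_eqF// -addrA ltr_wpDr// addr_ge0 ?sqr_ge0.
by field.
Qed.

Lemma dilatation_le (g1 g0 : R4 -> 'M[R]_4) f q (m M K : R) : 0 < m -> M <= K * m ->
  (exists2 X, HS3 q X & hnorm g1 q X = 1) ->
  (forall X, HS3 q X -> hnorm g1 q X = 1 -> m <= hnorm g0 (f q) (push f q X) <= M) ->
  (dilatation g1 g0 f q <= K%:E)%E.
Proof.
move=> m0 MK [X0 hX0 X01] H; rewrite /dilatation.
set N := [set _ | _ in _].
have infm : (m%:E <= ereal_inf N)%E.
  by apply: le_ereal_inf_tmp => _ [X [hX X1] <-]; rewrite lee_fin; have /andP[] := H X hX X1.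
have supM : (ereal_sup N <= M%:E)%E.
  by apply: ge_ereal_sup => _ [X [hX X1] <-]; rewrite lee_fin; have /andP[] := H X hX X1.
have inN : N (hnorm g0 (f q) (push f q X0))%:E by exists X0.
have := ereal_inf_lbound inN; move: infm; case: (ereal_inf N) => [i| |] //=.
rewrite !lee_fin => mi _; have i0 : 0 < i by exact: lt_le_trans mi.
rewrite eqe gt_eqF// inver gt_eqF//.
apply: (@le_trans _ _ (M%:E * (i^-1)%:E)%E).
  by rewrite lee_wpmul2r// lee_fin invr_ge0 ltW.
rewrite -EFinM lee_fin ler_pdivrMr//; apply: (le_trans MK).
apply: ler_wpM2l => //.
have mM : m <= M by have /andP[h1 h2] := H _ hX0 X01; exact: le_trans h2.
by have := lt_le_trans m0 (le_trans mM MK); rewrite pmulr_lgt0// => /ltW.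
Qed.

Lemma dilatation_ge (g1 g0 : R4 -> 'M[R]_4) f q (K : R) X Y :
  (dilatation g1 g0 f q <= K%:E)%E ->
  HS3 q X -> hnorm g1 q X = 1 -> HS3 q Y -> hnorm g1 q Y = 1 ->
  hnorm g0 (f q) (push f q X) <= K * hnorm g0 (f q) (push f q Y).
Proof.
rewrite /dilatation; set N := [set _ | _ in _] => H hX X1 hY Y1.
have NX : N (hnorm g0 (f q) (push f q X))%:E by exists X.
have NY : N (hnorm g0 (f q) (push f q Y))%:E by exists Y.
have inf0 : (0 <= ereal_inf N)%E.
  by apply: le_ereal_inf_tmp => _ [Z _ <-]; rewrite lee_fin sqrtr_ge0.
have := ereal_inf_lbound NY; have := ereal_sup_ubound NX.
move: H inf0; case: (ereal_inf N) => [i| |] //=.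
(* A zero infimum is excluded here: the dilatation would be [+oo], above the finite [K]. *)
rewrite eqe lee_fin; case: eqVneq => // i0 + i0' supX infY.
rewrite lee_fin in infY; have ip : 0 < i by rewrite lt_neqAle eq_sym i0.
rewrite inver (negPf i0) => H.
have : ((hnorm g0 (f q) (push f q X))%:E * (i^-1)%:E <= K%:E)%E.
  by apply: le_trans H; rewrite lee_wpmul2r// lee_fin invr_ge0.
rewrite -EFinM lee_fin ler_pdivrMr// => HK; apply: (le_trans HK).
apply: ler_wpM2l => //.
have : 0 <= K * i by apply: le_trans HK; rewrite sqrtr_ge0.
by rewrite pmulr_lge0.
Qed.

Section Metrics.
Variables (lam : 'rV[R]_3 -> R) (Lam : R).
Variables (J0 J1 g0 g1 : R4 -> 'M[R]_4).
Hypothesis lam_bounds : forall x, S2 x -> 1 <= lam x <= Lam.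
Hypothesis J0_cr : complex_structure W0bar J0.
Hypothesis J1_cr : complex_structure (W1bar lam) J1.
Hypothesis g0_hermitian : hermitian_metric J0 g0.
Hypothesis g1_hermitian : hermitian_metric J1 g1.

Let N1_neq0 q : S3 q -> N1 q != 0.
Proof.
move=> Sq; rewrite -nsq_eq0 nsq_dot; have := dot_N 1 0 1 0 Sq.
by rewrite scale1r scale0r addr0 mulr1 mulr0 addr0 => ->; rewrite oner_eq0.
Qed.

Lemma hnorm_g0 q : S3 q -> exists2 c, 0 < c & forall X, HS3 q X -> hnorm g0 q X = Num.sqrt (c * nsq X).
Proof.
move=> Sq; have [z zE] := W0bar_toC q.
have [h1 h2] := complex_structure_eigen J0_cr Sq zE.
have [c c0 H] := hermitian_isotropic g0_hermitian Sq (HS3_N1 q) (HS3_N2 q) h1 h2 (N1_neq0 Sq).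
exists c => // X hX; rewrite /hnorm (HS3_coord Sq hX) H nsq_dot dot_N//.
Qed.

Let lamr_bounds q : 0 <= lamr lam q < 1 /\ 1 + lamr lam q <= Lam ^+ 2 * (1 - lamr lam q).
Proof.
have := lam_bounds (stereo_S2 (hopf q)); rewrite /lamr; move: (lam _) => l /andP[l1 l2].
have l21 : 1 <= l ^+ 2 by rewrite expr_ge1//; lra.
have l2L : l ^+ 2 <= Lam ^+ 2 by rewrite ler_pXn2r// nnegrE; lra.
have p0 : 0 < l ^+ 2 + 1 by lra.
rewrite divr_ge0//= ?ltr_pdivrMr//; [|lra|lra].
split; first lra.
have -> : 1 + (l ^+ 2 - 1) / (l ^+ 2 + 1) = 2 * l ^+ 2 / (l ^+ 2 + 1) by field; rewrite gt_eqF.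
have -> : 1 - (l ^+ 2 - 1) / (l ^+ 2 + 1) = 2 / (l ^+ 2 + 1) by field; rewrite gt_eqF.
have -> : Lam ^+ 2 * (2 / (l ^+ 2 + 1)) = 2 * Lam ^+ 2 / (l ^+ 2 + 1) by ring.
by rewrite ler_pM2r ?invr_gt0//; lra.
Qed.

(* The normalized directions of greatest and least stretching of the identity. *)
Lemma adapted_basis q : S3 q -> exists X Y (n s t : R),
  [/\ [/\ 0 < n, 0 < s, s <= t & t <= Lam ^+ 2 * s],
      HS3 q X /\ HS3 q Y,
      exists2 c, 0 < c & forall a b, Defs.form g1 q (a *: X + b *: Y) (a *: X + b *: Y) = c * (a ^+ 2 + b ^+ 2) &
      exists al be, [/\ al ^+ 2 + be ^+ 2 = n, X = s *: (al *: N1 q + be *: N2 q) &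
        Y = t *: ((- be) *: N1 q + al *: N2 q)]] /\
  (w1 q * w2 q != 0 -> X = (1 - lamr lam q) *: hP q /\ Y = (1 + lamr lam q) *: hiP q).
Proof.
move=> Sq; have [/andP[r0 r1] rL] := lamr_bounds q.
have Lam1 : 1 <= Lam by have /andP[? ?] := lam_bounds (stereo_S2 (hopf q)); lra.
have [p0|p0] := eqVneq (w1 q * w2 q) 0.
  (* Where w1 w2 = 0, [nu] vanishes and the two (0,1) vectors agree, so the standard frame is
     adapted with equal stretchings. *)
  exists (N1 q), (N2 q), 1, 1, 1; split; last by [].
  split.
  - by split => //; rewrite mulr1 exprn_ege1.
  - by split; [exact: HS3_N1|exact: HS3_N2].
  - have [z zE] := W0bar_toC q.
    have W1E : W1bar lam q = W0bar q by rewrite /W1bar /nu p0 eqxx scale0r subr0.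
    rewrite -W1E in zE; have [h1 h2] := complex_structure_eigen J1_cr Sq zE.
    exact: (hermitian_isotropic g1_hermitian Sq (HS3_N1 q) (HS3_N2 q) h1 h2 (N1_neq0 Sq)).
  - by exists 1, 0; rewrite expr1n expr0n/= addr0 oppr0 !scale0r !scale1r addr0 add0r.
have [z zE] := deformed_W1bar (nu_prod lam q).
have [h1 h2] := complex_structure_eigen J1_cr Sq zE.
have n0 : 0 < prod_re q ^+ 2 + prod_im q ^+ 2.
  rewrite lt_neqAle eq_sym addr_ge0 ?sqr_ge0// andbT paddr_eq0 ?sqr_ge0// !sqrf_eq0.
  apply: contra p0 => /andP[/eqP a0 /eqP b0].
  by rewrite eq_complex/=; move: a0 b0; rewrite /prod_re /prod_im => -> ->; rewrite !eqxx.
have hX := HS3Z (1 - lamr lam q) (HS3_hP q); have hY := HS3Z (1 + lamr lam q) (HS3_hiP q).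
exists ((1 - lamr lam q) *: hP q), ((1 + lamr lam q) *: hiP q), (prod_re q ^+ 2 + prod_im q ^+ 2), (1 - lamr lam q), (1 + lamr lam q).
split; last by [].
split => //.
- by split => //; lra.
- apply: (hermitian_isotropic g1_hermitian Sq hX hY h1 h2).
  rewrite scaler_eq0 negb_or subr_eq0 eq_sym lt_eqF//=.
  by rewrite -nsq_eq0 nsq_dot hP_N dot_N// -!expr2 gt_eqF.
- by exists (prod_re q), (prod_im q); split => //; rewrite hiP_N.
Qed.

Lemma dilatation_id q : S3 q -> (dilatation g1 g0 id q <= (Lam ^+ 2)%:E)%E.
Proof.
move=> Sq; have [X [Y [n [s [t [[[n0 s0 st tL] [hX hY] [c c0 Hc] [al [be [abn XE YE]]]] _]]]]]] := adapted_basis Sq.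
have [d d0 Hd] := hnorm_g0 Sq.
have Lam0 : 0 <= Lam by have /andP[? ?] := lam_bounds (stereo_S2 (hopf q)); lra.
have L0 : 0 <= Lam ^+ 2 by exact: sqr_ge0.
have n0' := ltW n0; have s0' := ltW s0; have d0' := ltW d0; have c0' : 0 <= c^-1 by rewrite invr_ge0 ltW.
(* The [g0]-length of a [g1]-unit vector along [X], the direction of least stretching. *)
pose m := Num.sqrt (d * (n * s ^+ 2 / c)).
have t0 : 0 < t by exact: lt_le_trans st.
have ns : 0 < d * (n * s ^+ 2 / c) by rewrite mulr_gt0// divr_gt0// mulr_gt0// exprn_gt0.
apply: (@dilatation_le _ _ _ _ m (Lam ^+ 2 * m)) => //.
- by rewrite sqrtr_gt0.
- exists (Num.sqrt c^-1 *: X); first exact: HS3Z.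
  rewrite /hnorm -[_ *: X]addr0 -(scale0r Y) Hc expr0n/= addr0 sqr_sqrtr ?invr_ge0 ?ltW//.
  by rewrite mulfV ?gt_eqF// sqrtr1.
move=> Z hZ Z1.
have pZ : push id q Z = Z.
  have /HS3E[TZ _] := hZ; have [_ h] := has_diff_retr_tangent Sq TZ.
  exact: h.
rewrite pZ Hd// /m.
pose A := dot Z (N1 q); pose B := dot Z (N2 q).
pose a := (A * al + B * be) / (n * s); pose b := (B * al - A * be) / (n * t).
have ZE : Z = a *: X + b *: Y.
  rewrite XE YE [LHS](HS3_coord Sq hZ) -/A -/B !scalerDr !scalerA addrACA -!scalerDl.
  congr (_ *: _ + _ *: _); rewrite /a /b -abn; field; rewrite abn !gt_eqF//.
have ab : a ^+ 2 + b ^+ 2 = c^-1.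
  move: Z1; rewrite /hnorm ZE Hc => h.
  have := congr1 (fun x => x ^+ 2) h; rewrite /= sqr_sqrtr ?expr1n; last first.
    by rewrite mulr_ge0 ?addr_ge0 ?sqr_ge0// ltW.
  by move=> h2; rewrite -[LHS](mulKf (lt0r_neq0 c0)) h2 mulr1.
have nZ : nsq Z = n * (a ^+ 2 * s ^+ 2 + b ^+ 2 * t ^+ 2).
  rewrite ZE XE YE !scalerDr !scalerA addrACA -!scalerDl nsq_dot dot_N// -abn; ring.
have a2 := sqr_ge0 a; have b2 := sqr_ge0 b.
have st2 : s ^+ 2 <= t ^+ 2 by rewrite ler_pXn2r// nnegrE ltW.
have tL2 : t ^+ 2 <= (Lam ^+ 2) ^+ 2 * s ^+ 2.
  by rewrite -exprMn ler_pXn2r// nnegrE ltW//; exact: lt_le_trans tL.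
rewrite -[X in _ <= X * _]ger0_norm// -sqrtr_sqr -sqrtrM ?sqr_ge0//.
rewrite !ler_psqrt ?nnegrE ?mulr_ge0 ?sqr_ge0 ?(ltW ns) ?nsq_ge0 ?(ltW d0)//.
rewrite nZ -ab; apply/andP; split.
  apply: ler_wpM2l; first exact: ltW.
  rewrite -mulrA; apply: ler_wpM2l; first exact: ltW.
  have h := ler_wpM2l b2 st2; rewrite mulrDr (mulrC _ (a ^+ 2)) (mulrC _ (b ^+ 2)).
  by rewrite lerD2l.
rewrite [leRHS]mulrCA; apply: ler_wpM2l; first exact: ltW.
rewrite -(mulrA n (s ^+ 2)) [leRHS]mulrCA; apply: ler_wpM2l; first exact: ltW.
rewrite [leRHS]mulrA mulrDr.
apply: lerD; rewrite mulrC; apply: ler_wpM2r => //.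
exact: le_trans st2 tL2.
Qed.

(** The vectors (1 + r) hiP and (1 - r) hP are [g1]-orthogonal and of equal length, so after one
    common scaling their combinations with coefficients on the Euclidean unit circle are [g1]-unit
    vectors, to which the dilatation bound applies. *)
Lemma push_unit_le f q (K : R) : S3 q -> S3 (f q) -> w1 q * w2 q != 0 -> 0 <= K ->
  (forall X, HS3 q X -> HS3 (f q) (push f q X)) ->
  (dilatation g1 g0 f q <= K%:E)%E ->
  forall a b c d : R, a ^+ 2 + b ^+ 2 = 1 -> c ^+ 2 + d ^+ 2 = 1 ->
    let X := push f q ((1 + lamr lam q) *: hiP q) in
    let Y := push f q ((1 - lamr lam q) *: hP q) in
    nsq (a *: X + b *: Y) <= K ^+ 2 * nsq (c *: X + d *: Y).
Proof.
move=> Sq Sf p0 K0 HH dil a0 b0 u v ab uv /=.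
have [X [Y [n [s [t [[_ [hX hY] [c c0 Hc] _] XY]]]]]] := adapted_basis Sq.
have [<- <-] := XY p0.
have [d d0 Hd] := hnorm_g0 Sf.
have pl (a b : R) : push f q (a *: Y + b *: X) = a *: push f q Y + b *: push f q X.
  by rewrite /push linearD !linearZ.
rewrite -!pl.
pose k := Num.sqrt c^-1.
have k2 : k ^+ 2 = c^-1 by rewrite sqr_sqrtr// invr_ge0 ltW.
have k0 : 0 < k by rewrite sqrtr_gt0 invr_gt0.
have k0' := ltW k0.
have unit (a' b' : R) : a' ^+ 2 + b' ^+ 2 = 1 -> hnorm g1 q (k *: (a' *: Y + b' *: X)) = 1.
  move=> ab'; rewrite /hnorm addrC scalerDr !scalerA Hc !exprMn -mulrDr [_ + a' ^+ 2]addrC ab' mulr1 k2.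
  by rewrite mulfV ?gt_eqF// sqrtr1.
have hz (a' b' : R) : HS3 q (a' *: Y + b' *: X) by exact: HS3_lin.
have := dilatation_ge dil (HS3Z k (hz a0 b0)) (unit _ _ ab) (HS3Z k (hz u v)) (unit _ _ uv).
rewrite (Hd _ (HH _ (HS3Z k (hz a0 b0)))) (Hd _ (HH _ (HS3Z k (hz u v)))).
have pk Z : push f q (k *: Z) = k *: push f q Z by rewrite /push linearZ.
rewrite !pk !nsqZ -[X in _ <= X * _]ger0_norm// -sqrtr_sqr -sqrtrM ?sqr_ge0//.
rewrite ler_psqrt ?nnegrE ?mulr_ge0 ?sqr_ge0 ?nsq_ge0 ?(ltW d0)//.
move=> h; rewrite -(ler_pM2l d0) -(ler_pM2l (exprn_gt0 2 k0)).
by move: h; congr (_ <= _); ring.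
Qed.

(** [dilatation_det] gives (1 + r)^2 |f_* hiP|^2 <= K (1 + r) (1 - r) |omega|; dividing by (1 + r)
    (1 - r) leaves the factor lam^2 on the left. *)
Lemma push_dilatation f q (K : R) : S3 q -> S3 (f q) -> w1 q * w2 q != 0 -> 0 <= K ->
  (forall X, HS3 q X -> HS3 (f q) (push f q X)) ->
  (dilatation g1 g0 f q <= K%:E)%E ->
  (lam (stereo (hopf q))) ^+ 2 * nsq (push f q (hiP q)) <= K * `|omega (push f q (hiP q)) (push f q (hP q))|.
Proof.
move=> Sq Sf p0 K0 HH dil.
have hX := HH _ (HS3Z (1 - lamr lam q) (HS3_hP q)).
have hY := HH _ (HS3Z (1 + lamr lam q) (HS3_hiP q)).
have := dilatation_det Sf hY hX K0 (push_unit_le Sq Sf p0 K0 HH dil).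
have pk k Z : push f q (k *: Z) = k *: push f q Z by rewrite /push linearZ.
rewrite !pk nsqZ omegaZr.
have -> : omega ((1 + lamr lam q) *: push f q (hiP q)) (push f q (hP q)) = (1 + lamr lam q) * omega (push f q (hiP q)) (push f q (hP q)).
  by rewrite omegaZl.
have [/andP[r0 r1] _] := lamr_bounds q.
have r1' : 0 < 1 + lamr lam q by lra.
have r2' : 0 < 1 - lamr lam q by lra.
rewrite !normrM (gtr0_norm r1') (gtr0_norm r2').
move: (`|_|) (nsq _) => O N; rewrite /lamr.
move: (lam_bounds (stereo_S2 (hopf q))); move: (lam _) => l /andP[l1 _].
have p : 0 < l ^+ 2 + 1 by rewrite ltr_wpDl ?sqr_ge0.
have -> : 1 + (l ^+ 2 - 1) / (l ^+ 2 + 1) = 2 / (l ^+ 2 + 1) * l ^+ 2 by field; rewrite gt_eqF.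
have -> : 1 - (l ^+ 2 - 1) / (l ^+ 2 + 1) = 2 / (l ^+ 2 + 1) by field; rewrite gt_eqF.
have : 0 < 2 / (l ^+ 2 + 1) by rewrite divr_gt0.
move: (2 / _) => k k0 h.
have k1 : 0 < k ^+ 2 * l ^+ 2 by rewrite mulr_gt0// exprn_gt0//; lra.
rewrite -(ler_pM2l k1); move: h; congr (_ <= _); ring.
Qed.

(** The differential is uniformly nondegenerate on the contact plane. In the constant, 8 is 4 from
    (1 + r)^2, (1 - r)^2 <= 4 times 2 for the two vectors, and [Lam ^+ 2 + 1] bounds 1 / (1 - r). *)
Lemma push_lower f q (K : R) : S3 q -> S3 (f q) -> w1 q * w2 q != 0 -> 0 < K ->
  (forall X, HS3 q X -> HS3 (f q) (push f q X)) ->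
  (dilatation g1 g0 f q <= K%:E)%E ->
  let X := push f q (hiP q) in let Y := push f q (hP q) in
  forall a b : R, (a ^+ 2 + b ^+ 2) * (nsq X + nsq Y) <=
    8 * K ^+ 2 * (Lam ^+ 2 + 1) ^+ 2 * nsq (a *: X + b *: Y).
Proof.
move=> Sq Sf p0 K0 HH dil X Y a b.
have U := push_unit_le Sq Sf p0 (ltW K0) HH dil.
have pk k Z : push f q (k *: Z) = k *: push f q Z by rewrite /push linearZ.
have [/andP[r0 r1] rL] := lamr_bounds q.
set r := lamr lam q in U r0 r1 rL.
have r1' : 0 < 1 + r by lra.
have r2' : 0 < 1 - r by lra.
have r2L : 1 <= (Lam ^+ 2 + 1) * (1 - r) by lra.
have L0 : 0 <= Lam ^+ 2 by exact: sqr_ge0.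
have [a' aE] : exists a', a = a' * (1 + r) by exists (a / (1 + r)); rewrite divfK// gt_eqF.
have [b' bE] : exists b', b = b' * (1 - r) by exists (b / (1 - r)); rewrite divfK// gt_eqF.
have E : a *: X + b *: Y = a' *: push f q ((1 + r) *: hiP q) + b' *: push f q ((1 - r) *: hP q).
  by rewrite !pk !scalerA -aE -bE.
have aa' : a ^+ 2 <= 4 * a' ^+ 2.
  rewrite aE exprMn mulrC; apply: ler_wpM2r; first exact: sqr_ge0.
  have h : (1 + r) * (1 + r) <= 2 * 2 by apply: ler_pM; lra.
  by rewrite expr2; lra.
have bb' : b ^+ 2 <= 4 * b' ^+ 2.
  rewrite bE exprMn mulrC; apply: ler_wpM2r; first exact: sqr_ge0.
  have h : (1 - r) * (1 - r) <= 2 * 2 by apply: ler_pM; lra.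
  by rewrite expr2; lra.
have [s0|s0] := eqVneq (a' ^+ 2 + b' ^+ 2) 0.
  have a2 := sqr_ge0 a; have b2 := sqr_ge0 b.
  have -> : a ^+ 2 + b ^+ 2 = 0 by lra.
  have K2 := sqr_ge0 K; have L2 := sqr_ge0 (Lam ^+ 2 + 1).
  rewrite mul0r; apply: mulr_ge0; last exact: nsq_ge0.
  by apply: mulr_ge0 => //; apply: mulr_ge0.
have s1 : 0 < a' ^+ 2 + b' ^+ 2 by rewrite lt_neqAle eq_sym s0 addr_ge0 ?sqr_ge0.
pose s := Num.sqrt (a' ^+ 2 + b' ^+ 2).
have ss : s ^+ 2 = a' ^+ 2 + b' ^+ 2 by rewrite sqr_sqrtr// ltW.
have sp : 0 < s by rewrite sqrtr_gt0.
have uv : (a' / s) ^+ 2 + (b' / s) ^+ 2 = 1.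
  by rewrite !exprMn -mulrDl -ss exprVn mulfV// expf_neq0// gt_eqF.
have e10 : (1 : R) ^+ 2 + 0 ^+ 2 = 1 by rewrite expr1n expr0n addr0.
have e01 : (0 : R) ^+ 2 + 1 ^+ 2 = 1 by rewrite expr1n expr0n add0r.
have H1 := U 1 0 _ _ e10 uv; have H2 := U 0 1 _ _ e01 uv.
rewrite /= scale1r scale0r addr0 in H1; rewrite /= scale1r scale0r add0r in H2.
set Z := _ + (b' / s) *: _ in H1 H2.
have ZE : a *: X + b *: Y = s *: Z.
  have s0' : s != 0 by rewrite gt_eqF.
  by rewrite E /Z [RHS]scalerDr !scalerA (mulrC s (a' / s)) (mulrC s (b' / s)) !divfK.
rewrite ZE nsqZ ss.
rewrite !pk !nsqZ -/X -/Y in H1 H2.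
have X0 := nsq_ge0 X; have Y0 := nsq_ge0 Y; have Z0 := nsq_ge0 Z.
have HX : nsq X <= (1 + r) ^+ 2 * nsq X.
  rewrite -[leLHS]mul1r; apply: ler_wpM2r => //.
  have h : 1 * 1 <= (1 + r) * (1 + r) by apply: ler_pM; lra.
  by rewrite expr2; lra.
have HY : nsq Y <= (Lam ^+ 2 + 1) ^+ 2 * ((1 - r) ^+ 2 * nsq Y).
  rewrite mulrA -exprMn -[leLHS]mul1r; apply: ler_wpM2r => //.
  by rewrite exprn_ege1.
have L1 : 1 <= (Lam ^+ 2 + 1) ^+ 2 by rewrite exprn_ege1//; lra.
have KZ0 : 0 <= K ^+ 2 * nsq Z by rewrite mulr_ge0// sqr_ge0.
have HX' : nsq X <= (Lam ^+ 2 + 1) ^+ 2 * (K ^+ 2 * nsq Z).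
  apply: (le_trans (le_trans HX H1)); rewrite -[leLHS]mul1r; exact: ler_wpM2r.
have HY' : nsq Y <= (Lam ^+ 2 + 1) ^+ 2 * (K ^+ 2 * nsq Z).
  apply: (le_trans HY); apply: ler_wpM2l => //; exact: le_trans L1.
have ab : a ^+ 2 + b ^+ 2 <= 4 * (a' ^+ 2 + b' ^+ 2) by lra.
apply: (@le_trans _ _ (4 * (a' ^+ 2 + b' ^+ 2) * (2 * ((Lam ^+ 2 + 1) ^+ 2 * (K ^+ 2 * nsq Z))))).
  by apply: ler_pM => //; rewrite ?addr_ge0 ?sqr_ge0//; lra.
rewrite le_eqVlt; apply/orP; left; apply/eqP; ring.
Qed.

End Metrics.
End Dilatation.

(** * Lipschitz curves joining antipodal points *)

Section Angles.
Context {R : realType}.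
Local Notation R4 := 'rV[R]_4.
Implicit Types (u v w X Y : R4).

Lemma dot_sqr_le X Y : dot X Y ^+ 2 <= nsq X * nsq Y.
Proof.
rewrite -subr_ge0.
have -> : nsq X * nsq Y - dot X Y ^+ 2 =
  (X 0 0 * Y 0 1 - X 0 1 * Y 0 0) ^+ 2 + (X 0 0 * Y 0 2 - X 0 2 * Y 0 0) ^+ 2 +
  (X 0 0 * Y 0 3 - X 0 3 * Y 0 0) ^+ 2 + (X 0 1 * Y 0 2 - X 0 2 * Y 0 1) ^+ 2 +
  (X 0 1 * Y 0 3 - X 0 3 * Y 0 1) ^+ 2 + (X 0 2 * Y 0 3 - X 0 3 * Y 0 2) ^+ 2.
  by rewrite /nsq /dot; ring.
by rewrite !addr_ge0// sqr_ge0.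
Qed.

Lemma dot_unit u v : nsq u = 1 -> nsq v = 1 -> -1 <= dot u v <= 1.
Proof.
move=> u1 v1; have := dot_sqr_le u v; rewrite u1 v1 mul1r => h.
by rewrite -ler_norml -(@ler_pXn2r _ 2)// ?nnegrE// expr1n real_normK ?num_real.
Qed.

(** The triangle inequality for angles on the unit sphere, in terms of cosines: Cauchy-Schwarz is
    applied to the components of [u] and [w] orthogonal to [v]. *)
Lemma dot_angle u v w (a b : R) : nsq u = 1 -> nsq v = 1 -> nsq w = 1 ->
  0 <= a -> 0 <= b -> a + b <= pi -> cos a <= dot u v -> cos b <= dot v w ->
  cos (a + b) <= dot u w.
Proof.
move=> u1 v1 w1 a0 b0 abpi; move: (dot_unit u1 v1) (dot_unit v1 w1).
set s := dot u v; set t := dot v w => hs ht as_ bt.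
have ang (c r : R) : -1 <= r <= 1 -> 0 <= c -> c <= pi -> cos c <= r ->
    [/\ 0 <= acos r, acos r <= c & cos (acos r) = r].
  move=> hr c0 cpi cr; have A0 := acos_ge0 hr; have Api := acos_lepi hr.
  have cA : cos (acos r) = r by rewrite acosK// in_itv.
  split => //; rewrite leNgt; apply/negP => cA'.
  have : cos (acos r) < cos c by rewrite ltr_cos// in_itv/= ?c0 ?cpi ?A0 ?Api.
  by rewrite cA ltNge cr.
have pi0 := pi_ge0 R.
have [A0 Aa cA] : [/\ 0 <= acos s, acos s <= a & cos (acos s) = s] by apply: ang => //; lra.
have [B0 Bb cB] : [/\ 0 <= acos t, acos t <= b & cos (acos t) = t] by apply: ang => //; lra.
have step : cos (a + b) <= cos (acos s + acos t).
  have [/eqP ->//|ne] := boolP (a + b == acos s + acos t).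
  apply/ltW; rewrite ltr_cos ?in_itv/= ?addr_ge0//=; last first.
    by rewrite (le_trans _ abpi)// lerD.
  by rewrite lt_neqAle eq_sym ne lerD.
apply: (le_trans step); rewrite cosD cA cB !sin_acos//.
have gram : (dot u w - s * t) ^+ 2 <= (1 - s ^+ 2) * (1 - t ^+ 2).
  have := dot_sqr_le (u - s *: v) (w - t *: v).
  have -> : dot (u - s *: v) (w - t *: v) = dot u w - t * dot u v - s * dot v w + s * t * nsq v.
    by rewrite /dot /nsq !mxE; ring.
  have -> : nsq (u - s *: v) = nsq u - 2 * s * dot u v + s ^+ 2 * nsq v.
    by rewrite /dot /nsq !mxE; ring.
  have -> : nsq (w - t *: v) = nsq w - 2 * t * dot v w + t ^+ 2 * nsq v.
    by rewrite /dot /nsq !mxE; ring.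
  rewrite u1 v1 w1 -/s -/t; congr (_ ^+ 2 <= _ * _); ring.
have s1 : 0 <= 1 - s ^+ 2 by have := dot_sqr_le u v; rewrite u1 v1 -/s; lra.
have t1 : 0 <= 1 - t ^+ 2 by have := dot_sqr_le v w; rewrite v1 w1 -/t; lra.
have : `|dot u w - s * t| <= Num.sqrt (1 - s ^+ 2) * Num.sqrt (1 - t ^+ 2).
  rewrite -(@ler_pXn2r _ 2)// ?nnegrE ?mulr_ge0 ?sqrtr_ge0//.
  by rewrite real_normK ?num_real// exprMn !sqr_sqrtr.
by rewrite ler_norml => /andP[h _]; lra.
Qed.

Lemma sin_ge_near0 (k : R) : k < 1 -> exists2 e, 0 < e & forall y, 0 <= y < e -> k * y <= sin y.
Proof.
move=> k1; have [ds dsE] := is_derive_diff (is_derive_sin (0 : R)).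
have k0 : 0 < 1 - k by lra.
have /nbhs_ballP[e /= e0 H] := differentiable_eps ds k0.
exists e => // y /andP[y0 ye].
have := H y; rewrite -ball_normE/= sub0r normrN ger0_norm// => /(_ ye).
have -> : 'd sin 0 (y - 0) = y :> R.
  by rewrite subr0 -[y in LHS]mulr1 -[y * 1]/(y *: (1 : R)) linearZ/= dsE cos0 /GRing.scale/= mulr1.
rewrite sin0 add0r subr0 (ger0_norm y0) ler_norml => /andP[h _]; lra.
Qed.

(** A chord of length l subtends an angle 2 arcsin (l / 2), slightly more than l. The gap between
    [C] and [C'] absorbs the excess on short steps, and real induction adds up the steps through
    [dot_angle]. *)
Lemma locally_lipschitz_dot (beta : R -> R4) (C C' b : R) : 0 <= C -> C < C' -> 0 <= b -> C' * b <= pi ->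
  (forall x, nsq (beta x) = 1) ->
  (forall x, 0 <= x <= b -> exists2 e, 0 < e & forall x1 x2, x - e < x1 -> x1 <= x2 -> x2 < x + e ->
     nsq (beta x2 - beta x1) <= (C * (x2 - x1)) ^+ 2) ->
  cos (C' * b) <= dot (beta 0) (beta b).
Proof.
move=> C0 CC' b0 Cb u1 lip.
have C'0 : 0 < C' by exact: le_lt_trans CC'.
pose P x := cos (C' * x) <= dot (beta 0) (beta x).
have kC : C / C' < 1 by rewrite ltr_pdivrMr// mul1r.
have [d d0 Hd] := sin_ge_near0 kC.
have step x : 0 <= x <= b -> exists2 e, 0 < e & forall x1 x2, x - e < x1 -> x1 <= x2 -> x2 < x + e ->
    0 <= x1 -> x2 <= b -> P x1 -> P x2.
  move=> xb; have [e e0 He] := lip x xb.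
  exists (Num.min (e / 2) (d / C')); first by rewrite lt_min !divr_gt0.
  move=> x1 x2 h1 x12 h2 x10 x2b Px1.
  have [m1 m2] : Num.min (e / 2) (d / C') <= e / 2 /\ Num.min (e / 2) (d / C') <= d / C'.
    by split; rewrite ge_min lexx ?orbT.
  have L := He x1 x2; rewrite /P.
  have -> : C' * x2 = C' * x1 + C' * (x2 - x1) by ring.
  apply: (dot_angle (u1 0) (u1 x1) (u1 x2)) => //.
  - by rewrite mulr_ge0// ltW.
  - by rewrite mulr_ge0 ?subr_ge0// ltW.
  - rewrite -mulrDr addrC subrK; apply: le_trans Cb.
    by rewrite ler_pM2l.
  (* Half the angle allotted to the step; the chord is at most 2 (C / C') y, hence at most 2 sin
     y. *)
  set y := C' * (x2 - x1) / 2.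
  have yE : C' * (x2 - x1) = y *+ 2 by rewrite /y mulr2n; field.
  have y0 : 0 <= y by rewrite divr_ge0// mulr_ge0 ?subr_ge0// ltW.
  have yd : y < d.
    have h3 : x2 - x1 < 2 * (d / C') by lra.
    have : C' * (x2 - x1) < C' * (2 * (d / C')) by rewrite ltr_pM2l.
    have -> : C' * (2 * (d / C')) = 2 * d by field; rewrite gt_eqF.
    by rewrite yE mulr2n; lra.
  rewrite yE cos_mulr2n cos2sin2.
  have := Hd y; rewrite y0 yd => /(_ isT) hs.
  have ky : C / C' * y = C * (x2 - x1) / 2 by rewrite /y; field; rewrite gt_eqF.
  rewrite ky in hs.
  have hs2 : (C * (x2 - x1) / 2) ^+ 2 <= sin y ^+ 2.
    by rewrite ler_pXn2r// nnegrE ?divr_ge0 ?mulr_ge0 ?subr_ge0//; apply: le_trans hs; rewrite divr_ge0// mulr_ge0 ?subr_ge0.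
  have Lx : nsq (beta x2 - beta x1) <= (C * (x2 - x1)) ^+ 2 by apply: L => //; lra.
  have : nsq (beta x2 - beta x1) = nsq (beta x2) + nsq (beta x1) - 2 * dot (beta x1) (beta x2).
    by rewrite /dot /nsq !mxE; ring.
  rewrite !u1 => E; rewrite E in Lx.
  have : (C * (x2 - x1) / 2) ^+ 2 = (C * (x2 - x1)) ^+ 2 / 4 by field.
  move: hs2 Lx; move: ((C * (x2 - x1) / 2) ^+ 2) ((C * (x2 - x1)) ^+ 2) (sin y ^+ 2) (dot _ _) => p q r s.
  by move=> *; rewrite mulr2n; lra.
apply: (@real_induction R P 0 b) => //.
- by rewrite /P mulr0 cos0 -nsq_dot u1.
- move=> t /andP[t0 tb] H; have [|e e0 He] := step t; first by rewrite ltW.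
  have [s /andP[s1 s2] [s0 Ps]] := H e e0.
  by apply: (He s t) => //; [exact: ltW|rewrite ltrDl].
- move=> t /andP[t0 tb] Pt; have [|e e0 He] := step t; first by rewrite t0 ltW.
  exists (Num.min (t + e / 2) b).
    by rewrite lt_min tb ltrDl divr_gt0//= ge_min lexx orbT.
  apply: (He t _) => //.
  - by rewrite ltrBlDr ltrDl.
  - by rewrite le_min (ltW tb) lerDl divr_ge0// ltW.
  - by rewrite gt_min; apply/orP; left; lra.
  - by rewrite ge_min lexx orbT.
Qed.

Lemma antipodal_lipschitz (beta : R -> R4) (C : R) : 0 <= C ->
  (forall x, nsq (beta x) = 1) -> beta (2 * pi) = - beta 0 ->
  (forall x, 0 <= x <= 2 * pi -> exists2 e, 0 < e & forall x1 x2, x - e < x1 -> x1 <= x2 -> x2 < x + e ->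
     nsq (beta x2 - beta x1) <= (C * (x2 - x1)) ^+ 2) ->
  2^-1 <= C.
Proof.
move=> C0 u1 anti lip; rewrite leNgt; apply/negP => C2.
pose C' := (C + 2^-1) / 2.
have pi0 := pi_gt0 R.
have C'1 : C < C' by rewrite /C'; lra.
have C'2 : C' < 2^-1 by rewrite /C'; lra.
have C'pi : C' * (2 * pi) < pi.
  rewrite -[ltRHS]mul1r mulrA ltr_pM2r//; lra.
have b0 : 0 <= 2 * pi :> R by rewrite mulr_ge0// ltW.
have := locally_lipschitz_dot C0 C'1 b0 (ltW C'pi) u1 lip.
rewrite anti (_ : dot _ _ = -1); last first.
  by rewrite -(u1 0) /dot /nsq !mxE; ring.
have C'0 : 0 <= C' by lra.
have h1 : C' * (2 * pi) \in `[0, pi] by rewrite in_itv/= (ltW C'pi) mulr_ge0.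
have h2 : (pi : R) \in `[0, pi] by rewrite in_itv/= lexx ltW.
by rewrite leNgt => /negP; apply; rewrite -cospi ltr_cos.
Qed.

End Angles.

(** * The identity *)

Section IdentityQuasiconformal.
Context {R : realType}.
Local Notation R4 := 'rV[R]_4.

Lemma norm_le_coord (X : R4) (B : R) : 0 <= B -> (forall i, `|X 0 i| <= B) -> `|X| <= B.
Proof.
move=> B0 H; rewrite [leLHS]mx_normrE; apply: bigmax_le => // -[i j] _ /=.
by rewrite (ord1 i); exact: H.
Qed.

Lemma has_diff_is_derive (f : R -> R) (t d : R) : has_diff f t 1 d -> is_derive t 1 f d.
Proof.
move=> [df dE]; have df' : derivable f t 1 by apply/derivable1_diffP.
by split => //; rewrite deriveE.
Qed.

(** The speed is bounded on the compact interval, so [c] is Lipschitz there by the mean value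
    theorem applied to each coordinate. *)
Lemma smooth_abs_continuous (c : R -> R4) (a b : R) : smooth_on setT c -> abs_continuous a b c.
Proof.
move=> sc; have [ab|ba] := leP a b; last first.
  move=> e e0; exists 1 => // n u v H _ _; rewrite big1// => i _.
  by have [h1 h2 h3] := H i; move: (le_trans h1 (le_trans h2 h3)); rewrite leNgt ba.
have dc t : differentiable c t by exact: smooth_on_differentiable sc I.
have cd : continuous (fun t => `|'d c t 1|).
  have [_ H] := sc 1%N; move=> t; apply: continuous_comp; last exact: norm_continuous.
  by have := H 1 t I.
have [z _ zmax] := EVT_max ab (continuous_subspaceT cd).
have L s t : a <= s -> s <= t -> t <= b -> `|c t - c s| <= `|'d c z 1| * (t - s).
  move=> as_ st tb; apply: norm_le_coord; first by rewrite mulr_ge0 ?subr_ge0.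
  move=> i; rewrite !mxE.
  have hd (x : R) : is_derive x (1 : R) (fun t => c t 0 i) ('d c x (1 : R) 0 i).
    by apply: has_diff_is_derive; exact: has_diff_coord.
  have cc : {within `[s, t], continuous (fun t => c t 0 i)}.
    apply: continuous_subspaceT => x; apply: differentiable_continuous.
    by have [] := has_diff_coord i (conj (dc x) erefl : has_diff c x 1 _).
  have [w] := MVT_segment st (fun x _ => hd x) cc.
  rewrite in_itv/= => /andP[sw wt] ->; rewrite normrM (ger0_norm (_ : 0 <= t - s)) ?subr_ge0//.
  apply: ler_wpM2r; rewrite ?subr_ge0//; apply: (le_trans (le_coord_norm _ _)).
  by apply: zmax; rewrite in_itv/= (le_trans as_ sw) (le_trans wt tb).
apply: (@abs_continuous_dominated R R R R4 (fun x => x) (fun x => x) c a b `|'d c z 1|).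
- exact: abs_continuous_id.
- exact: abs_continuous_id.
move=> s t as_ st tb; apply: (le_trans (L s t as_ st tb)).
apply: ler_wpM2l => //; rewrite ger0_norm ?subr_ge0//; lra.
Qed.

Lemma ae_S3_all (P : R4 -> Prop) : (forall q, S3 q -> P q) -> ae_S3 P.
Proof.
move=> H U psi _; rewrite (_ : _ `&` _ = set0); first exact: negligible_set0.
by rewrite -subset0 => u [_ [Sq]] []; exact: H.
Qed.

Lemma ACL_id : ACL (@id R4).
Proof.
move=> U G _; exists set0.
  split; first exact: sub0set.
  move=> S _ _ V psi _; rewrite bigcup_set0 setI0 preimage_set0 setI0.
  exact: negligible_set0.
move=> gamma _ _ c sc _ _ a b; exact: smooth_abs_continuous.
Qed.

Lemma push_id (q X : R4) : S3 q -> TS3 q X -> push id q X = X.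
Proof. by move=> Sq TX; have [_ h] := has_diff_retr_tangent Sq TX; exact: h. Qed.

Lemma differentiable_id_S3 (q : R4) : S3 q -> differentiable_S3 id q.
Proof. by move=> Sq; have [h _] := has_diff_retr 0 Sq; exact: h. Qed.

Lemma equivariant_id : equivariant (@id R4). Proof. by []. Qed.

Lemma homeomorphism_id : homeomorphism_S3 (@id R4).
Proof. by exists id; split => // q; apply: continuous_subspaceT => x; exact: cvg_id. Qed.

End IdentityQuasiconformal.

(** * Equivariant maps on a slice *)

Section HopfQuotient.
Context {R : realType}.
Local Notation R4 := 'rV[R]_4.
Local Notation P2 := (R * R)%type.
Implicit Types (p q X Y : R4).

Lemma continuous_on_S3 (V : normedModType R) (c : V -> R4) v (f : R4 -> R4) :
  {within S3, continuous f} -> {for v, continuous c} ->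
  (\forall w \near v, S3 (c w)) -> {for v, continuous (fun w => f (c w))}.
Proof.
move=> /subspace_continuousP cf cc Sc.
have Sv := nbhs_singleton Sc.
move=> A nA; have H := cf _ Sv _ nA.
by apply: filterS2 Sc (cc _ H) => w Sw; exact.
Qed.

Lemma hiP_Psi (x y t : R) : -1 <= y <= 1 ->
  hiP (Psi x y t) = - (Psi_x (Psi x y t) + (y / 2) *: Psi_t (Psi x y t)).
Proof.
move=> /andP[y1 y2]; have := Psi_w1 x t y1; have := Psi_w2 x t y2.
move: (Psi x y t) => q h2 h1.
rewrite /hiP /prod_re /prod_im; apply: row4P; rewrite !mxE/=.
- transitivity (- q 0 1 * (q 0 2 ^+ 2 + q 0 3 ^+ 2)); [ring|by rewrite h2; field].
- transitivity (q 0 0 * (q 0 2 ^+ 2 + q 0 3 ^+ 2)); [ring|by rewrite h2; field].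
- transitivity (q 0 3 * (q 0 0 ^+ 2 + q 0 1 ^+ 2)); [ring|by rewrite h1; field].
- transitivity (- q 0 2 * (q 0 0 ^+ 2 + q 0 1 ^+ 2)); [ring|by rewrite h1; field].
Qed.

Lemma hP_Psi (x y t : R) : -1 < y < 1 ->
  hP (Psi x y t) = (1 - y ^+ 2) *: Psi_y (Psi x y t) y.
Proof.
move=> /andP[y1 y2]; have := Psi_w1 x t (ltW y1); have := Psi_w2 x t (ltW y2).
move: (Psi x y t) => q h2 h1.
have p1 : 1 + y != 0 by rewrite gt_eqF//; lra.
have p2 : 1 - y != 0 by rewrite gt_eqF//; lra.
rewrite /hP /prod_re /prod_im; apply: row4P; rewrite !mxE/=.
- transitivity (q 0 0 * (q 0 2 ^+ 2 + q 0 3 ^+ 2)); [ring|rewrite h2; field; rewrite ?p1 ?p2//].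
- transitivity (q 0 1 * (q 0 2 ^+ 2 + q 0 3 ^+ 2)); [ring|rewrite h2; field; rewrite ?p1 ?p2//].
- transitivity (- q 0 2 * (q 0 0 ^+ 2 + q 0 1 ^+ 2)); [ring|rewrite h1; field; rewrite ?p1 ?p2//].
- transitivity (- q 0 3 * (q 0 0 ^+ 2 + q 0 1 ^+ 2)); [ring|rewrite h1; field; rewrite ?p1 ?p2//].
Qed.

Lemma w12_Psi (x y t : R) : -1 < y < 1 -> w1 (Psi x y t) * w2 (Psi x y t) != 0.
Proof.
move=> /andP[y1 y2]; apply: mulf_neq0; apply/eqP => w0.
- have h1 : Psi x y t 0 0 = 0 := congr1 (@complex.Re R) w0.
  have h2 : Psi x y t 0 1 = 0 := congr1 (@complex.Im R) w0.
  by have := Psi_w1 x t (ltW y1); rewrite h1 h2; lra.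
- have h1 : Psi x y t 0 2 = 0 := congr1 (@complex.Re R) w0.
  have h2 : Psi x y t 0 3 = 0 := congr1 (@complex.Im R) w0.
  by have := Psi_w2 x t (ltW y2); rewrite h1 h2; lra.
Qed.

Lemma circle_act_S3 phi q : S3 q -> S3 (circle_act phi q).
Proof.
move=> /S3_nsq h; apply/S3_nsq; rewrite -[RHS]h circle_actE /nsq !mxE/=.
transitivity ((cos phi ^+ 2 + sin phi ^+ 2) * nsq q); first by rewrite /nsq; ring.
by rewrite cos2Dsin2 mul1r.
Qed.

Lemma has_diff_circle q : has_diff (fun phi : R => circle_act phi q) 0 1 (Psi_t q).
Proof.
have hc := has_diff_cos (has_diff_id (0 : R) (1 : R)); have hs := has_diff_sin (has_diff_id (0 : R) (1 : R)).
have cst (a : R) := has_diff_cst a (0 : R) (1 : R).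
pose F (i : 'I_4) phi := [:: cos phi * q 0 0 - sin phi * q 0 1; cos phi * q 0 1 + sin phi * q 0 0;
      cos phi * q 0 2 - sin phi * q 0 3; cos phi * q 0 3 + sin phi * q 0 2]`_i.
have HF i : has_diff (F i) 0 1 (Psi_t q 0 i).
  case: i => -[|[|[|[|//]]]] i; rewrite /F/= mxE/=.
  - apply: (has_diff_eq (has_diffD (has_diffM hc (cst _)) (has_diffN (has_diffM hs (cst _))))).
    by rewrite sin0 cos0; ring.
  - apply: (has_diff_eq (has_diffD (has_diffM hc (cst _)) (has_diffM hs (cst _)))).
    by rewrite sin0 cos0; ring.
  - apply: (has_diff_eq (has_diffD (has_diffM hc (cst _)) (has_diffN (has_diffM hs (cst _))))).
    by rewrite sin0 cos0; ring.
  - apply: (has_diff_eq (has_diffD (has_diffM hc (cst _)) (has_diffM hs (cst _)))).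
    by rewrite sin0 cos0; ring.
apply: (has_diff_eq (has_diff_row HF)).
by apply/rowP => i; rewrite mxE.
Qed.

Lemma circle_act0 q : circle_act 0 q = q.
Proof. by rewrite circle_actE cos0 sin0; apply: row4P; rewrite !mxE/=; ring. Qed.

Lemma has_diff_unique (V W : normedModType R) (f g : V -> W) u v d e :
  has_diff f u v d -> has_diff g u v e -> f = g -> d = e.
Proof. by move=> [_ <-] [_ <-] ->. Qed.

(** Derivative at phi = 0 of the equivariance relation; [Psi_t] generates the circle action. *)
Lemma push_Psi_t f q : equivariant f -> S3 q -> differentiable_S3 f q ->
  push f q (Psi_t q) = Psi_t (f q).
Proof.
move=> ef Sq df.
have hf : has_diff (f \o @retr R 4) (circle_act 0 q) (Psi_t q) (push f q (Psi_t q)).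
  by rewrite circle_act0.
have h1 := has_diff_comp (has_diff_circle q) hf.
have h2 := has_diff_circle (f q).
apply: (has_diff_unique h1 h2); apply/funext => phi /=.
by rewrite retr_id ?ef//; exact: circle_act_S3.
Qed.

(** The affine coordinate w2 / w1 of the Hopf projection as a pair of reals; it is meaningful where
    [nw1], the squared modulus of w1, is nonzero. *)
Definition quot p : P2 :=
  ((p 0 0 * p 0 2 + p 0 1 * p 0 3) / (p 0 0 ^+ 2 + p 0 1 ^+ 2),
   (p 0 0 * p 0 3 - p 0 1 * p 0 2) / (p 0 0 ^+ 2 + p 0 1 ^+ 2)).

Definition nw1 p : R := p 0 0 ^+ 2 + p 0 1 ^+ 2.

Lemma nw1_circle phi p : nw1 (circle_act phi p) = nw1 p.
Proof.
rewrite /nw1 circle_actE !mxE/=.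
transitivity ((cos phi ^+ 2 + sin phi ^+ 2) * (p 0 0 ^+ 2 + p 0 1 ^+ 2)); first by ring.
by rewrite cos2Dsin2 mul1r.
Qed.

Lemma quot_circle phi p : quot (circle_act phi p) = quot p.
Proof.
rewrite /quot -!/(nw1 _) nw1_circle circle_actE !mxE/=; congr (_ / _, _ / _).
- transitivity ((cos phi ^+ 2 + sin phi ^+ 2) * (p 0 0 * p 0 2 + p 0 1 * p 0 3)); first by ring.
  by rewrite cos2Dsin2 mul1r.
- transitivity ((cos phi ^+ 2 + sin phi ^+ 2) * (p 0 0 * p 0 3 - p 0 1 * p 0 2)); first by ring.
  by rewrite cos2Dsin2 mul1r.
Qed.

Lemma quot_w2 p : nw1 p != 0 ->
  p 0 2 = (quot p).1 * p 0 0 - (quot p).2 * p 0 1 /\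
  p 0 3 = (quot p).1 * p 0 1 + (quot p).2 * p 0 0.
Proof. by rewrite /nw1 /quot/= => n0; split; field. Qed.

Lemma nw1_quot p : S3 p -> nw1 p != 0 -> nw1 p * (1 + (quot p).1 ^+ 2 + (quot p).2 ^+ 2) = 1.
Proof.
move=> /S3_nsq Sp n0; have [h2 h3] := quot_w2 n0.
move: (quot p).1 (quot p).2 h2 h3 => u v h2 h3.
by transitivity (nsq p) => //; rewrite /nsq h2 h3 /nw1; ring.
Qed.

Lemma quot_orbit p p' : S3 p -> S3 p' -> nw1 p != 0 -> nw1 p' != 0 -> quot p = quot p' ->
  exists phi, p' = circle_act phi p.
Proof.
move=> Sp Sp' n0 n0' E.
have nE : nw1 p' = nw1 p.
  have h1 := nw1_quot Sp n0; have h2 := nw1_quot Sp' n0'; rewrite -E in h2.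
  have z0 : 1 + (quot p).1 ^+ 2 + (quot p).2 ^+ 2 != 0.
    by rewrite gt_eqF// -addrA ltr_wpDr// addr_ge0 ?sqr_ge0.
  by apply: (mulIf z0); rewrite h1 h2.
have [h2 h3] := quot_w2 n0; have [h2' h3'] := quot_w2 n0'.
rewrite -E in h2' h3'; move: (quot p).1 (quot p).2 h2 h3 h2' h3' => u v h2 h3 h2' h3' {E}.
have [] := @polar R ((p 0 0 * p' 0 0 + p 0 1 * p' 0 1) / nw1 p) ((p 0 0 * p' 0 1 - p 0 1 * p' 0 0) / nw1 p).
  rewrite !exprMn -mulrDl.
  have -> : (p 0 0 * p' 0 0 + p 0 1 * p' 0 1) ^+ 2 + (p 0 0 * p' 0 1 - p 0 1 * p' 0 0) ^+ 2 = nw1 p * nw1 p'.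
    by rewrite /nw1; ring.
  by rewrite nE -expr2 exprVn mulfV// expf_neq0.
move=> phi [cE sE]; exists phi.
have e0 : p' 0 0 = cos phi * p 0 0 - sin phi * p 0 1.
  by rewrite -cE -sE; move: n0; rewrite /nw1 => n0; field.
have e1 : p' 0 1 = cos phi * p 0 1 + sin phi * p 0 0.
  by rewrite -cE -sE; move: n0; rewrite /nw1 => n0; field.
rewrite circle_actE; apply: row4P; rewrite mxE/=.
- exact: e0.
- exact: e1.
- by rewrite h2' e0 e1 h2 h3; ring.
- by rewrite h3' e0 e1 h2 h3; ring.
Qed.

(** The section of the Hopf fibration over C with w1 real and positive. *)
Definition hopf_section (z : P2) : R4 :=
  let s := (Num.sqrt (1 + z.1 ^+ 2 + z.2 ^+ 2))^-1 in \row_k [:: s; 0; s * z.1; s * z.2]`_k.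

Let zpos (z : P2) : 0 < 1 + z.1 ^+ 2 + z.2 ^+ 2.
Proof. by rewrite -addrA ltr_wpDr// addr_ge0 ?sqr_ge0. Qed.

Lemma hopf_section_S3 z : S3 (hopf_section z).
Proof.
apply/S3_nsq; rewrite /nsq /hopf_section !mxE/=.
transitivity ((Num.sqrt (1 + z.1 ^+ 2 + z.2 ^+ 2))^-1 ^+ 2 * (1 + z.1 ^+ 2 + z.2 ^+ 2)); first by ring.
by rewrite exprVn sqr_sqrtr ?ltW// mulVf// gt_eqF.
Qed.

Lemma hopf_section_nw1 z : nw1 (hopf_section z) != 0.
Proof.
rewrite /nw1 /hopf_section !mxE/= expr0n addr0 expf_neq0// invr_eq0.
by rewrite gt_eqF// sqrtr_gt0.
Qed.

Lemma quot_section z : quot (hopf_section z) = z.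
Proof.
have s0 : Num.sqrt (1 + z.1 ^+ 2 + z.2 ^+ 2) != 0 by rewrite gt_eqF// sqrtr_gt0.
rewrite /quot /hopf_section !mxE/=; move: (Num.sqrt _) s0 => s s0.
by case: z => u v /=; congr (_, _); field.
Qed.

Lemma continuous_hopf_section : continuous hopf_section.
Proof.
move=> z; apply: differentiable_continuous.
have d1 : differentiable (fun z : P2 => z.1) z by have [] := diff_fst z.
have d2 : differentiable (fun z : P2 => z.2) z by have [] := diff_snd z.
have ds : differentiable (fun z : P2 => (Num.sqrt (1 + z.1 ^+ 2 + z.2 ^+ 2))^-1) z.
  have s0 : Num.sqrt (1 + z.1 ^+ 2 + z.2 ^+ 2) != 0 by rewrite gt_eqF// sqrtr_gt0.
  apply: (diffble_comp1 (f := fun z : P2 => 1 + z.1 ^+ 2 + z.2 ^+ 2) (is_deriveV s0 (is_derive1_sqrt (zpos z)))).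
  by apply: diffbleD; [apply: diffbleD; [exact: differentiable_cst|exact: diffbleX2]|exact: diffbleX2].
pose F (i : 'I_4) (z : P2) := [:: (Num.sqrt (1 + z.1 ^+ 2 + z.2 ^+ 2))^-1; 0;
  (Num.sqrt (1 + z.1 ^+ 2 + z.2 ^+ 2))^-1 * z.1; (Num.sqrt (1 + z.1 ^+ 2 + z.2 ^+ 2))^-1 * z.2]`_i.
have [] // := @diff_row R P2 4 F z 0.
case=> -[|[|[|[|//]]]] i; rewrite /F/=.
- exact: ds.
- exact: differentiable_cst.
- exact: diffbleM.
- exact: diffbleM.
Qed.

Lemma has_diff_pair (V : normedModType R) (f g : V -> R) u v d e :
  has_diff f u v d -> has_diff g u v e -> has_diff (fun w => (f w, g w)) u v (d, e).
Proof. by move=> [df <-] [dg <-]; exact: diff_pairE. Qed.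

Lemma has_diffV (V : normedModType R) (f : V -> R) u v d : f u != 0 ->
  has_diff f u v d -> has_diff (fun w => (f w)^-1) u v (d * - (f u) ^- 2).
Proof.
move=> f0; apply: has_diff_comp1.
have h := is_deriveV f0 (is_derive_id (f u) (1 : R)).
by apply: (is_derive_eq h); rewrite /GRing.scale/= mulr1.
Qed.

(** The differential of w2 / w1 is (w1 dw2 - w2 dw1) / w1^2, and the real and imaginary parts of
    this numerator are, up to sign, the components of [Y] along [N1] and [N2]: the quotient is
    conformal on contact planes and kills the fibre direction. *)
Lemma has_diff_quot p Y : nw1 p != 0 -> exists a b,
  has_diff quot p Y (a, b) /\
  (a ^+ 2 + b ^+ 2) * nw1 p ^+ 2 = dot Y (N1 p) ^+ 2 + dot Y (N2 p) ^+ 2.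
Proof.
move=> n0.
have h i := has_diff_coord i (has_diff_id p Y).
have hn : has_diff (@nw1) p Y _ := has_diffD (has_diffM (h 0) (h 0)) (has_diffM (h 1) (h 1)).
have hv := has_diffV n0 hn.
have ha := has_diffM (has_diffD (has_diffM (h 0) (h 2)) (has_diffM (h 1) (h 3))) hv.
have hb := has_diffM (has_diffD (has_diffM (h 0) (h 3)) (has_diffN (has_diffM (h 1) (h 2)))) hv.
eexists; eexists; split; first exact: has_diff_pair ha hb.
rewrite /dot !mxE/=; move: n0; rewrite /nw1 => n0; field.
exact: n0.
Qed.

End HopfQuotient.

(** * Lipschitz estimates for reparametrizations and rotations *)

Section LipschitzTrig.
Context {R : realType}.
Local Notation R4 := 'rV[R]_4.

Lemma lipschitz_derive (h dh : R -> R) (k a b : R) : a <= b ->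
  (forall x, a <= x <= b -> is_derive x 1 h (dh x) /\ `|dh x| <= k) ->
  `|h b - h a| <= k * (b - a) /\ exists2 c, a <= c <= b & h b - h a = dh c * (b - a).
Proof.
move=> ab H.
have hd x : x \in `]a, b[ -> is_derive x 1 h (dh x).
  by rewrite in_itv/= => /andP[/ltW ax /ltW xb]; have [] := H x; rewrite ?ax.
have hc : {within `[a, b], continuous h}.
  apply/subspace_continuousP => x; rewrite /= in_itv/= => axb.
  have [[dx _] _] := H x axb; apply: cvg_within_filter.
  exact: (differentiable_continuous ((derivable1_diffP _ _).1 dx)).
have [c] := MVT_segment ab hd hc; rewrite in_itv/= => acb E.
split; last by exists c.
rewrite E normrM (ger0_norm (_ : 0 <= b - a)) ?subr_ge0//.
by apply: ler_wpM2r; rewrite ?subr_ge0//; have [] := H c acb.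
Qed.

Lemma cos_sin_lipschitz (x y : R) : `|cos x - cos y| <= `|x - y| /\ `|sin x - sin y| <= `|x - y|.
Proof.
wlog xy : x y / y <= x.
  move=> H; have [/H//|/ltW /H[h1 h2]] := leP y x.
  by rewrite distrC (distrC (sin x)) (distrC x).
rewrite [in X in _ <= X](ger0_norm (_ : 0 <= x - y)) ?subr_ge0//.
have hc z : y <= z <= x -> is_derive z 1 (@cos R) (- sin z) /\ `|- sin z| <= 1.
  by move=> _; split; [exact: is_derive_cos|rewrite normrN ler_norml sin_geN1 sin_le1].
have hs z : y <= z <= x -> is_derive z 1 (@sin R) (cos z) /\ `|cos z| <= 1.
  by move=> _; split; [exact: is_derive_sin|rewrite ler_norml cos_geN1 cos_le1].
have [h1 _] := lipschitz_derive xy hc; have [h2 _] := lipschitz_derive xy hs.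
by move: h1 h2; rewrite !mul1r (ger0_norm (_ : 0 <= x - y)) ?subr_ge0.
Qed.

Lemma pihalf_gt1 : 1 < pi / 2 :> R.
Proof.
rewrite lt_neqAle pihalf_ge1 andbT; apply/eqP => h.
by have := @cos1_gt0 R; rewrite h cos_pihalf ltxx.
Qed.

Lemma cos_ge_cos1 (x : R) : -1 <= x <= 1 -> cos 1 <= cos x.
Proof.
move=> /andP[x1 x2]; have pi2 := pi_ge2 R.
have H y : 0 <= y <= 1 -> cos 1 <= cos y :> R.
  move=> /andP[y0 y1]; have [->//|ne] := eqVneq y 1.
  by apply/ltW; rewrite ltr_cos ?in_itv/= ?y0 ?ler01//=; [rewrite lt_neqAle ne|lra|lra].
have [x0|x0] := leP 0 x; first by apply: H; rewrite x0.
by rewrite -(cosN x); apply: H; apply/andP; split; lra.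
Qed.

Lemma tan_lipschitz (s t : R) : -1 <= s -> s <= t -> t <= 1 ->
  tan s <= tan t /\ tan t - tan s <= (cos 1) ^- 2 * (t - s).
Proof.
move=> s1 st t1; have c1 := @cos1_gt0 R.
have H x : s <= x <= t -> is_derive x 1 (@tan R) ((cos x) ^- 2) /\ `|(cos x) ^- 2| <= (cos 1) ^- 2.
  move=> /andP[sx xt]; have cx : cos 1 <= cos x by apply: cos_ge_cos1; lra.
  have cx0 : 0 < cos x by exact: lt_le_trans cx.
  split; first by apply: is_derive_tan; rewrite gt_eqF.
  rewrite ger0_norm ?invr_ge0 ?exprn_ge0 ?(ltW cx0)//.
  by rewrite lef_pV2 ?posrE ?exprn_gt0// ler_pXn2r// nnegrE ltW.
have [h1 [c /andP[c2 c3] E]] := lipschitz_derive st H; split; last first.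
  by apply: le_trans h1; exact: ler_norm.
rewrite -subr_ge0 E mulr_ge0 ?subr_ge0// invr_ge0 sqr_ge0//.
Qed.

Lemma S3_coord_le1 (p : R4) i : S3 p -> `|p 0 i| <= 1.
Proof.
move=> Sp; have : \sum_j p 0 j ^+ 2 = 1 := Sp.
rewrite (bigD1 i)//= => E.
have h : 0 <= \sum_(j < 4 | j != i) p 0 j ^+ 2 by apply: sumr_ge0 => j _; exact: sqr_ge0.
by rewrite -(@ler_pXn2r _ 2)// ?nnegrE// expr1n real_normK ?num_real// -E lerDl.
Qed.

Lemma circle_act_lipschitz (phi psi : R) (p p' : R4) : S3 p ->
  `|circle_act phi p' - circle_act psi p| <= 2 * (`|p' - p| + `|phi - psi|).
Proof.
move=> Sp; have [h1 h2] := cos_sin_lipschitz phi psi.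
have A0 : 0 <= `|p' - p| by []; have B0 : 0 <= `|phi - psi| by [].
have c1 : `|cos phi| <= 1 by rewrite ler_norml cos_geN1 cos_le1.
have s1 : `|sin phi| <= 1 by rewrite ler_norml sin_geN1 sin_le1.
have H i : `|cos phi * p' 0 i - cos psi * p 0 i| <= `|p' - p| + `|phi - psi| /\
     `|sin phi * p' 0 i - sin psi * p 0 i| <= `|p' - p| + `|phi - psi|.
  have d : `|p' 0 i - p 0 i| <= `|p' - p| by have := le_coord_norm (p' - p) i; rewrite !mxE.
  have pi1 := S3_coord_le1 i Sp.
  split.
    have -> : cos phi * p' 0 i - cos psi * p 0 i = cos phi * (p' 0 i - p 0 i) + (cos phi - cos psi) * p 0 i by ring.
    apply: (le_trans (ler_normD _ _)); rewrite !normrM; apply: lerD.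
      by rewrite -[leRHS]mul1r; apply: ler_pM.
    by rewrite -[leRHS]mulr1; apply: ler_pM.
  have -> : sin phi * p' 0 i - sin psi * p 0 i = sin phi * (p' 0 i - p 0 i) + (sin phi - sin psi) * p 0 i by ring.
  apply: (le_trans (ler_normD _ _)); rewrite !normrM; apply: lerD.
    by rewrite -[leRHS]mul1r; apply: ler_pM.
  by rewrite -[leRHS]mulr1; apply: ler_pM.
apply: norm_le_coord; first by rewrite mulr_ge0// addr_ge0.
have K (a b c d : R) : `|a - c| <= `|p' - p| + `|phi - psi| -> `|b - d| <= `|p' - p| + `|phi - psi| ->
    `|a - b - (c - d)| <= 2 * (`|p' - p| + `|phi - psi|) /\ `|a + b - (c + d)| <= 2 * (`|p' - p| + `|phi - psi|).
  rewrite !ler_norml => /andP[? ?] /andP[? ?]; split; apply/andP; split; lra.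
rewrite !circle_actE => -[[|[|[|[|//]]]]] i; rewrite !mxE/=.
- by have [h _] := H 0; have [_ h'] := H 1; have [] := K _ _ _ _ h h'.
- by have [h _] := H 1; have [_ h'] := H 0; have [] := K _ _ _ _ h h'.
- by have [h _] := H 2; have [_ h'] := H 3; have [] := K _ _ _ _ h h'.
- by have [h _] := H 3; have [_ h'] := H 2; have [] := K _ _ _ _ h h'.
Qed.

End LipschitzTrig.

(** * The planar map covered by f *)

Section PlanarMap.
Context {R : realType}.
Local Notation R4 := 'rV[R]_4.
Local Notation P2 := (R * R)%type.
Variables (f finv : R4 -> R4) (x0 ts : R).
Hypothesis fS : forall q, S3 q -> S3 (f q).
Hypothesis finvS : forall q, S3 q -> S3 (finv q).
Hypothesis fK : forall q, S3 q -> finv (f q) = q.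
Hypothesis finvK : forall q, S3 q -> f (finv q) = q.
Hypothesis cf : {within S3, continuous f}.
Hypothesis cfinv : {within S3, continuous finv}.
Hypothesis ef : equivariant f.
Hypothesis acl : ACL f.

(* f on the slice t = ts, in the coordinates (x - x0, y). *)
Definition gmap (z : P2) : R4 := f (Psi (x0 + z.1) z.2 ts).
Definition rect : set P2 := [set z | `|z.1| < 1 /\ `|z.2| < 2^-1].
Definition planar (z : P2) : P2 := quot (gmap z).

Lemma rect_bounds z : rect z -> [/\ -1 < z.1 < 1, -1 < z.2 < 1, -1 <= z.2 <= 1 & - (pi / 2) < z.1 < pi / 2].
Proof.
case: z => x y [/=]; rewrite !ltr_norml => /andP[x1 x2] /andP[y1 y2]; split; try by apply/andP; split; lra.
have := @pihalf_ge1 R => h; rewrite (lt_le_trans x2 h) andbT (le_lt_trans _ x1)// lerN2//.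
Qed.

Lemma f_shift (x y t phi : R) : -1 <= y <= 1 -> f (Psi x y (phi + t)) = circle_act phi (f (Psi x y t)).
Proof. by move=> y1; rewrite -circle_act_Psi ef//; exact: Psi_S3. Qed.

Lemma gmap_S3 z : rect z -> S3 (gmap z).
Proof. by move=> /rect_bounds[_ _ h _]; apply: fS; exact: Psi_S3. Qed.

Lemma has_diff_Psi_rect (z v : P2) : rect z ->
  has_diff (fun z : P2 => Psi (x0 + z.1) z.2 ts) z v
    (v.1 *: Psi_x (Psi (x0 + z.1) z.2 ts) + v.2 *: Psi_y (Psi (x0 + z.1) z.2 ts) z.2).
Proof.
move=> /rect_bounds[_ h _ _].
have h1 : has_diff (fun z : P2 => z.1) z v v.1 by have [d E] := diff_fst z; split => //; rewrite E.
have h2 : has_diff (fun z : P2 => z.2) z v v.2 by have [d E] := diff_snd z; split => //; rewrite E.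
have := has_diff_Psi (y := fun z : P2 => z.2) h (has_diffD (has_diff_cst x0 z v) h1) h2 (has_diff_cst ts z v).
by move=> /has_diff_eq; apply; rewrite scale0r addr0 add0r.
Qed.

Lemma open_rect12 : open rect. Proof. exact: open_rect. Qed.

Lemma gmap_continuous z : rect z -> {for z, continuous gmap}.
Proof.
move=> rz; apply: (continuous_on_S3 (c := fun z : P2 => Psi (x0 + z.1) z.2 ts) cf).
  by apply: differentiable_continuous; have [] := has_diff_Psi_rect 0 rz.
apply: filterS (open_nbhs_nbhs (conj open_rect12 rz)) => w /rect_bounds[_ _ h _].
exact: Psi_S3.
Qed.

(** By equivariance and injectivity of f the two source points lie on one circle orbit, and
    [base_x], [base_y] show that the slice meets an orbit at most once. *)
Lemma orbit_inj z z' phi : rect z -> rect z' -> gmap z' = circle_act phi (gmap z) -> z' = z.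
Proof.
move=> rz rz'; have [_ y1 y2 x1] := rect_bounds rz; have [_ y1' y2' x1'] := rect_bounds rz'.
rewrite /gmap -f_shift// => E.
have E' : Psi (x0 + z'.1) z'.2 ts = Psi (x0 + z.1) z.2 (phi + ts).
  by rewrite -[LHS]fK ?E ?fK//; exact: Psi_S3.

have [_ hx'] := base_x_Psi x0 ts x1' y1'; have [_ hx] := base_x_Psi x0 (phi + ts) x1 y1.
have hy' := base_y_Psi (x0 + z'.1) ts y2'; have hy := base_y_Psi (x0 + z.1) (phi + ts) y2.
rewrite E' hx in hx'; rewrite E' hy in hy'.
by rewrite [LHS]surjective_pairing [RHS]surjective_pairing hx' hy'.
Qed.

Lemma planar_inj z z' : rect z -> rect z' -> nw1 (gmap z) != 0 -> nw1 (gmap z') != 0 ->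
  planar z = planar z' -> z' = z.
Proof.
move=> rz rz' n0 n0' E; have [phi h] := quot_orbit (gmap_S3 rz) (gmap_S3 rz') n0 n0' E.
exact: orbit_inj h.
Qed.

(** The points with w1 = 0 form a single orbit, so at most one point of the rectangle is sent to
    infinity by the quotient. *)
Lemma nw1_zero_unique z z' : rect z -> rect z' -> nw1 (gmap z) = 0 -> nw1 (gmap z') = 0 -> z' = z.
Proof.
move=> rz rz' n0 n0'; have Sp := gmap_S3 rz; have Sp' := gmap_S3 rz'.
suff [phi h] : exists phi, gmap z' = circle_act phi (gmap z) by exact: orbit_inj h.
move: (gmap z) (gmap z') n0 n0' Sp Sp' => p p' n0 n0' /S3E Sp /S3E Sp'.
rewrite /nw1 in n0 n0'.
have z0 (r : R4) : r 0 0 ^+ 2 + r 0 1 ^+ 2 = 0 -> r 0 0 = 0 /\ r 0 1 = 0.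
  move=> h; have := sqr_ge0 (r 0 0); have := sqr_ge0 (r 0 1) => h1 h2.
  by split; apply/eqP; rewrite -sqrf_eq0; apply/eqP; lra.
have [p00 p01] := z0 _ n0; have [p00' p01'] := z0 _ n0'.
have Sq : p 0 2 ^+ 2 + p 0 3 ^+ 2 = 1 by lra.
have Sq' : p' 0 2 ^+ 2 + p' 0 3 ^+ 2 = 1 by lra.
have [] := @polar R (p 0 2 * p' 0 2 + p 0 3 * p' 0 3) (p 0 2 * p' 0 3 - p 0 3 * p' 0 2).
  transitivity ((p 0 2 ^+ 2 + p 0 3 ^+ 2) * (p' 0 2 ^+ 2 + p' 0 3 ^+ 2)); first by ring.
  by rewrite Sq Sq' mulr1.
move=> phi [cE sE]; exists phi; rewrite circle_actE -cE -sE; apply: row4P; rewrite mxE/= ?p00 ?p01 ?p00' ?p01' ?mulr0 ?subr0 ?addr0//.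
- transitivity (p' 0 2 * (p 0 2 ^+ 2 + p 0 3 ^+ 2)); first by rewrite Sq mulr1.
  by ring.
- transitivity (p' 0 3 * (p 0 2 ^+ 2 + p 0 3 ^+ 2)); first by rewrite Sq mulr1.
  by ring.
Qed.

Lemma planar_continuous z : rect z -> nw1 (gmap z) != 0 -> {for z, continuous planar}.
Proof.
move=> rz n0; apply: (continuous_comp (gmap_continuous rz)).
have [a [b [[d _] _]]] := has_diff_quot 0 n0.
exact: differentiable_continuous.
Qed.

(** The image is also a preimage: [z] belongs to it exactly when the base coordinates of
    [finv (hopf_section z)] lie in [O]. Continuity of [finv] thus takes the place of invariance of
    domain. *)
Lemma planar_open O : open O -> O `<=` rect -> (forall z, O z -> nw1 (gmap z) != 0) -> open (planar @` O).
Proof.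
move=> oO Or On.
pose B (q : R4) : P2 := (base_x x0 q, base_y q).
have -> : planar @` O = [set z | 0 < cross_re x0 (finv (hopf_section z)) /\ O (B (finv (hopf_section z)))].
  apply/seteqP; split => [_ [w Ow <-]|z [c0 Oz]].
    have rw := Or _ Ow; have [_ y1 y2 x1] := rect_bounds rw.
    have [phi h] := quot_orbit (gmap_S3 rw) (hopf_section_S3 (planar w)) (On _ Ow) (hopf_section_nw1 _) (esym (quot_section _)).
    have E : finv (hopf_section (planar w)) = Psi (x0 + w.1) w.2 (phi + ts).
      by rewrite h /gmap -f_shift// fK//; exact: Psi_S3.
    have [c0 xE] := base_x_Psi x0 (phi + ts) x1 y1; rewrite /= E; split => //.
    by rewrite /B xE base_y_Psi// -surjective_pairing.
  set q := finv (hopf_section z) in c0 Oz *.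
  have Sq : S3 q by apply: finvS; exact: hopf_section_S3.
  have [t qE] := Psi_base_exists Sq c0.
  exists (B q) => //; have [_ y1 y2 x1] := rect_bounds (Or _ Oz).
  rewrite /planar /gmap /= (_ : ts = (ts - t) + t); last by rewrite subrK.
  by rewrite f_shift// quot_circle -qE finvK ?quot_section//; exact: hopf_section_S3.
rewrite openE => z [c0 Oz].
have ch : {for z, continuous (fun z => finv (hopf_section z))}.
  apply: (continuous_on_S3 cfinv (@continuous_hopf_section R z)).
  by exists (setT, setT); [split; exact: filterT|move=> w _; exact: hopf_section_S3].
have cre : {for z, continuous (fun z => cross_re x0 (finv (hopf_section z)))}.
  apply: (continuous_comp ch); apply: differentiable_continuous.
  exact: differentiable_cross_re.
have cB : {for z, continuous (fun z => B (finv (hopf_section z)))}.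
  apply: (continuous_comp ch); apply: differentiable_continuous.
  by apply: differentiable_pair; [exact: differentiable_base_x|exact: differentiable_base_y].
apply: filterI.
  exact: (cre _ (open_nbhs_nbhs (conj (@open_gt R 0) c0))).
exact: (cB _ (open_nbhs_nbhs (conj oO Oz))).
Qed.

(** For almost every [y] there is a [t0] whose leaf is good. Rotation by the angle ts - t0 - y x / 2
    carries the image of that leaf onto the row, and [tan] is Lipschitz on [-1, 1], so absolute
    continuity is inherited. *)
Lemma gmap_rows : (@lebesgue_measure R).-negligible [set y | `|y| < 2^-1 /\
  ~ forall s1 s2, -1 <= s1 -> s2 <= 1 -> abs_continuous s1 s2 (fun x => gmap (x, y))].
Proof.
apply: negligibleS (negligible_xsection (xleaf_ACL x0 acl)) => y [yb nac] neg; apply: nac => s1 s2 s1b s2b.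
have e8 : - 8^-1 < 8^-1 :> R by lra.
have [t0 [t0b nt0]] := negligible_not_itv e8 neg.
have Dt : xleaf_dom (y, t0) by split => //=; rewrite ltr_norml.
have ac : forall a b, abs_continuous a b (fun s => f (xleaf x0 ((y, t0), s))).
  by apply: contrapT => h; apply: nt0; rewrite /xsection/= inE.
have y1 : -1 <= y <= 1 by move: yb; rewrite ltr_norml => /andP[? ?]; apply/andP; split; lra.
have E x : -1 <= x <= 1 -> gmap (x, y) = circle_act (ts - t0 - y * (x / 2)) (f (xleaf x0 ((y, t0), tan x))).
  move=> /andP[x1 x2]; have hp := @pihalf_gt1 R.
  rewrite /gmap /xleaf/= tanK; last by rewrite in_itv/=; apply/andP; split; lra.
  by rewrite -f_shift//; congr (f (Psi _ _ _)); ring.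
have ac' : abs_continuous s1 s2 ((fun s => f (xleaf x0 ((y, t0), s))) \o @tan R).
  apply: (abs_continuous_monotone_comp (ac (tan s1) (tan s2)) (k := (cos 1) ^- 2)) => s t h1 h2 h3.
  have [] := @tan_lipschitz R s t; [lra|by []|lra|] => m1 m2; split => //.
    by have [] := @tan_lipschitz R s1 s; [lra|by []|lra|].
  by have [] := @tan_lipschitz R t s2; [lra|by []|lra|].
apply: (abs_continuous_dominated ac' (@abs_continuous_id R s1 s2) (k := 2)) => s t h1 h2 h3.
rewrite !E; [|by apply/andP; split; lra|by apply/andP; split; lra].
apply: (le_trans (circle_act_lipschitz _ _ _ _)).
  apply: fS; apply: Psi_S3 => //=.
rewrite /=; apply: ler_wpM2l => //; rewrite lerD2l.
have -> : ts - t0 - y * (t / 2) - (ts - t0 - y * (s / 2)) = - (y / 2) * (t - s) by ring.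
rewrite normrM -[leRHS]mul1r; apply: ler_wpM2r => //.
rewrite normrN normrM (ger0_norm (_ : 0 <= 2^-1)) ?invr_ge0//.
move: yb; move: (`|y|) => a; lra.
Qed.

Lemma gmap_cols : (@lebesgue_measure R).-negligible [set x | `|x| < 1 /\
  ~ forall s1 s2, -2^-1 <= s1 -> s2 <= 2^-1 -> abs_continuous s1 s2 (fun y => gmap (x, y))].
Proof.
apply: negligibleS (negligible_xsection (yleaf_ACL x0 acl)) => x [xb nac] neg; apply: nac => s1 s2 s1b s2b.
have e8 : - 8^-1 < 8^-1 :> R by lra.
have [t0 [t0b nt0]] := negligible_not_itv e8 neg.
have Dt : yleaf_dom (x, t0) by split => //=; rewrite ltr_norml.
have ac : forall a b, abs_continuous a b (fun s => f (yleaf x0 ((x, t0), s))).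
  by apply: contrapT => h; apply: nt0; rewrite /xsection/= inE.
(* The columns are already Legendrian, so a constant rotation suffices. *)
have E y : -2^-1 <= y <= 2^-1 -> gmap (x, y) = circle_act (ts - t0) (f (yleaf x0 ((x, t0), tan (2 * y)))).
  move=> /andP[y1 y2]; have hp := @pihalf_gt1 R.
  rewrite /gmap /yleaf/= tanK; last by rewrite in_itv/=; apply/andP; split; lra.
  rewrite (_ : 2 * y / 2 = y); last by field.
  rewrite -f_shift; first by congr (f (Psi _ _ _)); ring.
  by apply/andP; split; lra.
have ac' : abs_continuous s1 s2 ((fun s => f (yleaf x0 ((x, t0), s))) \o (fun y => tan (2 * y))).
  apply: (abs_continuous_monotone_comp (ac (tan (2 * s1)) (tan (2 * s2))) (k := (cos 1) ^- 2 * 2)) => s t h1 h2 h3.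
  have [] := @tan_lipschitz R (2 * s) (2 * t); [lra|lra|lra|] => m1 m2; split => //.
    by have [] := @tan_lipschitz R (2 * s1) (2 * s); [lra|lra|lra|].
    by have [] := @tan_lipschitz R (2 * t) (2 * s2); [lra|lra|lra|].
  by rewrite -mulrA mulrBr.
apply: (abs_continuous_dominated ac' (@abs_continuous_id R s1 s2) (k := 2)) => s t h1 h2 h3.
rewrite !E; [|by apply/andP; split; lra|by apply/andP; split; lra].
apply: (le_trans (circle_act_lipschitz _ _ _ _)).
  apply: fS; apply: Psi_S3 => //=.
  have hy : - (1 : R) < atan (tan (2 * s)) / 2 < 1 by exact: atan_half_bounds.
  by move: hy => /andP[? ?]; apply/andP; split; lra.
by rewrite /= subrr normr0; apply: ler_wpM2l => //; rewrite lerD2l.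
Qed.

End PlanarMap.

(** * Area preservation almost everywhere *)

Section GoodPoints.
Context {R : realType}.
Local Notation R4 := 'rV[R]_4.
Local Notation P2 := (R * R)%type.
Variables (f finv : R4 -> R4) (x0 ts : R).
Hypothesis fS : forall q, S3 q -> S3 (f q).
Hypothesis finvS : forall q, S3 q -> S3 (finv q).
Hypothesis fK : forall q, S3 q -> finv (f q) = q.
Hypothesis finvK : forall q, S3 q -> f (finv q) = q.
Hypothesis cf : {within S3, continuous f}.
Hypothesis cfinv : {within S3, continuous finv}.
Hypothesis ef : equivariant f.
Hypothesis acl : ACL f.
Variables (lam : 'rV[R]_3 -> R) (Lam K : R).
Variables (J0 J1 g0 g1 : R4 -> 'M[R]_4).
Hypothesis lam_bounds : forall x, S2 x -> 1 <= lam x <= Lam.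
Hypothesis J0_cr : complex_structure W0bar J0.
Hypothesis J1_cr : complex_structure (W1bar lam) J1.
Hypothesis g0_hermitian : hermitian_metric J0 g0.
Hypothesis g1_hermitian : hermitian_metric J1 g1.
Hypothesis K_gt0 : 0 < K.

Local Notation gmap := (gmap f x0 ts).
Local Notation planar := (planar f x0 ts).
Let Q (z : P2) : R4 := Psi (x0 + z.1) z.2 ts.

Definition good_S3 q : Prop :=
  (differentiable_S3 f q /\ forall X, HS3 q X -> HS3 (f q) (push f q X)) /\
  (dilatation g1 g0 f q <= K%:E)%E.

Definition good z : Prop := rect z /\ good_S3 (Psi (x0 + z.1) z.2 ts).

Definition gx z : R4 := push f (Q z) (Psi_x (Q z)).
Definition gy z : R4 := push f (Q z) (Psi_y (Q z) z.2).
(* the image under f of the horizontal lift of d/dx *)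
Definition hor z : R4 := gx z + (z.2 / 2) *: Psi_t (gmap z).

Let QS z : rect z -> S3 (Q z).
Proof. by move=> /rect_bounds[_ _ h _]; exact: Psi_S3. Qed.

Let gS z : rect z -> S3 (gmap z).
Proof. by move=> rz; apply: fS; exact: QS. Qed.

Lemma near_has_diff (V W : normedModType R) (h k : V -> W) u v d :
  (\forall w \near u, h w = k w) -> has_diff h u v d -> has_diff k u v d.
Proof.
move=> hk [dh <-]; have [dk E] := near_eq_diff hk dh; split; first exact: dk.
exact: (congr1 (fun F : V -> W => F v) E).
Qed.

Lemma good_diff z v : good z -> has_diff gmap z v (v.1 *: gx z + v.2 *: gy z).
Proof.
move=> [rz [[df _] _]].
have hf : has_diff (f \o @retr R 4) (Psi (x0 + z.1) z.2 ts) (v.1 *: Psi_x (Q z) + v.2 *: Psi_y (Q z) z.2)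
    (v.1 *: gx z + v.2 *: gy z).
  by split; [exact: df|rewrite linearD !linearZ].
apply: near_has_diff (has_diff_comp (has_diff_Psi_rect x0 ts v rz) hf).
apply: filterS (open_nbhs_nbhs (conj (@open_rect12 R) rz)) => w rw.
by rewrite /= retr_id//; exact: QS.
Qed.

Lemma good_eps z e : good z -> 0 < e -> \forall w \near z,
  `|gmap w - (gmap z + (w.1 - z.1) *: gx z + (w.2 - z.2) *: gy z)| <= e * `|w - z|.
Proof.
move=> gz e0; have [dg _] := good_diff 0 gz.
apply: filterS (differentiable_eps dg e0) => w.
by have [_ ->] := good_diff (w - z) gz; rewrite /= addrA.
Qed.

Lemma hor_push z : good z -> hor z = - push f (Q z) (hiP (Q z)).
Proof.
move=> [rz [[df _] _]]; have [_ y1 y2 _] := rect_bounds rz.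
rewrite /Q hiP_Psi// [in RHS]/push linearN opprK linearD linearZ /hor.
by congr (_ + _ *: _); rewrite -[LHS](push_Psi_t ef (QS rz) df).
Qed.

Lemma push_hP z : good z -> push f (Q z) (hP (Q z)) = (1 - z.2 ^+ 2) *: gy z.
Proof.
by move=> [rz _]; have [_ y1 y2 _] := rect_bounds rz; rewrite /Q hP_Psi// /push linearZ.
Qed.

Lemma HS3_hor z : good z -> HS3 (gmap z) (hor z).
Proof.
move=> gz; rewrite (hor_push gz) -scaleN1r; apply: HS3Z.
by case: gz => rz [[_ H] _]; apply: H; exact: HS3_hiP.
Qed.

Lemma HS3_gy z : good z -> HS3 (gmap z) (gy z).
Proof.
move=> [rz [[_ H] _]]; apply: H; have [_ y1 y2 _] := rect_bounds rz.
by apply/HS3E; split; [exact: TS3_Psi_y|rewrite omega_Psi_y].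
Qed.

Lemma good_omega_x z : good z -> omega (gmap z) (gx z) = - z.2 / 2.
Proof.
move=> gz; have [rz _] := gz; have /HS3E[_] := HS3_hor gz.
rewrite /hor omegaDr omegaZr omega_Psi_t; last exact: gS.
by rewrite mulr1 => h; lra.
Qed.

Lemma good_omega_y z : good z -> omega (gmap z) (gy z) = 0.
Proof. by move=> gz; have /HS3E[] := HS3_gy gz. Qed.

Lemma omega_hor z : good z -> omega (hor z) (gy z) = omega (gx z) (gy z).
Proof.
move=> gz; rewrite /hor omegaDl omegaZl.
have /HS3E[/TS3E T _] := HS3_gy gz.
rewrite (_ : omega (Psi_t _) _ = 0) ?mulr0 ?addr0//.
transitivity (- (gmap z 0 0 * gy z 0 0 + gmap z 0 1 * gy z 0 1 + gmap z 0 2 * gy z 0 2 + gmap z 0 3 * gy z 0 3)).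
  by rewrite /omega !mxE/=; ring.
by rewrite T oppr0.
Qed.

Let nsqN X : nsq (- X : R4) = nsq X.
Proof. by rewrite /nsq !mxE !sqrrN. Qed.

Lemma good_area z : good z ->
  (lam (stereo (hopf (Q z)))) ^+ 2 * nsq (hor z) <= K * ((1 - z.2 ^+ 2) * `|omega (gx z) (gy z)|).
Proof.
move=> gz; have [rz [[df H] dil]] := gz; have [_ y1 y2 _] := rect_bounds rz.
have := push_dilatation lam_bounds J0_cr J1_cr g0_hermitian g1_hermitian (QS rz) (gS rz) (w12_Psi _ _ y1) (ltW K_gt0) H dil.
rewrite push_hP// -[push f (Q z) (hiP (Q z))]opprK -hor_push// nsqN omegaNl omegaZr normrN normrM omega_hor//.
rewrite (ger0_norm (_ : 0 <= 1 - z.2 ^+ 2))// subr_ge0 -real_normK ?num_real//.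
by rewrite expr_le1// ler_norml.
Qed.

(** Twice the constant of [push_lower]: passing from [hP] to [Psi_y] costs the factor (1 - y^2)^2,
    which is at least 1 / 2 for |y| < 1 / 2. *)
Definition qbound : R := 16 * K ^+ 2 * (Lam ^+ 2 + 1) ^+ 2.

Lemma qbound_gt0 : 0 < qbound.
Proof.
have h := sqr_ge0 Lam.
have h1 : 0 < Lam ^+ 2 + 1 by lra.
rewrite /qbound; apply: mulr_gt0; last exact: exprn_gt0.
by apply: mulr_gt0 => //; exact: exprn_gt0.
Qed.

Lemma good_lower z (a b : R) : good z ->
  (a ^+ 2 + b ^+ 2) * (nsq (hor z) + nsq (gy z)) <= qbound * nsq (a *: hor z + b *: gy z).
Proof.
move=> gz; have [rz [[df H] dil]] := gz; have [_ y1 y2 _] := rect_bounds rz.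
have := push_lower lam_bounds J0_cr J1_cr g0_hermitian g1_hermitian (QS rz) (gS rz) (w12_Psi _ _ y1) K_gt0 H dil.
rewrite /= push_hP// -[push f (Q z) (hiP (Q z))]opprK -hor_push// nsqN nsqZ.
set s := 1 - z.2 ^+ 2 => U.
have y4 : z.2 ^+ 2 <= 4^-1.
  have [_ yb] := rz; rewrite -real_normK ?num_real//.
  have : `|z.2| * `|z.2| <= 2^-1 * 2^-1 by apply: ler_pM => //; exact: ltW.
  by rewrite expr2; lra.
have s1 : s <= 1 by rewrite /s; have := sqr_ge0 z.2; lra.
have s34 : 3 / 4 <= s by rewrite /s; lra.
have s0 : 0 < s by lra.
have := U (- a) (b / s); rewrite scalerN scaleNr opprK scalerA divfK ?gt_eqF// sqrrN.
move=> h.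
have X0 := nsq_ge0 (hor z); have Y0 := nsq_ge0 (gy z).
have a2 := sqr_ge0 a; have b2 := sqr_ge0 b.
have bs : b ^+ 2 <= (b / s) ^+ 2.
  rewrite exprMn -[leLHS]mulr1; apply: ler_wpM2l => //.
  by rewrite exprn_ege1// invf_ge1.
have s22 : 2^-1 <= s ^+ 2.
  have : 3 / 4 * (3 / 4) <= s * s by apply: ler_pM; lra.
  by rewrite expr2; lra.
have sY : 2^-1 * nsq (gy z) <= s ^+ 2 * nsq (gy z) by exact: ler_wpM2r.
have : (a ^+ 2 + b ^+ 2) * (2^-1 * (nsq (hor z) + nsq (gy z))) <= (a ^+ 2 + (b / s) ^+ 2) * (nsq (hor z) + s ^+ 2 * nsq (gy z)).
  by apply: ler_pM; lra.
rewrite /qbound; move: h; move: (nsq (_ + _)) ((b / s) ^+ 2) => N B h1 h2.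
by lra.
Qed.

Lemma nsq_HS3 (p X : R4) : S3 p -> HS3 p X -> nsq X = dot X (N1 p) ^+ 2 + dot X (N2 p) ^+ 2.
Proof. by move=> Sp hX; rewrite [in LHS](HS3_coord Sp hX) nsq_dot dot_N// !expr2. Qed.

(** The quotient sees only the horizontal components, which are those of [hor] and [gy], and it does
    not shorten them because |w1| <= 1. *)
Lemma planar_diff z v : good z -> nw1 (gmap z) != 0 -> exists a b,
  has_diff planar z v (a, b) /\ nsq (v.1 *: hor z + v.2 *: gy z) <= a ^+ 2 + b ^+ 2.
Proof.
move=> gz n0; have [rz _] := gz.
have [a [b [hab E]]] := has_diff_quot (v.1 *: gx z + v.2 *: gy z) n0.
exists a, b; split; first exact: (has_diff_comp (good_diff v gz) hab).
have hH : HS3 (gmap z) (v.1 *: hor z + v.2 *: gy z) by apply: HS3_lin; [exact: HS3_hor|exact: HS3_gy].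
have d1 : dot (v.1 *: hor z + v.2 *: gy z) (N1 (gmap z)) = dot (v.1 *: gx z + v.2 *: gy z) (N1 (gmap z)).
  by rewrite /dot /hor !mxE/=; ring.
have d2 : dot (v.1 *: hor z + v.2 *: gy z) (N2 (gmap z)) = dot (v.1 *: gx z + v.2 *: gy z) (N2 (gmap z)).
  by rewrite /dot /hor !mxE/=; ring.
rewrite (nsq_HS3 (gS rz) hH) d1 d2 -E -[leRHS]mulr1; apply: ler_wpM2l.
  by rewrite addr_ge0// sqr_ge0.
have /S3E Sp := gS rz; have h2 := sqr_ge0 (gmap z 0 2); have h3 := sqr_ge0 (gmap z 0 3).
rewrite expr_le1//; first by rewrite /nw1; lra.
by rewrite /nw1 addr_ge0// sqr_ge0.
Qed.

Let zmod_aux (V : zmodType) (A B D : V) : A = (B - D) - (B - (D + A)).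
Proof. by rewrite opprB addrC subrKA addrAC subrr add0r. Qed.

Lemma density_lower (V : set P2) z : open V -> V `<=` rect ->
  (forall w, V w -> nw1 (gmap w) != 0) -> V z -> good z ->
  (((nsq (hor z) + nsq (gy z)) / (8 * qbound))%:E <= area_density planar V z)%E.
Proof.
move=> oV Vr Vn Vz gz; have q0 := qbound_gt0.
set M := nsq _ + nsq _.
have M0 : 0 <= M by rewrite addr_ge0 ?nsq_ge0.
have [->|Mn] := eqVneq M 0; first by rewrite mul0r; exact: area_density_ge0.
have Mp : 0 < M by rewrite lt_neqAle eq_sym Mn.
(* With this [m] the differential of [planar] expands the sup norm by at least 2 m. One m is spent
   on the differentiability error, so by [ball_sub_image] the image of a small ball of radius r
   contains a ball of radius m r. *)
pose m := Num.sqrt (M / (8 * qbound)).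
have mm : m ^+ 2 = M / (8 * qbound) by rewrite sqr_sqrtr// divr_ge0// mulr_ge0// ltW.
have m0 : 0 < m by rewrite sqrtr_gt0 divr_gt0// mulr_gt0.
rewrite -mm.
have [dP _] : has_diff planar z 0 _ := (projT2 (cid (projT2 (cid (planar_diff 0 gz (Vn _ Vz)))))).1.
have lower v : 2 * m * `|v| <= `|'d planar z v|.
  have [a [b [[_ ->] E]]] := planar_diff v gz (Vn _ Vz).
  have L := good_lower v.1 v.2 gz; rewrite -/M in L.
  have nv : `|v| ^+ 2 <= v.1 ^+ 2 + v.2 ^+ 2.
    have h1 := sqr_ge0 v.1; have h2 := sqr_ge0 v.2.
    rewrite prod_normE/=; case: (leP `|v.1| `|v.2|) => _; rewrite real_normK ?num_real//; lra.
  have nab : a ^+ 2 + b ^+ 2 <= 2 * `|(a, b)| ^+ 2.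
    have h1 : `|a| <= `|(a, b)| by rewrite prod_normE/= le_max lexx.
    have h2 : `|b| <= `|(a, b)| by rewrite prod_normE/= le_max lexx orbT.
    have h3 : a ^+ 2 <= `|(a, b)| ^+ 2 by rewrite -(real_normK (num_real a)) ler_pXn2r// nnegrE.
    have h4 : b ^+ 2 <= `|(a, b)| ^+ 2 by rewrite -(real_normK (num_real b)) ler_pXn2r// nnegrE.
    lra.
  rewrite -(@ler_pXn2r _ 2)// ?nnegrE ?mulr_ge0// ?(ltW m0)//.
  rewrite exprMn exprMn mm.
  have h : `|v| ^+ 2 * M <= qbound * (2 * `|(a, b)| ^+ 2).
    apply: le_trans (ler_wpM2r M0 nv) (le_trans L _).
    by apply: ler_wpM2l; [exact: ltW|exact: le_trans E nab].
  have -> : 2 ^+ 2 * (M / (8 * qbound)) * `|v| ^+ 2 = `|v| ^+ 2 * M / (2 * qbound) by field; rewrite gt_eqF.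
  have q2 : 0 < 2 * qbound by exact: mulr_gt0.
  rewrite (ler_pdivrMr _ _ q2); apply: (le_trans h).
  by rewrite mulrCA mulrA mulrC.
have /nbhs_ballP[e1 /= e10 He1] := differentiable_eps dP m0.
have /nbhs_ballP[e2 /= e20 He2] : nbhs z V by exact: open_nbhs_nbhs.
have oF O : open O -> O `<=` V -> open (planar @` O).
  move=> oO OV; apply: (planar_open fS finvS fK finvK cfinv ef oO) => [w /OV /Vr//|w /OV].
  exact: Vn.
have e0 : 0 < Num.min e1 e2 by rewrite lt_min e10.
apply: (le_area_density oV Vz (ltW m0) e0) => r /andP[r0]; rewrite lt_min => /andP[r1 r2].
have sub : ball (planar z) (m * r) `<=` planar @` ball z r.
  apply: (ball_sub_image (V := V)) => //.
  - by move=> w Vw; exact: (planar_continuous cf (Vr _ Vw) (Vn _ Vw)).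
  - move=> w wr; apply: He2; rewrite -ball_normE/= distrC; exact: le_lt_trans r2.
  - move=> w wr.
    have := He1 w; rewrite -ball_normE/= distrC wr => /(_ r1).
    have := lower (w - z); rewrite wr.
    set A := 'd planar z (w - z); set B := planar w; set D := planar z => h1 h2.
    have : `|A| <= `|B - D| + `|B - (D + A)|.
      rewrite [in leLHS](zmod_aux A B D).
      exact: ler_normB.
    by lra.
have mr0 : 0 <= m * r by rewrite mulr_ge0 ?ltW.
apply: (@le_trans _ _ (leb2 (ball (planar z) (m * r)))).
  rewrite leb2_ball// lee_fin; have := sqr_ge0 (m * r); lra.
apply: le_measure; rewrite ?inE//.
  by apply: open_measurable2; exact: ball_open.
apply: open_measurable2; apply: oF; first exact: ball_open.
by move=> w; rewrite -ball_normE/= => wr; apply: He2; rewrite -ball_normE/=; exact: lt_trans r2.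
Qed.

Lemma norm_le_nsq (X : R4) : `|X| <= 1 + nsq X.
Proof.
apply: norm_le_coord; first by rewrite addr_ge0 ?nsq_ge0.
move=> i; have : X 0 i ^+ 2 <= nsq X.
  have -> : nsq X = \sum_j X 0 j ^+ 2 by rewrite sum4.
  by rewrite (bigD1 i)//= lerDl; apply: sumr_ge0 => j _; exact: sqr_ge0.
rewrite -real_normK ?num_real//; move: (`|X 0 i|) => a h.
have E : (a - 1) ^+ 2 = a ^+ 2 - 2 * a + 1 by ring.
by have := sqr_ge0 (a - 1); have := sqr_ge0 a; rewrite E; lra.
Qed.

(** The 2 covers [|X| <= 1 + nsq X] and the vertical part of [gx]; the second term is the constant
    of [density_lower]. *)
Definition cbound : R := 2 + 8 * qbound.

Lemma norm_density (V : set P2) z : open V -> V `<=` rect ->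
  (forall w, V w -> nw1 (gmap w) != 0) -> V z -> good z ->
  ((`|gx z|)%:E <= cbound%:E * (1 + area_density planar V z))%E /\
  ((`|gy z|)%:E <= cbound%:E * (1 + area_density planar V z))%E.
Proof.
move=> oV Vr Vn Vz gz; have q0 := qbound_gt0; have [rz _] := gz.
have := density_lower oV Vr Vn Vz gz; have E0 := area_density_ge0 planar V z.
have X0 := nsq_ge0 (hor z); have Y0 := nsq_ge0 (gy z).
have hx := norm_le_nsq (hor z); have hy := norm_le_nsq (gy z).
have ht : `|Psi_t (gmap z)| <= 2.
  have := norm_le_nsq (Psi_t (gmap z)); have /S3E := gS rz; rewrite /nsq !mxE/= !sqrrN => h; lra.
have hgx : `|gx z| <= 2 + nsq (hor z).
  have -> : gx z = hor z - (z.2 / 2) *: Psi_t (gmap z) by rewrite /hor addrK.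
  apply: (le_trans (ler_normB _ _)); rewrite normrZ.
  have yb : `|z.2 / 2| <= 4^-1.
    by rewrite normrM (ger0_norm (_ : 0 <= 2^-1)) ?invr_ge0//; case: rz => _ /=; lra.
  have : `|z.2 / 2| * `|Psi_t (gmap z)| <= 4^-1 * 2 by apply: ler_pM.
  by lra.
have c0 : 0 <= cbound by rewrite /cbound; lra.
case: (area_density _ _ _) E0 => [E| |] // E0; last first.
  by move=> _; rewrite addey// gt0_muley ?leey ?lte_fin// /cbound; lra.
have q8 : 0 < 8 * qbound by exact: mulr_gt0.
rewrite lee_fin (ler_pdivrMr _ _ q8) => h.
rewrite -EFinD -EFinM !lee_fin; rewrite lee_fin in E0.
have qE : 0 <= qbound * E by exact: mulr_ge0 (ltW q0) E0.
by rewrite /cbound; split; lra.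
Qed.

Section AreaPreserving.
Variable Nb : set P2.
Hypothesis Nb0 : leb2.-negligible Nb.
Hypothesis NbP : forall z, rect z -> ~ Nb z -> good z.

(** The quotient w2 / w1 is unbounded near w1 = 0; keeping [nw1] away from 0 makes the image
    bounded, so that its area is finite. *)
Let V (n : nat) : set P2 := rect `&` [set z | n.+1%:R^-1 < nw1 (gmap z)].

Let openV n : open (V n).
Proof.
rewrite openE => z [rz nz]; apply: filterI; first exact: (open_nbhs_nbhs (conj (@open_rect12 R) rz)).
have cn : {for gmap z, continuous (@nw1 R)}.
  apply: differentiable_continuous.
  have h i := has_diff_coord i (has_diff_id (gmap z) 0).
  by have [] := has_diffD (has_diffM (h 0) (h 0)) (has_diffM (h 1) (h 1)).
have c := continuous_comp (gmap_continuous (ts := ts) cf rz) cn.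
exact: (c _ (open_nbhs_nbhs (conj (@open_gt R n.+1%:R^-1) nz))).
Qed.

Let Vn n w : V n w -> nw1 (gmap w) != 0.
Proof. by move=> [_ /= h]; rewrite gt_eqF//; apply: lt_trans h; rewrite invr_gt0. Qed.

Let Vr n : V n `<=` rect. Proof. by move=> w []. Qed.

Let openF n O : open O -> O `<=` V n -> open (planar @` O).
Proof.
move=> oO OV; apply: (planar_open fS finvS fK finvK cfinv ef oO) => [w /OV /Vr//|w /OV].
exact: Vn.
Qed.

Let boundV n : planar @` V n `<=` ball (0 : P2) n.+2%:R.
Proof.
move=> _ [w Vw <-]; have [rw /= hw] := Vw; have Sp := gS rw.
have E := nw1_quot Sp (Vn Vw); rewrite -/(planar w) in E.
have H : (planar w).1 ^+ 2 + (planar w).2 ^+ 2 < n.+1%:R.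
  have n0 : 0 < nw1 (gmap w) by apply: lt_trans hw; rewrite invr_gt0.
  have -> : (planar w).1 ^+ 2 + (planar w).2 ^+ 2 = (nw1 (gmap w))^-1 - 1.
    apply: (mulfI (lt0r_neq0 n0)); rewrite mulrBr mulr1 mulfV ?gt_eqF//.
    by rewrite -[X in _ = X - _]E; ring.
  rewrite ltrBlDr (lt_trans (_ : _ < n.+1%:R)) ?ltrDl// -[ltRHS]invrK ltf_pV2 ?posrE// invr_gt0//.
have c (a : R) : a ^+ 2 < n.+1%:R -> `|a| < n.+2%:R.
  move=> h; rewrite ltNge; apply/negP => h2.
  have : n.+2%:R * n.+2%:R <= `|a| * `|a| by apply: ler_pM.
  rewrite -expr2 -[X in _ <= X -> _]expr2 real_normK ?num_real// => h3.
  have : (n.+1%:R : R) <= n.+2%:R ^+ 2.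
    by rewrite -natrX ler_nat (leq_trans (leqnSn _))// leq_pmulr.
  by move=> h4; have := le_lt_trans (le_trans h4 h3) h; rewrite ltxx.
move: (planar w) H => p H.
rewrite -ball_normE/= sub0r normrN prod_normE/= gt_max.
have h1 := sqr_ge0 p.1; have h2 := sqr_ge0 p.2.
by rewrite !c//; lra.
Qed.

Let finite_density n : leb2.-negligible [set z | ~ (area_density planar (V n) z < +oo)%E].
Proof.
have oF := @openF n.
have mE := measurable_area_density (@openV n) oF.
have fb : (4%:E * leb2 (planar @` V n) < +oo)%E.
  apply: (@le_lt_trans _ _ (4%:E * leb2 (ball (0%R : P2) (n.+2%:R : R)))%E).
    apply: lee_wpmul2l => //; apply: le_measure; rewrite ?inE.
    - by apply: open_measurable2; exact: oF.
    - by apply: open_measurable2; exact: ball_open.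
    - exact: boundV.
  by rewrite leb2_ball// -EFinM ltry.
have iF : {in (V n : set P2) &, injective planar}.
  move=> w w'; rewrite !inE => Vw Vw' E.
  exact: (planar_inj fS fK ef (Vr Vw') (Vr Vw) (Vn Vw') (Vn Vw) (esym E)).
have fin := le_lt_trans (integral_area_density (@openV n) iF oF) fb.
have int : leb2.-integrable setT (area_density planar (V n)).
  apply/integrableP; split => //.
  under eq_integral do rewrite gee0_abs ?area_density_ge0//.
  exact: fin.
have := integrable_ae (measurableT) int; apply: negligibleS => z /= nz H; apply: nz.
have := H I; have := area_density_ge0 planar (V n) z.
by case: area_density => // x _ _; rewrite ltry.
Qed.

Let negligible_subsingleton (A : set P2) : (forall z z', A z -> A z' -> z' = z) -> leb2.-negligible A.
Proof.
move=> H; have [->|/set0P[z Az]] := eqVneq A set0; first exact: negligible_set0.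
exists ([set z.1] `*` setT); split.
- by apply: measurableX.
- rewrite [LHS]product_measure1E//= lebesgue_measure_set1 mul0e//.
- by move=> w Aw; rewrite (H z w Az Aw).
Qed.

Lemma is_derive_row z : good z -> forall i, is_derive z.1 1 (fun t => gmap (t, z.2) 0 i) (gx z 0 i).
Proof.
move=> gz i; apply: has_diff_is_derive.
have h : has_diff (fun t : R => (t, z.2)) z.1 1 (1, 0) := has_diff_pair (has_diff_id _ _) (has_diff_cst _ _ _).
have hg : has_diff gmap (z.1, z.2) (1, 0) (gx z).
  by rewrite -surjective_pairing; apply: (has_diff_eq (good_diff _ gz)); rewrite scale1r scale0r addr0.
exact: has_diff_coord (has_diff_comp h hg).
Qed.

Lemma is_derive_col z : good z -> forall i, is_derive z.2 1 (fun t => gmap (z.1, t) 0 i) (gy z 0 i).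
Proof.
move=> gz i; apply: has_diff_is_derive.
have h : has_diff (fun t : R => (z.1, t)) z.2 1 (0, 1) := has_diff_pair (has_diff_cst _ _ _) (has_diff_id _ _).
have hg : has_diff gmap (z.1, z.2) (0, 1) (gy z).
  by rewrite -surjective_pairing; apply: (has_diff_eq (good_diff _ gz)); rewrite scale1r scale0r add0r.
exact: has_diff_coord (has_diff_comp h hg).
Qed.

Lemma area_preserving_ae : exists2 N, leb2.-negligible N &
  forall z, rect z -> ~ N z -> good z /\ omega (gx z) (gy z) = 4^-1.
Proof.
pose Z := rect `&` [set z | nw1 (gmap z) = 0].
(* Three exceptional sets: the bad points, the single possible zero of w1 and the points of infinite
   density for some [V n]. *)
exists ((Nb `|` Z) `|` \bigcup_n [set z | ~ (area_density planar (V n) z < +oo)%E]).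
  apply: negligibleU; first apply: negligibleU => //.
    apply: negligible_subsingleton => z z' [rz nz] [rz' nz'].
    exact: (nw1_zero_unique fS fK ef rz rz' nz nz').
  by apply: negligible_bigcup => n; exact: finite_density.
move=> z rz nN.
have gz : good z by apply: NbP => // Nz; apply: nN; left; left.
split => //.
have n0 : 0 < nw1 (gmap z).
  rewrite lt_neqAle eq_sym; apply/andP; split; last by rewrite addr_ge0 ?sqr_ge0.
  by apply/eqP => h; apply: nN; left; right.
have [n Vz] : exists n, V n z.
  have [n _ hn] := near_infty_natSinv_lt (PosNum n0).
  by exists n; split => //; exact: (hn n (leqnn n)).
have /nbhs_ballP[r0 /= r00 rV] : nbhs z (V n) by exact: (open_nbhs_nbhs (conj (@openV n) Vz)).
have bn w : ball z r0 w -> nw1 (gmap w) != 0 by move=> /rV; exact: Vn.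
have br : ball z r0 `<=` rect by move=> w /rV; exact: Vr.
have Efin : (area_density planar (ball z r0) z < +oo)%E.
  rewrite (area_density_local planar (ball_open z r0) rV (ballxx z r00)).
  by apply: contrapT => h; apply: nN; right; exists n.
have Nb0' : (@lebesgue_measure R \x @lebesgue_measure R)%E.-negligible Nb := Nb0.
(* The rows, and likewise the columns in [Nx], that meet the bad points in a set of positive measure
   or along which absolute continuity fails. *)
pose Ny := [set y | ~ (@lebesgue_measure R).-negligible (ysection Nb y)] `|`
  [set y | `|y| < 2^-1 /\ ~ forall s1 s2, -1 <= s1 -> s2 <= 1 -> abs_continuous s1 s2 (fun x => gmap (x, y))].
pose Nx := [set x | ~ (@lebesgue_measure R).-negligible (xsection Nb x)] `|`
  [set x | `|x| < 1 /\ ~ forall s1 s2, -2^-1 <= s1 -> s2 <= 2^-1 -> abs_continuous s1 s2 (fun y => gmap (x, y))].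
have Ny0 : (@lebesgue_measure R).-negligible Ny.
  by apply: negligibleU; [exact: negligible_ysection Nb0'|exact: (gmap_rows x0 ts fS ef acl)].
have Nx0 : (@lebesgue_measure R).-negligible Nx.
  by apply: negligibleU; [exact: negligible_xsection Nb0'|exact: (gmap_cols x0 ts fS ef acl)].
have c0 : 0 <= cbound by rewrite /cbound addr_ge0// mulr_ge0// ltW// qbound_gt0.
apply: (@area_preserving_at R planar gmap z (gx z) (gy z) r0 cbound Nx Ny) => //.
- move=> w w'; rewrite !inE => bw bw' E.
  exact: (planar_inj fS fK ef (br _ bw') (br _ bw) (bn _ bw') (bn _ bw) (esym E)).
- by move=> O oO OV; apply: (@openF n _ oO) => w Ow; exact: rV (OV _ Ow).
- by move=> e e0; exact: good_eps.
- move=> y s1 s2 nNy yz h1 s12 h2.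
  have bs s : s1 <= s -> s <= s2 -> ball z r0 (s, y).
    move=> ss1 ss2; rewrite -ball_normE/= prod_normE/= gt_max; apply/andP; split.
      by rewrite ltr_norml; apply/andP; split; lra.
    by rewrite distrC.
  have [] := br _ (bs s1 (lexx _) s12); have [] := br _ (bs s2 s12 (lexx _)); rewrite /= !ltr_norml.
  move=> /andP[_ q2] _ /andP[q1 _] yb.
  split.
    apply: contrapT => nac; apply: nNy; right; split; first by rewrite /= ltr_norml.
    by move=> H; apply: nac; apply: H; lra.
  have neg : (@lebesgue_measure R).-negligible (ysection Nb y).
    by apply: contrapT => h; apply: nNy; left.
  apply: negligibleS neg => s [/andP[ss1 ss2] H].
  rewrite /ysection/= inE; apply: contrapT => nNs; apply: H.
  have bsy := bs _ ss1 ss2; have rsy := br _ bsy; have gsy := NbP rsy nNs.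
  have [D1 _] := norm_density (ball_open z r0) br bn bsy gsy.
  exists (gx (s, y)); split => //.
  + exact: (is_derive_row gsy).
  + exact: (good_omega_x gsy).
- move=> x s1 s2 nNx xz h1 s12 h2.
  have bs s : s1 <= s -> s <= s2 -> ball z r0 (x, s).
    move=> ss1 ss2; rewrite -ball_normE/= prod_normE/= gt_max; apply/andP; split.
      by rewrite distrC.
    by rewrite ltr_norml; apply/andP; split; lra.
  have [xb] := br _ (bs s1 (lexx _) s12); have [_] := br _ (bs s2 s12 (lexx _)); rewrite /= !ltr_norml.
  move=> /andP[_ q2] /andP[q1 _].
  split.
    apply: contrapT => nac; apply: nNx; right; split; first exact: xb.
    by move=> H; apply: nac; apply: H; lra.
  have neg : (@lebesgue_measure R).-negligible (xsection Nb x).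
    by apply: contrapT => h; apply: nNx; left.
  apply: negligibleS neg => s [/andP[ss1 ss2] H].
  rewrite /xsection/= inE; apply: contrapT => nNs; apply: H.
  have bsy := bs _ ss1 ss2; have rsy := br _ bsy; have gsy := NbP rsy nNs.
  have [_ D2] := norm_density (ball_open z r0) br bn bsy gsy.
  exists (gy (x, s)); split => //.
  + exact: (is_derive_col gsy).
  + exact: (good_omega_y gsy).
Qed.

Lemma hor_bound : exists2 N, leb2.-negligible N &
  forall z, rect z -> ~ N z -> good z /\ (lam (stereo (hopf (Q z)))) ^+ 2 * nsq (hor z) <= K / 4.
Proof.
have [N N0 H] := area_preserving_ae; exists N => // z rz nz.
have [gz oz] := H z rz nz; split => //.
apply: (le_trans (good_area gz)); rewrite oz ger0_norm ?invr_ge0//.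
rewrite ler_pM2l// -[leRHS]mul1r ler_pM2r ?invr_gt0//.
by have := sqr_ge0 z.2; lra.
Qed.

End AreaPreserving.
End GoodPoints.

(** * The lower bound on the dilatation *)

Section Equator.
Context {R : realType}.
Local Notation R4 := 'rV[R]_4.
Local Notation P2 := (R * R)%type.

Lemma dotBl (X Y Z : R4) : dot (X - Y) Z = dot X Z - dot Y Z.
Proof. by rewrite /dot !mxE; ring. Qed.

Lemma abs_dot_le (X Z : R4) : `|dot X Z| <= (4 * `|Z|) * `|X|.
Proof.
have h i : `|X 0 i * Z 0 i| <= `|Z| * `|X|.
  by rewrite normrM mulrC; apply: ler_pM => //; exact: le_coord_norm.
have := h 0; have := h 1; have := h 2; have := h 3; rewrite /dot.
move: (X 0 0 * _) (X 0 1 * _) (X 0 2 * _) (X 0 3 * _) => p q r s; rewrite !ler_norml.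
move=> /andP[? ?] /andP[? ?] /andP[? ?] /andP[? ?]; apply/andP; split; lra.
Qed.

(** Projecting onto the chord [w = g b - g a] reduces to a real function of slope at most C |w|.
    This gives the Euclidean constant [C], which coordinatewise estimates would lose. *)
Lemma lipschitz_of_speed (g : R -> R4) (a b C : R) : a <= b -> 0 <= C -> abs_continuous a b g ->
  (@lebesgue_measure R).-negligible [set t | a <= t <= b /\
     ~ exists D : R4, (forall i, is_derive t 1 (fun s => g s 0 i) (D 0 i)) /\ nsq D <= C ^+ 2] ->
  nsq (g b - g a) <= (C * (b - a)) ^+ 2.
Proof.
move=> ab C0 ac neg.
set w := g b - g a; pose m := Num.sqrt (nsq w).
have mm : m ^+ 2 = nsq w by rewrite sqr_sqrtr// nsq_ge0.
have m0 : 0 <= m by rewrite sqrtr_ge0.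
pose h s := dot (g s) w - C * m * s.
have ach : abs_continuous a b h.
  apply: (abs_continuous_dominated ac (@abs_continuous_id R a b) (k := 4 * `|w| + C * m)) => s t _ st _.
  have -> : h t - h s = dot (g t - g s) w - C * m * (t - s) by rewrite /h dotBl; ring.
  apply: (le_trans (ler_normB _ _)); rewrite normrM (ger0_norm (mulr_ge0 C0 m0)).
  have h1 := abs_dot_le (g t - g s) w.
  have p1 : 0 <= 4 * `|w| * `|t - s| by rewrite !mulr_ge0.
  have p2 : 0 <= C * m * `|g t - g s| by rewrite !mulr_ge0.
  have -> : (4 * `|w| + C * m) * (`|g t - g s| + `|t - s|) =
    4 * `|w| * `|g t - g s| + 4 * `|w| * `|t - s| + C * m * `|g t - g s| + C * m * `|t - s| by ring.
  by lra.
have hba : h b <= h a.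
  apply: (abs_continuous_nonincreasing ab ach); apply: negligibleS neg => t [tab nD]; split => // -[D [dD DC]].
  apply: nD => e e0.
  have dh : is_derive t 1 h (dot D w - C * m).
    have hc i : has_diff (fun s : R => g s 0 i) t 1 (D 0 i).
      exact: is_derive_diff.
    have hm i : has_diff (fun s : R => g s 0 i * w 0 i) t 1 (D 0 i * w 0 i).
      apply: has_diff_eq (has_diffM (hc i) (has_diff_cst (w 0 i) t 1)) _.
      by rewrite mulr0 addr0.
    apply: has_diff_is_derive.
    have hl := has_diffM (has_diff_cst (C * m) t 1) (has_diff_id t (1 : R)).
    apply: has_diff_eq (has_diffD (has_diffD (has_diffD (has_diffD (hm 0) (hm 1)) (hm 2)) (hm 3)) (has_diffN hl)) _.
    by rewrite mul0r add0r mulr1.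
  apply: (is_derive_slope_le dh _ e0).
  rewrite subr_le0; apply: le_trans (ler_norm _) _.
  rewrite -(@ler_pXn2r _ 2)// ?nnegrE ?mulr_ge0// real_normK ?num_real//.
  apply: (le_trans (dot_sqr_le _ _)); rewrite exprMn mm.
  by apply: ler_wpM2r => //; exact: nsq_ge0.
have ww : m ^+ 2 <= m * (C * (b - a)).
  have E : nsq w = dot (g b) w - dot (g a) w by rewrite -dotBl nsq_dot.
  by rewrite mm E; move: hba; rewrite /h; lra.
have Cab : 0 <= C * (b - a) by rewrite mulr_ge0// subr_ge0.
rewrite -mm ler_pXn2r// ?nnegrE//.
have [->|mn] := eqVneq m 0 => //.
have mp : 0 < m by rewrite lt_neqAle eq_sym mn.
by rewrite -(ler_pM2l mp) -expr2.
Qed.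

(** The point of the unit sphere of longitude x and height y: the factor 2 hopf_rad(y) hopf_rad(-y)
    is sqrt (1 - y^2). *)
Definition latlong (x y : R) : 'rV[R]_3 :=
  \row_k [:: 2 * (hopf_rad y * hopf_rad (- y)) * cos x; 2 * (hopf_rad y * hopf_rad (- y)) * sin x; y]`_k.

Lemma stereo_hopf_Psi (x y t : R) : -1 < y < 1 -> stereo (hopf (Psi x y t)) = latlong x y.
Proof.
move=> /andP[y1 y2].
have r0 := rad_gt0 y1.
have y2' : -1 < - y by lra.
have s0 := rad_gt0 y2'.
have r2 := rad_sqr (ltW y1); have s2 := rad_sqr (ltW y2').
set r := hopf_rad y in r0 r2 *; set s := hopf_rad (- y) in s0 s2 *.
have w1n : w1 (Psi x y t) != 0.
  have := w12_Psi x t (_ : -1 < y < 1); rewrite y1 y2 => /(_ isT).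
  by rewrite mulf_eq0 negb_or => /andP[].
have E : w2 (Psi x y t) / w1 (Psi x y t) = ((s / r * cos x) +i* (s / r * sin x))%C.
  apply: (canLR (mulfK w1n)); rewrite /w1 /w2 !mxE/= -/r -/s.
  have e : t + x / 2 = (t - x / 2) + x by field.
  have mulC (p q p' q' : R) : (p +i* q)%C * (p' +i* q')%C = ((p * p' - q * q') +i* (p * q' + q * p'))%C by [].
  by rewrite e (cosD _ x) (sinD _ x) mulC; congr (_ +i* _)%C; field; rewrite gt_eqF.
rewrite /hopf (negbTE w1n) E /stereo.
have cs := cos2Dsin2 x.
have D : 1 + (s / r * cos x) ^+ 2 + (s / r * sin x) ^+ 2 = (r ^+ 2)^-1.
  transitivity (1 + (s / r) ^+ 2 * (cos x ^+ 2 + sin x ^+ 2)); first by ring.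
  rewrite cs mulr1; apply: (mulIf (lt0r_neq0 (exprn_gt0 2 r0))); rewrite mulVf ?gt_eqF ?exprn_gt0//.
  transitivity (r ^+ 2 + s ^+ 2); first by field; rewrite gt_eqF.
  by rewrite r2 s2; field.
rewrite D invrK; apply/rowP => -[[|[|[|//]]]] i; rewrite !mxE/=.
- by rewrite -/r -/s; field; rewrite gt_eqF.
- by rewrite -/r -/s; field; rewrite gt_eqF.
- transitivity (r ^+ 2 - s ^+ 2 * (cos x ^+ 2 + sin x ^+ 2)); first by field; rewrite gt_eqF.
  by rewrite cs r2 s2; field.
Qed.

Lemma latlong0 (x : R) : latlong x 0 = spherical (pi / 2) x.
Proof.
have r : hopf_rad (0 : R) * hopf_rad 0 = 2^-1 by rewrite -expr2 rad_sqr; [rewrite addr0 mul1r|lra].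
apply/rowP => -[[|[|[|//]]]] i; rewrite !mxE/= ?sin_pihalf ?cos_pihalf// oppr0 r mulfV// ?pnatr_eq0//.
Qed.

Lemma latlong_continuous (x0 : R) (z : P2) : -1 < z.2 < 1 -> {for z, continuous (fun z : P2 => latlong (x0 + z.1) z.2)}.
Proof.
move=> /andP[y1 y2]; apply: differentiable_continuous.
have h1 : has_diff (fun z : P2 => z.1) z 0 0 by have [d E] := diff_fst z; split => //; rewrite E.
have h2 : has_diff (fun z : P2 => z.2) z 0 0 by have [d E] := diff_snd z; split => //; rewrite E.
have y2' : -1 < - z.2 by lra.
have hx := has_diffD (has_diff_cst x0 z 0) h1.
have hr := has_diffM (has_diff_cst (2 : R) z 0) (has_diffM (has_diff_rad y1 h2) (has_diff_rad (y := fun w : P2 => - w.2) y2' (has_diffN h2))).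
have hc := has_diffM hr (has_diff_cos hx); have hs := has_diffM hr (has_diff_sin hx).
pose F (i : 'I_3) (w : P2) := [:: 2 * (hopf_rad w.2 * hopf_rad (- w.2)) * cos (x0 + w.1);
   2 * (hopf_rad w.2 * hopf_rad (- w.2)) * sin (x0 + w.1); w.2]`_i.
suff H i : exists d, has_diff (F i) z 0 d.
  have [d _] := has_diff_row (fun i => projT2 (cid (H i))); exact: d.
case: i => -[|[|[|//]]] i; rewrite /F /=.
- by eexists; exact: hc.
- by eexists; exact: hs.
- by eexists; exact: h2.
Qed.

End Equator.

Section LowerBound.
Context {R : realType}.
Local Notation R4 := 'rV[R]_4.
Local Notation P2 := (R * R)%type.
Variables (lam : 'rV[R]_3 -> R) (Lam K : R).
Variables (J0 J1 g0 g1 : R4 -> 'M[R]_4) (f finv : R4 -> R4).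
Hypothesis lam_smooth : sphere_smooth lam.
Hypothesis Lam_gt1 : 1 < Lam.
Hypothesis lam_bounds : forall x, S2 x -> 1 <= lam x <= Lam.
Hypothesis lam_equator : forall phi, lam (spherical (pi / 2) phi) = Lam.
Hypothesis J0_cr : complex_structure W0bar J0.
Hypothesis J1_cr : complex_structure (W1bar lam) J1.
Hypothesis g0_hermitian : hermitian_metric J0 g0.
Hypothesis g1_hermitian : hermitian_metric J1 g1.
Hypothesis K_gt0 : 0 < K.
Hypothesis fS : forall q, S3 q -> S3 (f q).
Hypothesis finvS : forall q, S3 q -> S3 (finv q).
Hypothesis fK : forall q, S3 q -> finv (f q) = q.
Hypothesis finvK : forall q, S3 q -> f (finv q) = q.
Hypothesis cf : {within S3, continuous f}.
Hypothesis cfinv : {within S3, continuous finv}.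
Hypothesis ef : equivariant f.
Hypothesis acl : ACL f.
Hypothesis df : ae_S3 (fun q => differentiable_S3 f q /\
               forall X, HS3 q X -> HS3 (f q) (push f q X)).
Hypothesis dilf : ae_S3 (fun q => (dilatation g1 g0 f q <= K%:E)%E).

(** Fubini in the box chart: for almost every t the bad points of the slice form a null set of (x,
    y). *)
Lemma good_slice (x0 : R) : exists ts : R, exists2 Nb, leb2.-negligible Nb &
  forall z, rect z -> ~ Nb z -> good f x0 ts K g0 g1 z.
Proof.
have lp := chart_local_param (Psi_chart x0).
pose A (P : R4 -> Prop) : set (R * R * R) :=
  box3 `&` (fun u : R * R * R => Psi (x0 + u.1.1) u.1.2 u.2) @^-1` [set q | S3 q /\ ~ P q].
have sec P : ae_S3 P -> (@lebesgue_measure R).-negligible [set t | ~ leb2.-negligible (ysection (A P) t)].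
  by move=> aP; exact: (negligible_ysection (m1 := leb2) (m2 := @lebesgue_measure R) (aP _ _ lp)).
have n1 := sec _ df; have n2 := sec _ dilf.
have e8 : - 8^-1 < 8^-1 :> R by lra.
have [ts [tsb nts]] := negligible_not_itv e8 (negligibleU n1 n2); exists ts.
move: nts => /not_orP[/contrapT m1 /contrapT m2].
refine (ex_intro2 _ _ _ (negligibleU m1 m2) _) => z rz nz.
have [_ _ y1 _] := rect_bounds rz.
have Bz : box3 (z, ts) by split => //=; rewrite ltr_norml.
have SQ : S3 (Psi (x0 + z.1) z.2 ts) by exact: Psi_S3.
split => //; split.
  by apply: contrapT => h; apply: nz; left; rewrite /ysection/= inE; split.
by apply: contrapT => h; apply: nz; right; rewrite /ysection/= inE; split.
Qed.

Lemma lam_latlong_continuous (x0 : R) (z : P2) : -1 < z.2 < 1 ->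
  {for z, continuous (fun z : P2 => lam (latlong (x0 + z.1) z.2))}.
Proof.
move=> zb; have S2l (w : P2) : -1 < w.2 < 1 -> S2 (latlong (x0 + w.1) w.2).
  by move=> h; rewrite -(stereo_hopf_Psi _ 0 h); exact: stereo_S2.
have c : {for z, continuous ((lam \o @retr R 3) \o (fun z : P2 => latlong (x0 + z.1) z.2))}.
  apply: continuous_comp; first exact: latlong_continuous.
  apply: (lam_smooth 0%N) => /= h; have := S2l z zb; rewrite /S2 /sphere/= h big1; last by move=> i _; rewrite mxE expr0n.
  by move/esym/eqP; rewrite oner_eq0.
have E (w : P2) : -1 < w.2 < 1 -> ((lam \o @retr R 3) \o (fun z : P2 => latlong (x0 + z.1) z.2)) w = lam (latlong (x0 + w.1) w.2).
  by move=> h; have Sw : \sum_i _ = 1 := S2l w h; rewrite /= /retr Sw sqrtr1 invr1 scale1r.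
rewrite /prop_for /continuous_at -(E z zb).
have o2 : {for z, continuous (fun w : P2 => w.2)} by exact: cvg_snd.
have /andP[z1 z2] := zb.
have A := o2 _ (open_nbhs_nbhs (conj (@open_gt R (-1)) z1)).
have B := o2 _ (open_nbhs_nbhs (conj (@open_lt R 1) z2)).
apply: cvg_trans c; apply: near_eq_cvg.
have AB : nbhs z ((fun w : P2 => w.2) @^-1` [set x | -1 < x] `&` (fun w : P2 => w.2) @^-1` [set x | x < 1]) by exact: filterI.
change (nbhs z [set w | ((lam \o @retr R 3) \o (fun z : P2 => latlong (x0 + z.1) z.2)) w = lam (latlong (x0 + w.1) w.2)]).
apply: filterS AB => w [w1 w2].
by apply: E; apply/andP; split.
Qed.

(** Pythagoras: [omega (gmap z) h] is the scalar product of [h] with [Psi_t (gmap z)], and it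
    vanishes on the horizontal vector [hor z]. *)
Lemma nsq_gx (x0 ts : R) z : good f x0 ts K g0 g1 z ->
  nsq (gx f x0 ts z) = nsq (hor f x0 ts z) + z.2 ^+ 2 / 4.
Proof.
move=> gz; have [rz _] := gz; have Sg := gmap_S3 x0 ts fS rz.
have /HS3E[_ w0] := HS3_hor ef gz.
have -> : gx f x0 ts z = hor f x0 ts z - (z.2 / 2) *: Psi_t (gmap f x0 ts z) by rewrite /hor addrK.
have t1 : nsq (Psi_t (gmap f x0 ts z)) = 1.
  by move: Sg => /S3_nsq <-; rewrite /nsq !mxE/= !sqrrN; ring.
move: (hor _ _ _ _) w0 => h w0.
transitivity (nsq h - z.2 * omega (gmap f x0 ts z) h + (z.2 / 2) ^+ 2 * nsq (Psi_t (gmap f x0 ts z))).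
  by rewrite /nsq /omega !mxE/=; field.
by rewrite w0 t1; field.
Qed.

(** The room in [K / 4 < C ^+ 2 * Lam ^+ 2] lets the speed bound hold on almost all rows near the
    equator, where lam is close to [Lam]; the row y = 0 is then reached by continuity. *)
Lemma slice_lipschitz (x0 ts C : R) (Nb : set P2) : 0 <= C -> K / 4 < C ^+ 2 * Lam ^+ 2 ->
  leb2.-negligible Nb -> (forall z, rect z -> ~ Nb z -> good f x0 ts K g0 g1 z) ->
  exists2 e, 0 < e & forall s1 s2, -e < s1 -> s1 <= s2 -> s2 < e ->
    nsq (gmap f x0 ts (s2, 0) - gmap f x0 ts (s1, 0)) <= (C * (s2 - s1)) ^+ 2.
Proof.
move=> C0 CK Nb0 NbP.
have [N N0 NP] := hor_bound fS finvS fK finvK cf cfinv ef acl lam_bounds J0_cr J1_cr g0_hermitian g1_hermitian K_gt0 Nb0 NbP.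
pose L (z : P2) := lam (latlong (x0 + z.1) z.2).
(* [K / 4 < ph z] is exactly what converts the bound of [hor_bound] into [nsq (gx z) <= C ^+ 2],
   given [nsq_gx]. *)
pose ph (z : P2) := (C ^+ 2 - z.2 ^+ 2 / 4) * L z ^+ 2.
have z0b : -1 < ((0 : P2).2 : R) < 1 by rewrite /=; apply/andP; split; lra.
have cL := lam_latlong_continuous (x0 := x0) z0b.
have cph : {for (0 : P2), continuous ph}.
  have c2 : {for (0 : P2), continuous (fun w : P2 => w.2 : R)} by exact: cvg_snd.
  apply: cvgM; last by apply: cvgM; exact: cL.
  apply: cvgB; first exact: cvg_cst.
  by apply: cvgM; [apply: cvgM; exact: c2|exact: cvg_cst].
have ph0 : K / 4 < ph 0.
  by rewrite /ph /L /= expr0n /= mul0r subr0 addr0 latlong0 lam_equator.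
have /nbhs_ballP[e /= e0 He] := cph _ (open_nbhs_nbhs (conj (@open_gt R (K / 4)) ph0)).
pose r := Num.min e (2^-1).
have r0 : 0 < r by rewrite /r lt_min e0 invr_gt0/= ltr0n.
have [re r2] : r <= e /\ r <= 2^-1 by split; rewrite /r ge_min lexx ?orbT.
have rr (z : P2) : `|z.1| < r -> `|z.2| < r -> rect z by move=> h1 h2; split; lra.
have speed z : `|z.1| < r -> `|z.2| < r -> ~ N z -> good f x0 ts K g0 g1 z /\ nsq (gx f x0 ts z) <= C ^+ 2.
  move=> h1 h2 nz; have rz := rr z h1 h2; have [gz] := NP z rz nz; split => //.
  have [_ yb yb' _] := rect_bounds rz.
  have Sl : S2 (latlong (x0 + z.1) z.2) by rewrite -(stereo_hopf_Psi _ ts yb); exact: stereo_S2.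
  move: b; rewrite (stereo_hopf_Psi _ ts yb) -/(L z) (nsq_gx gz) => b.
  have L1 : 1 <= L z by have /andP[] := lam_bounds Sl.
  have L0 : 0 < L z ^+ 2 by rewrite exprn_gt0//; exact: lt_le_trans L1.
  have : ball (0 : P2) e z by rewrite -ball_normE/= sub0r normrN prod_normE/= gt_max; apply/andP; split; lra.
  move=> /He; rewrite /= /ph => b2.
  by rewrite -(ler_pM2l L0); lra.
exists r => // s1 s2 h1 h12 h2.
have rows := gmap_rows x0 ts fS ef acl.
have sec := negligible_ysection N0.
have Y (d : R) : 0 < d -> exists2 y, 0 < y < d &
    nsq (gmap f x0 ts (s2, y) - gmap f x0 ts (s1, y)) <= (C * (s2 - s1)) ^+ 2.
  move=> d0; have m0 : 0 < Num.min d r by rewrite lt_min d0.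
  have [y [/andP[y0]]] := negligible_not_itv m0 (negligibleU rows sec).
  rewrite lt_min => /andP[yd yr] ny; exists y; first by rewrite y0.
  have yn : `|y| < r by rewrite gtr0_norm.
  have ac : abs_continuous s1 s2 (fun x => gmap f x0 ts (x, y)).
    apply: contrapT => nac; apply: ny; left; split; first by rewrite /=; lra.
    by move=> H; apply: nac; apply: H; lra.
  have neg : (@lebesgue_measure R).-negligible (ysection N y).
    by apply: contrapT => h; apply: ny; right.
  apply: (lipschitz_of_speed h12 C0 ac); apply: negligibleS neg => s [/andP[ss1 ss2] H].
  rewrite /ysection/= inE; apply: contrapT => nN; apply: H.
  have sn : `|s| < r by rewrite ltr_norml; apply/andP; split; lra.
  have [gz sp] := speed (s, y) sn yn nN.
  by exists (gx f x0 ts (s, y)); split => //; exact: (is_derive_row gz).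
have rs s : -r < s -> s < r -> rect (s, 0).
  by move=> a b; apply: rr; rewrite /= ?normr0// ltr_norml a.
have cs s : -r < s -> s < r -> {for (0 : R), continuous (fun y => gmap f x0 ts (s, y))}.
  move=> a b; apply: (@continuous_comp _ _ _ (fun y : R => (s, y))); last exact: (gmap_continuous cf (rs s a b)).
  apply: differentiable_continuous.
  by have [] := has_diff_pair (has_diff_cst s 0 0) (has_diff_id (0 : R) (0 : R)).
have cd : {for (0 : R), continuous (fun y => nsq (gmap f x0 ts (s2, y) - gmap f x0 ts (s1, y)))}.
  apply: (@continuous_comp _ _ _ (fun y : R => gmap f x0 ts (s2, y) - gmap f x0 ts (s1, y)) (@nsq R)).
    by apply: cvgB; apply: cs; lra.
  apply: differentiable_continuous.
  by have [] := has_diff_nsq (has_diff_id (gmap f x0 ts (s2, 0) - gmap f x0 ts (s1, 0)) 0).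
(* A strict violation at y = 0 would persist for all small y, against [Y]. *)
rewrite leNgt; apply/negP => lt.
have /nbhs_ballP[d /= d0 Hd] := cd _ (open_nbhs_nbhs (conj (@open_gt R ((C * (s2 - s1)) ^+ 2)) lt)).
have [y /andP[y0 yd] hy] := Y d d0.
have := Hd y; rewrite -ball_normE/= sub0r normrN gtr0_norm// => /(_ yd).
by rewrite ltNge hy.
Qed.

Lemma nsq_circle (phi : R) (p q : R4) : nsq (circle_act phi p - circle_act phi q) = nsq (p - q).
Proof.
transitivity ((cos phi ^+ 2 + sin phi ^+ 2) * nsq (p - q)); last by rewrite cos2Dsin2 mul1r.
by rewrite !circle_actE /nsq !mxE/=; ring.
Qed.

Lemma Lam_sqr_le : Lam ^+ 2 <= K.
Proof.
have Lam0 : 0 < Lam by apply: lt_trans Lam_gt1.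
pose r := Num.sqrt K.
have rK : r ^+ 2 = K by rewrite sqr_sqrtr// ltW.
have r0 : 0 <= r by rewrite sqrtr_ge0.
rewrite leNgt; apply/negP => KL.
have rL : r < Lam by rewrite -(@ltr_pXn2r _ 2)// ?nnegrE ?(ltW Lam0)// rK.
(* Halfway between sqrt K / (2 Lam) and 1 / 2. *)
pose C := (r + Lam) / (4 * Lam).
have CL : C * Lam = (r + Lam) / 4 by rewrite /C; field; rewrite gt_eqF.
have C0 : 0 <= C by rewrite divr_ge0// ?addr_ge0 ?mulr_ge0// ltW.
have C2 : C < 2^-1 by rewrite -(ltr_pM2r Lam0) CL; lra.
suff : 2^-1 <= C by rewrite leNgt C2.
have CK : K / 4 < C ^+ 2 * Lam ^+ 2.
  rewrite -exprMn CL -rK.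
  have : r ^+ 2 < ((r + Lam) / 2) ^+ 2 by rewrite ltr_pXn2r// ?nnegrE//; lra.
  have -> : ((r + Lam) / 4) ^+ 2 = ((r + Lam) / 2) ^+ 2 / 4 by field.
  by lra.
have y01 : -1 <= (0 : R) <= 1 by apply/andP; split; lra.
apply: (@antipodal_lipschitz R (fun x => f (Psi x 0 0)) C C0) => [x||x0 _].
- by apply/S3_nsq; apply: fS; exact: Psi_S3.
(* Adding 2 pi to x multiplies w1 by e^(- i pi) and w2 by e^(i pi), both equal to -1, which is the
   circle action at angle pi. *)
- have -> : Psi (2 * pi) 0 0 = Psi 0 0 (pi + 0) :> R4.
    have e1 : 0 - 2 * pi / 2 = - pi :> R by field.
    have e2 : 0 + 2 * pi / 2 = pi :> R by field.
    have e3 : pi + 0 - 0 / 2 = pi :> R by field.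
    have e4 : pi + 0 + 0 / 2 = pi :> R by field.
    by apply: row4P; rewrite !mxE/= ?e1 ?e2 ?e3 ?e4 ?cosN ?sinN ?sinpi ?oppr0.
  rewrite f_shift// circle_actE cospi sinpi.
  by apply: row4P; rewrite !mxE/= mul0r ?subr0 ?addr0 mulN1r.
- have [ts [Nb Nb0 NbP]] := good_slice x0.
  have [e e0 He] := slice_lipschitz C0 CK Nb0 NbP; exists e => // x1 x2 h1 h12 h2.
  have := He (x1 - x0) (x2 - x0); have -> : x2 - x0 - (x1 - x0) = x2 - x1 by ring.
  have gE x : gmap f x0 ts (x - x0, 0) = circle_act ts (f (Psi x 0 0)).
    by rewrite /gmap /= (addrC x0) subrK -f_shift// addr0.
  rewrite !gE nsq_circle; apply; lra.
Qed.

End LowerBound.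

Lemma Lam_sqr_le_max_dilatation (R : realType) (lam : 'rV[R]_3 -> R) (Lam : R)
  (J0 J1 g0 g1 : 'rV[R]_4 -> 'M[R]_4) (f : 'rV[R]_4 -> 'rV[R]_4) :
  sphere_smooth lam -> 1 < Lam -> (forall x, S2 x -> 1 <= lam x <= Lam) ->
  (forall phi, lam (spherical (pi / 2) phi) = Lam) ->
  complex_structure W0bar J0 -> complex_structure (W1bar lam) J1 ->
  hermitian_metric J0 g0 -> hermitian_metric J1 g1 ->
  equivariant f -> quasiconformal g1 g0 f -> ((Lam ^+ 2)%:E <= max_dilatation g1 g0 f)%E.
Proof.
move=> ls L1 lb le J0c J1c g0h g1h ef [[finv [SS KK cf cfinv]] acl df _].
apply: le_ereal_inf_tmp => k dil.
have H K : ae_S3 (fun q => (dilatation g1 g0 f q <= K%:E)%E) -> 0 < K -> Lam ^+ 2 <= K.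
  move=> dK K0.
  apply: (Lam_sqr_le ls L1 lb le J0c J1c g0h g1h K0 (finv := finv) _ _ _ _ cf cfinv ef acl df dK) => q Sq.
  - by have [] := SS q Sq.
  - by have [] := SS q Sq.
  - by have [] := KK q Sq.
  - by have [] := KK q Sq.
have mono (k' : \bar R) : (k <= k')%E -> ae_S3 (fun q => (dilatation g1 g0 f q <= k')%E).
  move=> kk U psi lp; apply: negligibleS (dil U psi lp) => u [Uu [Su nd]]; split => //; split => // h.
  by apply: nd; exact: le_trans kk.
(* [Lam_sqr_le] asks for a positive real bound. A bound that is nonpositive or [-oo] is relaxed to
   1, which contradicts [1 < Lam]. *)
case: k dil mono => [k| |] dil mono; last 2 first.
- by rewrite leey.
- by have := H 1 (mono _ (leNye _)) ltr01; rewrite leNgt exprn_egt1.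
have [k1|k1] := ltP 0 k; first by rewrite lee_fin; exact: H.
have k1' : (k%:E <= 1%:E)%E by rewrite lee_fin; lra.
by have := H 1 (mono _ k1') ltr01; rewrite leNgt exprn_egt1.
Qed.

Theorem theorem4p3 (R : realType) (lam : 'rV[R]_3 -> R) (Lam : R)
  (lam_smooth : sphere_smooth lam)
  (Lam_gt1 : 1 < Lam)
  (lam_bounds : forall x, S2 x -> 1 <= lam x <= Lam)
  (lam_north : \forall x \near spherical 0 0, S2 x -> lam x = 1)
  (lam_south : \forall x \near spherical pi 0, S2 x -> lam x = 1)
  (lam_equator : forall phi, lam (spherical (pi / 2) phi) = Lam)
  (lam_elsewhere : forall theta phi, 0 <= theta <= pi -> theta != pi / 2 ->
     lam (spherical theta phi) < Lam)
  (J0 J1 g0 g1 : 'rV[R]_4 -> 'M[R]_4)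
  (J0_cr : complex_structure W0bar J0)
  (J1_cr : complex_structure (W1bar lam) J1)
  (g0_hermitian : hermitian_metric J0 g0)
  (g1_hermitian : hermitian_metric J1 g1) :
  [/\ equivariant (@id 'rV[R]_4),
      quasiconformal g1 g0 (@id 'rV[R]_4)
    & forall f : 'rV[R]_4 -> 'rV[R]_4,
        equivariant f -> quasiconformal g1 g0 f ->
        (max_dilatation g1 g0 id <= max_dilatation g1 g0 f)%E].
Proof.
have idK : (max_dilatation g1 g0 id <= (Lam ^+ 2)%:E)%E.
  apply: ereal_inf_lbound; apply: ae_S3_all => q Sq.
  exact: (dilatation_id lam_bounds J0_cr J1_cr g0_hermitian g1_hermitian Sq).
split.
- exact: equivariant_id.
- split; [exact: homeomorphism_id|exact: ACL_id| |].
    apply: ae_S3_all => q Sq; split; first exact: differentiable_id_S3.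
    by move=> X hX; rewrite (push_id Sq)//; case: hX.
  exact: le_lt_trans idK (ltry _).
- move=> f ef qf; apply: (le_trans idK).
  exact: (Lam_sqr_le_max_dilatation lam_smooth Lam_gt1 lam_bounds lam_equator
    J0_cr J1_cr g0_hermitian g1_hermitian ef qf).
Qed.
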